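(* Let $(G,x)$ be a planar weighted graph as in the context, with $\mathcal Z_{\mathrm{Ising}}(G,x)\neq0$. Let $e_1,\dots,e_{2n}$ be pairwise distinct oriented edges of $G$. Then the sign $\tau(P)$ defined in the context does not depend on the choices made in its definition, and $$\mathrm{Pf}\big[(\widehat K^{-1})_{e_j,e_k}\big]_{j,k=1}^{2n}=\frac{1}{\mathcal Z_{\mathrm{Ising}}(G,x)}\sum_{P\in\mathcal C(e_1,\dots,e_{2n})}\tau(P)\,x(P).$$
   Context: Planar setup. Let $G$ be a finite connected graph embedded in the plane without crossings, with every edge drawn as a straight segment. Let $x=(x_e)_{e\in E(G)}$ be edge weights. Let $\vec E(G)$ be the set of oriented edges, with origin $o(e)$, terminus $t(e)$ and reversal $\bar e$; put $x_e=x_{\bar e}$. For $t(e)=o(e')$ with $e'\ne\bar e$, let $w(e,e')\in(-\pi,\pi)$ be the oriented angle from the direction of $e$ to that of $e'$. Let $\mathcal{KW}=I-T$ with $T_{e,e'}=\exp(\tfrac i2w(e,e'))(x_ex_{e'})^{1/2}$ if $t(e)=o(e')$ and $e'\ne\bar e$, and $0$ otherwise. Let $J_{e,e'}=\delta_{\bar e,e'}$ and $K=J\mathcal{KW}$. Fix $\eta_e$ with $\eta_e^2$ the unit direction of $e$, let $U=\mathrm{diag}(\eta_e)$, and let $\widehat K=iUKU^*$ (real antisymmetric). $\mathcal E(G)$ denotes the even subgraphs, $x(P)=\prod_{e\in P}x_e$, and $\mathcal Z_{\mathrm{Ising}}(G,x)=\sum_{P\in\mathcal E(G)}x(P)$.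 Graph $G^\diamondsuit$. The graph $G^\diamondsuit$ is obtained by inserting a vertex $z_e$ at the midpoint of each edge $e$. Each of the two resulting half-edges gets weight $x_e^{1/2}$, and $x(P)$ is the product of the weights of the half-edges in $P$. Configurations. Let $\mathrm E=\{e_1,\dots,e_{2n}\}$. Then $\mathcal C(e_1,\dots,e_{2n})$ is the set of subgraphs $P$ of $G^\diamondsuit$ such that: - $P$ does not contain the half-edges $(o(e_k),z_{e_k})$; - $P$ contains $(z_{e_k},t(e_k))$ whenever $\bar e_k\notin\mathrm E$; - every vertex of $G^\diamondsuit$ other than $z_{e_1},\dots,z_{e_{2n}}$ has even degree in $P$. Sign $\tau(P)$. At each vertex, pair up the half-edges of $P$ incident to it without crossing. This decomposes $P$ as $C\sqcup\gamma_1\sqcup\dots\sqcup\gamma_n$, where $C$ is a collection of closed loops and $\gamma_1,\dots,\gamma_n$ are paths matching the half-edges $(z_{e_k},t(e_k))$. If both $e,\bar e\in\mathrm E$, the pair $e,\bar e$ is matched by an empty path. Orient each $\gamma_k$ and choose a permutation $s$ of $\{1,\dots,2n\}$ so that $\gamma_k$ runs from $z_{e_{s(2k-1)}}$ to $z_{e_{s(2k)}}$. Set $$\tau(P)=\mathrm{sign}(s)\prod_{k=1}^n\Big(i\,\bar\eta_{e_{s(2k-1)}}\eta_{e_{s(2k)}}\exp\big[-\tfrac i2\mathrm{wind}(\gamma_k)\big]\Big).$$ Here $\mathrm{wind}(\gamma_k)$ is the total rotation angle of the velocity vector of the polygonal path $\gamma_k$, i.e. the sum of its turning angles in $(-\pi,\pi)$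 at interior vertices; it is $0$ for empty paths. *)

(* Defs.v *)
From HB Require Import structures.
From mathcomp Require Import all_boot all_order all_algebra all_fingroup.
Set Implicit Arguments. Unset Strict Implicit. Unset Printing Implicit Defensive.
Import Order.TTheory GRing.Theory Num.Theory Num.Def.
Local Open Scope ring_scope.

Lemma dbl_lt n (k : 'I_n) : (k.*2 < n.*2)%N.
Proof. by rewrite ltn_double. Qed.
Lemma dbl1_lt n (k : 'I_n) : (k.*2.+1 < n.*2)%N.
Proof. by rewrite ltn_Sdouble. Qed.
Definition ev_ord n (k : 'I_n) : 'I_(n.*2) := Ordinal (dbl_lt k).
Definition od_ord n (k : 'I_n) : 'I_(n.*2) := Ordinal (dbl1_lt k).

Definition pfaffian (R : numFieldType) n (A : 'M[R]_(n.*2)) : R :=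
  ((2 ^ n * n`!)%:R)^-1 *
  \sum_(s : 'S_(n.*2)) (-1) ^+ s * \prod_(k < n) A (s (ev_ord k)) (s (od_ord k)).

Section Ising.
(* The plane is the numerically closed field C (for C = complex numbers
   this is the usual plane); vertices are placed at pos v. *)
Variables (C : numClosedFieldType) (V E : finType) (pos : V -> C)
          (ends : E -> V * V).

Local Notation dart := (E * bool)%type.

Definition org (d : dart) : V := if d.2 then (ends d.1).1 else (ends d.1).2.
Definition ter (d : dart) : V := if d.2 then (ends d.1).2 else (ends d.1).1.
Definition rev (d : dart) : dart := (d.1, ~~ d.2).

Definition udir (d : dart) : C :=
  let z := pos (ter d) - pos (org d) in z / `|z|.

(* exp(i w/2) for a unit z = exp(i w) with w in (-pi,pi):
   the square root of z with positive real part *)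
Definition halfexp (z : C) : C :=
  if 0 < 'Re (sqrtC z) then sqrtC z else - sqrtC z.
Definition hw (d d' : dart) : C := halfexp (udir d' / udir d).

Definition seg (a b z : C) : Prop :=
  exists t : C, [/\ 0 <= t, t <= 1 & z = a + t * (b - a)].
Definition endpt (v : V) (f : E) : bool :=
  ((ends f).1 == v) || ((ends f).2 == v).
Definition eseg (f : E) (z : C) : Prop := seg (pos (ends f).1) (pos (ends f).2) z.

Definition planar_embedding : Prop :=
  [/\ forall f : E, (ends f).1 != (ends f).2,
      injective pos,
      forall f g z, f != g -> eseg f z -> eseg g z ->
        exists v, [/\ endpt v f, endpt v g & z = pos v]
    & forall v f, eseg f (pos v) -> endpt v f].

Definition adjacent : rel V :=
  fun a b => [exists f : E, (ends f == (a, b)) || (ends f == (b, a))].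
Definition connected_graph : Prop := forall a b : V, connect adjacent a b.

(* y f is the chosen square root x_f^(1/2) of the weight x_f = y f ^+ 2 *)
Variables (y : E -> C) (eta : dart -> C).

Definition Tentry (d d' : dart) : C :=
  if (ter d == org d') && (d' != rev d) then hw d d' * (y d.1 * y d'.1) else 0.

Local Notation N := #|{: dart}|.
Local Notation dv i := (enum_val (i : 'I_N) : dart).

Definition KWmx : 'M[C]_N :=
  \matrix_(i, j) ((dv i == dv j)%:R - Tentry (dv i) (dv j)).
Definition Jmx : 'M[C]_N := \matrix_(i, j) (rev (dv i) == dv j)%:R.
Definition Kmx : 'M[C]_N := Jmx *m KWmx.
Definition Umx : 'M[C]_N := \matrix_(i, j) (if i == j then eta (dv i) else 0).
Definition Khat : 'M[C]_N := 'i *: (Umx *m Kmx *m (map_mx conjC Umx)^T).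
Definition Khat_inv (d d' : dart) : C := invmx Khat (enum_rank d) (enum_rank d').

Definition even_sub (S : {set E}) : bool :=
  [forall v : V, ~~ odd #|[set f in S | endpt v f]|].
Definition Z_Ising : C := \sum_(S : {set E} | even_sub S) \prod_(f in S) y f ^+ 2.

(* A subgraph of G^diamond is a set P of darts: the dart d stands for the
   half-edge [z_d, ter d] (of weight y d.1). *)
Variables (n : nat) (e : 'I_(n.*2) -> dart).

Definition marked (d : dart) : bool := [exists i, e i == d].

Definition in_config (P : {set dart}) : bool :=
  [&& [forall i, rev (e i) \notin P],
      [forall i, ~~ marked (rev (e i)) ==> (e i \in P)],
      [forall v : V, ~~ odd #|[set d in P | ter d == v]|]
    & [forall f : E, ~~ (marked (f, true) || marked (f, false)) ==>
                      (((f, true) \in P) == ((f, false) \in P))]].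

Definition configs : {set {set dart}} := [set P | in_config P].

Definition xw (P : {set dart}) : C := \prod_(d in P) y d.1.

(* cyclic order of unit directions: starting from direction a and turning
   counterclockwise, z is met strictly before w (z, w <> a) *)
Definition upper (r : C) : bool := (0 < 'Im r) || (('Im r == 0) && ('Re r < 0)).
Definition ccw_before (a z w : C) : bool :=
  let r1 := z / a in let r2 := w / a in
  if upper r1 == upper r2 then 0 < 'Im (r1^* * r2) else upper r1.
(* half-edges at a common vertex v: the half-edge of dart d leaves v in the
   direction udir (rev d). Pairs {a,b} and {c,d} cross iff c, d are
   separated by a, b in the cyclic order. *)
Definition crossing (a b c d : dart) : bool :=
  let inarc z := ccw_before (udir (rev a)) (udir (rev z)) (udir (rev b)) in
  inarc c != inarc d.

Definition pairing (P : {set dart}) (pi : dart -> dart) : Prop :=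
  forall d, d \in P -> [/\ pi d \in P, ter (pi d) = ter d, pi d <> d & pi (pi d) = d].
Definition noncrossing (P : {set dart}) (pi : dart -> dart) : Prop :=
  forall a b, a \in P -> b \in P -> ter a = ter b -> b <> a -> b <> pi a ->
    ~~ crossing a (pi a) b (pi b).

(* a path from z_ea to z_eb, written as the sequence of darts followed
   c_0 = ea, c_1, ..., c_m, c_{m+1} = rev eb (c_1..c_m full unmarked edges) *)
Definition walk (P : {set dart}) (pi : dart -> dart) (c : seq dart) (ea eb : dart) : Prop :=
  [/\ (2 <= size c)%N, nth ea c 0 = ea, last ea c = rev eb,
      forall i, (i.+1 < size c)%N ->
        nth ea c i \in P /\ nth ea c i.+1 = rev (pi (nth ea c i))
    & forall i, (0 < i)%N -> (i.+1 < size c)%N ->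
        ~~ marked (nth ea c i) /\ ~~ marked (rev (nth ea c i))].

(* i conj(eta_ea) eta_eb exp(-i wind/2); wind = sum of turning angles *)
Definition path_factor (c : seq dart) (ea eb : dart) : C :=
  'i * (eta ea)^* * eta eb *
  \prod_(i < (size c).-1) (hw (nth ea c i) (nth ea c i.+1))^-1.

(* the choices: pairing at vertices, permutation s (encoding also the
   orientations), and the paths gamma_k *)
Definition choice_t : Type :=
  ((dart -> dart) * 'S_(n.*2) * ('I_n -> seq dart))%type.

Definition valid_choice (P : {set dart}) (ch : choice_t) : Prop :=
  let: (pi, s, g) := ch in
  [/\ pairing P pi, noncrossing P pi &
      forall k : 'I_n,
        let ea := e (s (ev_ord k)) in let eb := e (s (od_ord k)) in
        (g k = [::] /\ eb = rev ea) \/ walk P pi (g k) ea eb].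

Definition tau (ch : choice_t) : C :=
  let: (pi, s, g) := ch in
  (-1) ^+ s * \prod_(k < n) path_factor (g k) (e (s (ev_ord k))) (e (s (od_ord k))).

Definition Kinv_sub : 'M[C]_(n.*2) := \matrix_(j, k) Khat_inv (e j) (e k).

End Ising.

(* Main.v *)
(** Conjugating by the square roots of the directions turns the Kac-Ward matrix
    into an antisymmetric one, real up to the weights; measuring heights in a generic
    direction, one can conjugate further by signs so that every entry is, up to weights, the sign of
    a comparison of two darts for one total order: by height of the origin, then
    by slope.  Border this matrix with the 2n unit vectors of the marked darts.
    A Schur complement gives Z * kappa * Pf (K^-1) for the Pfaffian of the bordered
    matrix, and multilinearity expands it over subgraphs P of G^diamond, with zero
    contribution unless P is a configuration.  For a configuration, the entries at
    each vertex decouple along any noncrossing pairing (the two darts of an innermost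
    pair have proportional rows), so the Pfaffian becomes that of a perfect matching.
    Elementary exchange moves peel the paths off this matching, dart by dart; the
    factors collected are those of tau P.  The remaining loops always contribute the
    same sign kappa: two edges produce the sign telling how their endpoints lie to
    the left or right of each other, and these signs cancel because all degrees
    are even.  So no winding numbers of closed curves have to be computed.  Since
    the Pfaffian and kappa do not depend on the choices made for P, nor does tau P. *)

Require Import Defs.
From HB Require Import structures.
From mathcomp Require Import all_boot all_order all_algebra all_fingroup.
From mathcomp Require Import ring lra zify.
Import Order.TTheory GRing.Theory Num.Theory Num.Def.
Local Open Scope ring_scope.
Set Implicit Arguments.
Unset Strict Implicit.
Unset Printing Implicit Defensive.

(** * Pfaffians *)

(** The decoupling of an innermost pair is applied to two different forms. In the form of a
    configuration, entries between distinct vertices vanish; in the sign form of a total order on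
    all rows, no off-diagonal entry vanishes. Once the paths are peeled off, both collapse to the
    same perfect matching, because the loop darts leaving one vertex are consecutive in the order
    and so compare alike with everything else. Hence the Pfaffian of a union of loops is, up to the
    gauge signs, the sign of a sorting permutation. That sign is a product over pairs of rows, so it
    can be evaluated one pair of edges at a time.

    Genericity of the direction means that distinct vertices have distinct heights. No edge is then
    horizontal, directions stay off the branch cut of the square root, and each edge is a graph over
    an interval of heights, where an intermediate value argument compares two edges.

    The signs due to the numbering of the rows and to the gauge are all gathered in [kappa], which
    occurs on both sides and cancels. Invertibility of [Khat] comes from the same computation: a
    kernel vector would make [Z_Ising] times [kappa] vanish. *)

Lemma half_ord_lt n (i : 'I_(n.*2)) : (i./2 < n)%N.
Proof. by rewrite ltn_half_double. Qed.
Definition half_ord n (i : 'I_(n.*2)) : 'I_n := Ordinal (half_ord_lt i).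
Definition dbl_ord n (kb : 'I_n * bool) : 'I_(n.*2) :=
  if kb.2 then od_ord kb.1 else ev_ord kb.1.

Lemma dbl_ordK n : cancel (@dbl_ord n) (fun i => (half_ord i, odd i)).
Proof.
case=> k b; apply/eqP; rewrite -pair_eqE /= -val_eqE /dbl_ord /=; case: b.
  by rewrite /= uphalf_double odd_double !eqxx.
by rewrite /= doubleK odd_double !eqxx.
Qed.

Lemma half_ordK n : cancel (fun i : 'I_(n.*2) => (half_ord i, odd i)) (@dbl_ord n).
Proof.
move=> i; apply: val_inj; rewrite /dbl_ord /=.
by rewrite -[RHS]odd_double_half; case: (odd i).
Qed.

Lemma dbl_ord_bij n : bijective (@dbl_ord n).
Proof. exact: Bijective (@dbl_ordK n) (@half_ordK n). Qed.

Lemma half_ev n (k : 'I_n) : half_ord (ev_ord k) = k.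
Proof. by have [] := dbl_ordK (k, false). Qed.
Lemma half_od n (k : 'I_n) : half_ord (od_ord k) = k.
Proof. by have [] := dbl_ordK (k, true). Qed.

Lemma ev_od_neq n (k l : 'I_n) : (ev_ord k == od_ord l) = false.
Proof.
apply/negbTE; apply/eqP => /(congr1 val)/(congr1 odd) /=.
by rewrite !odd_double.
Qed.
Lemma ev_inj n : injective (@ev_ord n).
Proof. by move=> k l /(congr1 (@half_ord n)); rewrite !half_ev. Qed.
Lemma od_inj n : injective (@od_ord n).
Proof. by move=> k l /(congr1 (@half_ord n)); rewrite !half_od. Qed.

Lemma ev_odP n (i : 'I_(n.*2)) : (exists k, i = ev_ord k) \/ (exists k, i = od_ord k).
Proof.
rewrite -[i]half_ordK /dbl_ord /=.
by case: (odd i); [right | left]; exists (half_ord i).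
Qed.

Lemma big_ev_od (R : Type) (idx : R) (op : Monoid.com_law idx) n
    (F : 'I_(n.*2) -> R) :
  \big[op/idx]_i F i = \big[op/idx]_(k < n) op (F (ev_ord k)) (F (od_ord k)).
Proof.
rewrite (reindex (@dbl_ord n)) /=; last exact/onW_bij/dbl_ord_bij.
rewrite (eq_bigr (fun p => F (dbl_ord (p.1, p.2)))); last by case.
rewrite -(pair_bigA _ (fun k b => F (dbl_ord (k, b)))) /=.
by apply: eq_bigr => k _; rewrite big_bool Monoid.mulmC.
Qed.

Lemma ltn_ev_ev n (k l : 'I_n) : (ev_ord k < ev_ord l)%N = (k < l)%N.
Proof. by rewrite /= ltn_double. Qed.
Lemma ltn_od_od n (k l : 'I_n) : (od_ord k < od_ord l)%N = (k < l)%N.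
Proof. by rewrite /= ltnS ltn_double. Qed.
Lemma ltn_ev_od n (k l : 'I_n) : (ev_ord k < od_ord l)%N = (k <= l)%N.
Proof. by rewrite /= ltnS leq_double. Qed.
Lemma ltn_od_ev n (k l : 'I_n) : (od_ord k < ev_ord l)%N = (k < l)%N.
Proof. by rewrite /= ltn_Sdouble. Qed.

Section Sign.
Variable R : comPzRingType.

(** Grouping by blocks of two consecutive indices brings together the four comparisons between two
    blocks; the cancellations take place inside these groups. *)
Lemma prod_lt_ev_od n (f : 'I_(n.*2) -> 'I_(n.*2) -> R) :
  \prod_(i : 'I_(n.*2)) \prod_(j : 'I_(n.*2) | (i < j)%N) f i j =
  \prod_(k < n) f (ev_ord k) (od_ord k) *
  \prod_(k < n) \prod_(l < n | (k < l)%N)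
    (f (ev_ord k) (ev_ord l) * f (ev_ord k) (od_ord l) *
     (f (od_ord k) (ev_ord l) * f (od_ord k) (od_ord l))).
Proof.
rewrite big_ev_od -big_split; apply: eq_bigr => k _.
have E (i : 'I_(n.*2)) : \prod_(j : 'I_(n.*2) | (i < j)%N) f i j =
   \prod_(l < n | (i < ev_ord l)%N) f i (ev_ord l) *
   \prod_(l < n | (i < od_ord l)%N) f i (od_ord l).
  by rewrite big_mkcond big_ev_od big_split -!big_mkcond.
rewrite !E (eq_bigl _ _ (fun l => ltn_ev_ev k l)) (eq_bigl _ _ (fun l => ltn_ev_od k l)).
rewrite (eq_bigl _ _ (fun l => ltn_od_ev k l)) (eq_bigl _ _ (fun l => ltn_od_od k l)).
have -> : \prod_(l < n | (k <= l)%N) f (ev_ord k) (od_ord l) =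
          f (ev_ord k) (od_ord k) * \prod_(l < n | (k < l)%N) f (ev_ord k) (od_ord l).
  rewrite (bigD1 k) //=; congr (_ * _).
  by apply: eq_bigl => i; rewrite andbC eq_sym -ltn_neqAle.
by rewrite !big_split /= -!mulrA mulrCA.
Qed.
End Sign.

(** The Vandermonde determinant at the nodes [s i] is evaluated in two ways: permuting columns
    produces the sign of [s], and the product formula produces one sign per inversion. *)
Lemma sign_inversions (R : numDomainType) n (s : 'S_n) :
  \prod_(i : 'I_n) \prod_(j : 'I_n | (i < j)%N) (if (s i < s j)%N then 1 else -1) =
  (-1) ^+ s :> R.
Proof.
pose a : 'rV[int]_n := \row_i i%:Z.
have detV : \det (Vandermonde n a) != 0.
  rewrite det_Vandermonde; apply/prodf_neq0 => i _; apply/prodf_neq0 => j ij.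
  by rewrite !mxE subr_eq0 eqz_nat gtn_eqF.
have E : \det (Vandermonde n (\row_i (s i)%:Z)) = (-1) ^+ s * \det (Vandermonde n a).
  have -> : Vandermonde n (\row_i (s i)%:Z) = col_perm s (Vandermonde n a).
    by apply/matrixP=> i j; rewrite !mxE.
  by rewrite col_permE det_mulmx det_perm odd_permV mulrC.
have sgE m (b : 'rV[int]_n) (sb : forall i, b 0 i = (m i : nat)%:Z) :
  injective m -> sgz (\det (Vandermonde n b)) =
  \prod_(i : 'I_n) \prod_(j : 'I_n | (i < j)%N) (if (m i < m j)%N then 1 else -1).
  move=> m_inj; rewrite det_Vandermonde.
  rewrite (big_morph (@sgz int) (@sgzM _) (@sgz1 _)); apply: eq_bigr => i _.
  rewrite (big_morph (@sgz int) (@sgzM _) (@sgz1 _)); apply: eq_bigr => j ij.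
  rewrite !sb; case: ltngtP => [lt|gt|/m_inj eq].
  - by rewrite gtr0_sgz // subr_gt0 ltz_nat.
  - by rewrite ltr0_sgz // subr_lt0 ltz_nat.
  - by rewrite eq ltnn in ij.
have := congr1 (@sgz int) E; rewrite sgzM (sgE (fun i => s i)); first last.
- by move=> i j /val_inj/perm_inj.
- by move=> i; rewrite mxE.
rewrite (sgE (fun i => i)); first last.
- exact: val_inj.
- by move=> i; rewrite mxE.
rewrite [X in _ = _ * X]big1; last by move=> i _; rewrite big1 // => j ->.
rewrite mulr1 => /(congr1 (fun z => z%:~R : R)).
rewrite rmorph_prod /= => E2.
transitivity ((sgz ((-1 : int) ^+ s))%:~R : R).
  rewrite -E2; apply: eq_bigr => i _; rewrite rmorph_prod /=.
  by apply: eq_bigr => j _; case: ifP.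
by case: (odd_perm s).
Qed.

Lemma sum_sign_prod (R : comPzRingType) n (B : 'M[R]_n) (g : 'I_n -> 'I_n) :
  \sum_(s : 'S_n) (-1) ^+ s * \prod_i B (s i) (g i) =
  \det (\matrix_(i, j) B i (g j)).
Proof.
rewrite -det_tr /determinant; apply: eq_bigr => s _; congr (_ * _).
by apply: eq_bigr => i _; rewrite !mxE.
Qed.

(** Expanding every entry of the congruence chooses a function [g] from rows to columns of [B]. For
    fixed [g], the sum over [s] is the determinant of the chosen columns, which vanishes unless [g]
    is a permutation. *)
Lemma pfaffian_congr (R : numFieldType) n (A B : 'M[R]_(n.*2)) :
  pfaffian (B *m A *m B^T) = \det B * pfaffian A.
Proof.
rewrite /pfaffian [RHS]mulrCA; congr (_ * _).
pose F (s : 'S_(n.*2)) (g : {ffun 'I_(n.*2) -> 'I_(n.*2)}) :=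
  (-1) ^+ s * ((\prod_i B (s i) (g i)) *
     \prod_k A (g (ev_ord k)) (g (od_ord k))).
transitivity (\sum_s \sum_g F s g).
  apply: eq_bigr => s _.
  have E k : (B *m A *m B^T) (s (ev_ord k)) (s (od_ord k)) =
     \sum_(ij : 'I_(n.*2) * 'I_(n.*2))
       B (s (ev_ord k)) ij.1 * B (s (od_ord k)) ij.2 * A ij.1 ij.2.
    rewrite mxE -(pair_bigA _ (fun i j =>
      B (s (ev_ord k)) i * B (s (od_ord k)) j * A i j)) exchange_big /=.
    apply: eq_bigr => j _; rewrite !mxE mulr_suml; apply: eq_bigr => i _.
    by rewrite mulrAC.
  rewrite (eq_bigr _ (fun k _ => E k)) bigA_distr_bigA /= mulr_sumr.
  (* A choice of a pair of indices for each block is the same as a choice of one index for each of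
     the [n.*2] rows. *)
  pose f2g (f : {ffun 'I_n -> 'I_(n.*2) * 'I_(n.*2)}) : {ffun 'I_(n.*2) -> 'I_(n.*2)} :=
    [ffun i : 'I_(n.*2) => if odd i then (f (half_ord i)).2 else (f (half_ord i)).1].
  pose g2f (g : {ffun 'I_(n.*2) -> 'I_(n.*2)}) :
    {ffun 'I_n -> 'I_(n.*2) * 'I_(n.*2)} := [ffun k => (g (ev_ord k), g (od_ord k))].
  rewrite (reindex g2f) /=; last first.
    exists f2g => [g _ | f _]; apply/ffunP => x; rewrite !ffunE.
      by have := half_ordK x; rewrite /dbl_ord /=; case: (odd x) => /= ->.
    by rewrite !half_ev !half_od /= odd_double /=; case: (f x).
  apply: eq_bigr => g _; rewrite /F; congr (_ * _).
  by rewrite big_split /= big_ev_od; congr (_ * _); apply: eq_bigr => k _; rewrite !ffunE.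
rewrite exchange_big /=.
transitivity (\sum_(g : {ffun 'I_(n.*2) -> 'I_(n.*2)}) \det (\matrix_(i, j) B i (g j)) *
     \prod_(k < n) A (g (ev_ord k)) (g (od_ord k))).
  apply: eq_bigr => g _; rewrite -sum_sign_prod mulr_suml.
  by apply: eq_bigr => s _; rewrite /F mulrA.
rewrite (bigID (fun g : {ffun 'I_(n.*2) -> 'I_(n.*2)} => injectiveb g)) /= [X in _ + X]big1 ?addr0; last first.
  move=> g /injectivePn[i [j ij gij]].
  rewrite -det_tr (determinant_alternate ij) ?mul0r // => k.
  by rewrite !mxE gij.
rewrite (reindex (fun s : 'S_(n.*2) => pval s)) /=; last first.
  have s0 : 'S_(n.*2) := 1%g; exists (insubd s0) => /= [s _ | g /=  inj_g].
    by apply: val_inj; rewrite /= insubdK // -topredE /= (valP s).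
  by rewrite insubdK.
rewrite mulr_sumr; apply: eq_big => [s | s _]; first by rewrite (valP s).
have -> : (\matrix_(i, j) B i ((pval s) j)) = col_perm s B.
  by apply/matrixP=> i j; rewrite !mxE pvalE.
rewrite col_permE det_mulmx det_perm odd_permV mulrA; congr (_ * _).
by apply: eq_bigr => k _; rewrite pvalE.
Qed.

Lemma pfaffian_perm (R : numFieldType) n (A : 'M[R]_(n.*2)) (s : 'S_(n.*2)) :
  pfaffian (\matrix_(i, j) A (s i) (s j)) = (-1) ^+ s * pfaffian A.
Proof.
rewrite /pfaffian [RHS]mulrCA; congr (_ * _).
rewrite mulr_sumr [RHS](reindex_inj (mulIg s)) /=; apply: eq_bigr => t _.
rewrite odd_permM addbC signr_addb -[_ * _ * _]mulrA signrMK.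
by congr (_ * _); apply: eq_bigr => k _; rewrite !mxE !permM.
Qed.

(** [B] is block triangular, with an identity block on [D] and a diagonal block off [D]. A
    permutation moving [i] meets a zero in row [i], or else sends [i] into [D] and meets one in row
    [s i], which it moves too. *)
Lemma det_unitriangular (R : comPzRingType) n (B : 'M[R]_n) (D : pred 'I_n) :
  (forall i j, D i -> B i j = (i == j)%:R) ->
  (forall i j, ~~ D i -> ~~ D j -> i != j -> B i j = 0) ->
  \det B = \prod_i B i i.
Proof.
move=> BD BnD; rewrite /determinant (bigD1 1%g) //= odd_perm1 mul1r.
rewrite [X in _ + X]big1 ?addr0 => [|s s1].
  by apply: eq_bigr => i _; rewrite perm1.
have [i si] : exists i, s i != i.
  apply/existsP; apply: contraR s1; rewrite negb_exists => /forallP s1.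
  by apply/eqP/permP => i; rewrite perm1; have /negPn/eqP := s1 i.
have [j Bj] : exists j, B j (s j) = 0.
  case Di: (D i); first by exists i; rewrite BD // eq_sym (negbTE si).
  case Dsi: (D (s i)); last by exists i; rewrite BnD ?Di ?Dsi // eq_sym.
  exists (s i); rewrite BD // [_ == _]negbTE //.
  by rewrite eq_sym (inj_eq perm_inj).
by rewrite (bigD1 j) //= Bj mul0r mulr0.
Qed.

Section IndexedPfaffian.
Variables (R : numFieldType) (T : finType) (m : nat) (h : 'I_(m.*2) -> T).
Hypothesis h_bij : bijective h.
Implicit Types (A B : T -> T -> R).

(* The bijection [h] fixes an order of the index type, hence the sign of the Pfaffian. *)
Definition PF A := pfaffian (\matrix_(i, j) A (h i) (h j)).

Definition antisym A := forall z w, A w z = - A z w.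

Lemma antisym_diag A z : antisym A -> A z z = 0.
Proof.
move=> /(_ z z) /eqP; rewrite -addr_eq0 -mulr2n -mulr_natr mulf_eq0 pnatr_eq0 orbF.
by move/eqP.
Qed.

Let h_inj : injective h := bij_inj h_bij.

Lemma PF_terms A A' :
  (forall s : 'S_(m.*2),
     \prod_k A (h (s (ev_ord k))) (h (s (od_ord k))) =
     \prod_k A' (h (s (ev_ord k))) (h (s (od_ord k)))) -> PF A = PF A'.
Proof.
move=> E; congr (_ * _); apply: eq_bigr => s _; congr (_ * _).
transitivity (\prod_k A (h (s (ev_ord k))) (h (s (od_ord k)))).
  by apply: eq_bigr => k _; rewrite mxE.
by rewrite E; apply: eq_bigr => k _; rewrite mxE.
Qed.

Lemma eq_PF A A' : (forall z w, A z w = A' z w) -> PF A = PF A'.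
Proof. by move=> E; apply: PF_terms => s; apply: eq_bigr => k _. Qed.

Lemma block_of (s : 'S_(m.*2)) z :
  exists k, z = h (s (ev_ord k)) \/ z = h (s (od_ord k)).
Proof.
have [h' hK h'K] := h_bij; pose i := (s^-1)%g (h' z).
have -> : z = h (s i) by rewrite permKV h'K.
by case: (ev_odP i) => [[k ->]|[k ->]]; exists k; [left | right].
Qed.

(** An odd set cannot be perfectly matched within itself, so each term contains an entry that leaves
    [W]. *)
Lemma PF_odd A (W : {set T}) : odd #|W| ->
  (forall z w, (z \in W) != (w \in W) -> A z w = 0) -> PF A = 0.
Proof.
move=> oddW AW; rewrite /PF /pfaffian big1 ?mulr0 // => s _.
have [k] : exists k, (h (s (ev_ord k)) \in W) != (h (s (od_ord k)) \in W).
  apply/existsP; apply: contraLR oddW; rewrite negb_exists => /forallP WE.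
  have -> : #|W| = (\sum_(i : 'I_(m.*2)) (h (s i) \in W))%N.
    rewrite -sum1_card big_mkcond /=.
    rewrite (reindex h) /=; last exact: onW_bij.
    rewrite (reindex_inj (@perm_inj _ s)) /=; apply: eq_bigr => i _.
    by case: (_ \in W).
  rewrite big_ev_od /= (eq_bigr (fun k => (h (s (ev_ord k)) \in W).*2)).
    elim/big_rec: _ => //= k x _; rewrite oddD odd_double => /negbTE ->.
    by [].
  by move=> k _; have /negPn/eqP <- := WE k; rewrite addnn.
by move=> /AW E; rewrite (bigD1 k) //= mxE E mul0r mulr0.
Qed.

Lemma PF_row0 A z : (forall w, A z w = 0) -> (forall w, A w z = 0) -> PF A = 0.
Proof.
move=> A1 A2; apply: (@PF_odd _ [set z]); first by rewrite cards1.
by move=> a b; rewrite !inE; case: (eqVneq a z) => [->|_]; case: (eqVneq b z) => [->|_].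
Qed.

Lemma PF_congr A B :
  PF (fun z w => \sum_a \sum_b B z a * A a b * B w b) =
  \det (\matrix_(i, j) B (h i) (h j)) * PF A.
Proof.
rewrite /PF -pfaffian_congr; congr (pfaffian _); apply/matrixP=> i j.
rewrite !mxE exchange_big /= (reindex h) /=; last exact: onW_bij.
apply: eq_bigr => k _; rewrite !mxE mulr_suml (reindex h) /=; last exact: onW_bij.
by apply: eq_bigr => l _; rewrite !mxE.
Qed.

Lemma PF_unitriangular A B (D : pred T) :
  (forall z w, D z -> B z w = (z == w)%:R) ->
  (forall z w, ~~ D z -> ~~ D w -> z != w -> B z w = 0) ->
  PF (fun z w => \sum_a \sum_b B z a * A a b * B w b) = (\prod_z B z z) * PF A.
Proof.
move=> BD BnD; rewrite PF_congr (@det_unitriangular _ _ _ (fun i => D (h i))).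
- by rewrite (reindex h (onW_bij _ h_bij)); under eq_bigr do rewrite mxE.
- by move=> i j Di; rewrite mxE BD // (inj_eq h_inj).
- by move=> i j Di Dj ij; rewrite mxE BnD // (inj_eq h_inj).
Qed.

(** Replacing row and column [z0] by the combination [u] multiplies the Pfaffian by [u z0] and
    creates a zero row. *)
Lemma PF_singular A (u : T -> R) z0 : antisym A -> u z0 != 0 ->
  (forall w, \sum_z u z * A z w = 0) -> PF A = 0.
Proof.
move=> Aas uz0 uA.
pose B z w := if z == z0 then u w else (z == w)%:R.
pose A1 z w := \sum_a \sum_b B z a * A a b * B w b.
have row0 w : A1 z0 w = 0.
  rewrite /A1 exchange_big big1 // => b _; rewrite -mulr_suml.
  by rewrite {1}/B eqxx uA mul0r.
have A1as : antisym A1.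
  move=> z w; rewrite /A1 exchange_big /= -sumrN; apply: eq_bigr => a _.
  by rewrite -sumrN; apply: eq_bigr => b _; rewrite Aas; ring.
have : PF A1 = (\prod_z B z z) * PF A.
  apply: (@PF_unitriangular A B (predC1 z0)) => [z w /= /negbTE zz0|z w /=].
    by rewrite /B zz0.
  by rewrite !negbK => /eqP -> /eqP ->; rewrite eqxx.
rewrite (@PF_row0 A1 z0) //; last by move=> w; rewrite A1as row0 oppr0.
rewrite (bigD1 z0) //= big1 => [|z /negbTE zz0]; last by rewrite /B zz0 eqxx.
rewrite mulr1 /B eqxx => /esym/eqP; rewrite mulf_eq0 (negbTE uz0) /=.
by move/eqP.
Qed.

Lemma PF_scale A (c : T -> R) :
  PF (fun z w => c z * c w * A z w) = (\prod_z c z) * PF A.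
Proof.
rewrite /PF /pfaffian [RHS]mulrCA; congr (_ * _).
rewrite mulr_sumr; apply: eq_bigr => s _; rewrite [RHS]mulrCA; congr (_ * _).
rewrite (reindex h (onW_bij _ h_bij)) (reindex_inj (@perm_inj _ s)) /= big_ev_od -big_split.
by apply: eq_bigr => k _; rewrite !mxE.
Qed.

Lemma PF_tperm A a b : a != b ->
  PF (fun z w => A (tperm a b z) (tperm a b w)) = - PF A.
Proof.
move=> ab; have [h' hK h'K] := h_bij.
have E i : tperm a b (h i) = h (tperm (h' a) (h' b) i).
  have := inj_tperm (h' a) (h' b) i h_inj; rewrite !h'K => ->.
  by [].
rewrite /PF; transitivity ((-1) ^+ tperm (h' a) (h' b) * PF A).
  rewrite -pfaffian_perm; congr (pfaffian _); apply/matrixP=> i j.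
  by rewrite !mxE !E.
by rewrite odd_tperm (can_eq h'K) ab mulN1r.
Qed.

(** In both forms [z] and [z'] see only each other, so the terms that do not pair them vanish, and
    the others agree factor by factor. *)
Lemma PF_pin A A' z z' : z != z' ->
  (forall w, w != z' -> [/\ A z w = 0, A w z = 0, A' z w = 0 & A' w z = 0]) ->
  A z z' = A' z z' -> A z' z = A' z' z ->
  (forall a b, a != z -> a != z' -> b != z -> b != z' -> A a b = A' a b) ->
  PF A = PF A'.
Proof.
move=> zz' A0 Az Az' AA'; apply: PF_terms => s.
have [k zk] := block_of s z.
have neq l : l != k -> [/\ h (s (ev_ord l)) != h (s (ev_ord k)),
   h (s (od_ord l)) != h (s (od_ord k)), h (s (ev_ord l)) != h (s (od_ord k))
   & h (s (od_ord l)) != h (s (ev_ord k))].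
  move=> lk; rewrite !(inj_eq h_inj) !(inj_eq perm_inj) (inj_eq (@ev_inj _)).
  by rewrite (inj_eq (@od_inj _)) lk [od_ord l == _]eq_sym !ev_od_neq.
rewrite (bigD1 k) //= [RHS](bigD1 k) //=.
have rest x y : (x = h (s (ev_ord k)) /\ y = h (s (od_ord k))) \/
    (y = h (s (ev_ord k)) /\ x = h (s (od_ord k))) -> z = x -> z' = y ->
    \prod_(l < m | l != k) A (h (s (ev_ord l))) (h (s (od_ord l))) =
    \prod_(l < m | l != k) A' (h (s (ev_ord l))) (h (s (od_ord l))).
  move=> xy zx zy; apply: eq_bigr => l /neq [n1 n2 n3 n4].
  by case: xy => [[ex ey]|[ex ey]]; apply: AA'; rewrite ?zx ?zy ?ex ?ey.
case: zk => zk.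
  case: (eqVneq (h (s (od_ord k))) z') => [e|/A0 []]; last first.
    by rewrite zk => -> _ -> _; rewrite !mul0r.
  rewrite (rest z z') //; first by rewrite -zk e Az.
  by left.
case: (eqVneq (h (s (ev_ord k))) z') => [e|/A0 []]; last first.
  by rewrite zk => _ -> _ ->; rewrite !mul0r.
rewrite (rest z z') //; first by rewrite -zk e Az'.
by right.
Qed.
End IndexedPfaffian.

(** * Block permutations and the normalisation of the Pfaffian *)

Lemma ltn_half_ord n (i j : 'I_(n.*2)) :
  half_ord i != half_ord j -> (i < j)%N = (half_ord i < half_ord j)%N.
Proof.
rewrite -val_eqE /= => ij.
rewrite -[in LHS](odd_double_half i) -[in LHS](odd_double_half j).
by move: ij; case: (odd i); case: (odd j) => /=; lia.
Qed.

Lemma half_odd_inj n (i j : 'I_(n.*2)) :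
  half_ord i = half_ord j -> odd i = odd j -> i = j.
Proof. by move=> e1 e2; rewrite -[i]half_ordK -[j]half_ordK e1 e2. Qed.

Section Std.
Variable R : numFieldType.

(** The direct sum of [n] copies of the 2 by 2 symplectic block; it serves as the reference of
    Pfaffian 1. *)
Definition std_form n (i j : 'I_(n.*2)) : R :=
  if half_ord i == half_ord j then (if (i < j)%N then 1 else if (j < i)%N then -1 else 0) else 0.

Section Count.
Variable n : nat.

Definition block_perm_fun (p : 'S_n) (b : {ffun 'I_n -> bool}) (i : 'I_(n.*2)) :=
  dbl_ord (p (half_ord i), odd i (+) b (half_ord i)).

Lemma block_perm_inj p b : injective (block_perm_fun p b).
Proof.
move=> i j /(can_inj (@dbl_ordK n)) [/perm_inj e1]; rewrite e1 => /addIb e2.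
exact: half_odd_inj.
Qed.

Definition block_perm (pb : 'S_n * {ffun 'I_n -> bool}) : 'S_(n.*2) :=
  perm (@block_perm_inj pb.1 pb.2).

Definition block_perms : {set 'S_(n.*2)} :=
  [set s : 'S_(n.*2) | [forall k, half_ord (s (ev_ord k)) == half_ord (s (od_ord k))]].

Lemma half_dbl (kb : 'I_n * bool) : half_ord (dbl_ord kb) = kb.1.
Proof. by have := dbl_ordK kb; case: kb => k b [-> _]. Qed.
Lemma odd_dbl (kb : 'I_n * bool) : odd (dbl_ord kb) = kb.2.
Proof. by have := dbl_ordK kb; case: kb => k b [_ ->]. Qed.

Lemma block_permsE : block_perms = block_perm @: setT.
Proof.
apply/setP => s; rewrite inE; apply/idP/imsetP => [/forallP sH|[pb _ ->]]; last first.
  apply/forallP => k; rewrite !permE /block_perm_fun !half_dbl /=.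
  by rewrite half_ev half_od.
have p_inj : injective (fun k => half_ord (s (ev_ord k))).
  move=> k l e; apply/eqP/negPn/negP => kl.
  have /eqP sk := sH k; have /eqP sl := sH l.
  have n1 : odd (s (ev_ord k)) != odd (s (ev_ord l)).
    by apply: contra kl => /eqP o; have /perm_inj/ev_inj -> := half_odd_inj e o.
  have n2 : odd (s (od_ord k)) != odd (s (ev_ord l)).
    apply/negP => /eqP o; have := half_odd_inj (etrans (esym sk) e) o.
    by move/perm_inj/eqP; rewrite eq_sym ev_od_neq.
  have n3 : odd (s (ev_ord k)) != odd (s (od_ord k)).
    by apply/negP => /eqP o; have /perm_inj/eqP := half_odd_inj sk o; rewrite ev_od_neq.
  by case: (odd (s (ev_ord k))) (odd (s (ev_ord l))) (odd (s (od_ord k))) n1 n2 n3 => [] [] [].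
exists (perm p_inj, [ffun k => odd (s (ev_ord k))]) => //.
apply/permP => i; rewrite permE /block_perm_fun /= permE ffunE.
apply: half_odd_inj; rewrite ?half_dbl ?odd_dbl /=.
  case: (ev_odP i) => [[k ->]|[k ->]]; rewrite ?half_ev ?half_od //.
  by apply/eqP; rewrite eq_sym.
case: (ev_odP i) => [[k ->]|[k ->]]; rewrite ?half_ev ?half_od /= odd_double //=.
have /eqP sk := sH k.
have : odd (s (ev_ord k)) != odd (s (od_ord k)).
  by apply/negP => /eqP /(half_odd_inj sk)/perm_inj/eqP; rewrite ev_od_neq.
by case: (odd (s (ev_ord k))) (odd (s (od_ord k))) => [] [].
Qed.

Lemma card_block_perms : #|block_perms| = (2 ^ n * n`!)%N.
Proof.
rewrite block_permsE card_imset ?cardsT; last first.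
  move=> [p b] [p' b'] /permP /= E.
  have Ek k : p k = p' k /\ b k = b' k.
    have := E (ev_ord k); rewrite !permE /block_perm_fun half_ev /= odd_double /=.
    by move/(can_inj (@dbl_ordK n)) => [-> ->].
  by congr pair; [apply/permP | apply/ffunP] => k; case: (Ek k).
by rewrite card_prod card_Sn card_ffun card_bool card_ord mulnC.
Qed.

(** Two distinct blocks stay separated, so the four comparisons between them are equal and multiply
    to 1. Only the flips inside the blocks contribute to the sign. *)
Lemma block_perm_sign s : s \in block_perms ->
  (-1) ^+ s = \prod_(k < n) std_form (s (ev_ord k)) (s (od_ord k)) :> R.
Proof.
rewrite inE => /forallP sH; rewrite -sign_inversions prod_lt_ev_od.
rewrite [X in _ * X]big1 ?mulr1 => [|k _].
  apply: eq_bigr => k _; rewrite /std_form (eqP (sH k)) eqxx.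
  case: ltngtP => // /val_inj/perm_inj/eqP; by rewrite ev_od_neq.
apply: big1 => l kl.
have nh : half_ord (s (ev_ord k)) != half_ord (s (ev_ord l)).
  have : s \in block_perms by rewrite inE; apply/forallP.
  rewrite block_permsE => /imsetP [pb _ ->]; rewrite !permE /block_perm_fun !half_dbl /=.
  by rewrite (inj_eq perm_inj) !half_ev neq_ltn kl.
have /eqP sk := sH k; have /eqP sl := sH l.
rewrite !ltn_half_ord -?sk -?sl //.
by case: ifP; rewrite ?mulrNN !mulr1.
Qed.

(** The nonzero terms come from the permutations respecting the blocks. Each equals 1, and their
    number is the normalising factor in [pfaffian]. *)
Lemma pfaffian_std : pfaffian (\matrix_(i, j) @std_form n i j) = 1.
Proof.
rewrite /pfaffian (bigID (mem block_perms)) /= [X in _ + X]big1 ?addr0.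
  under eq_bigr => s sH.
    rewrite (eq_bigr (fun k => std_form (s (ev_ord k)) (s (od_ord k)))); last first.
      by move=> k _; rewrite mxE.
    rewrite -block_perm_sign // -signr_addb addbb; over.
  rewrite sumr_const card_block_perms mulVf // pnatr_eq0 muln_eq0 negb_or expn_eq0 /=.
  by rewrite -lt0n fact_gt0.
move=> s; rewrite inE => /forallPn [k sk].
by rewrite (bigD1 k) //= mxE /std_form (negbTE sk) mul0r mulr0.
Qed.
End Count.
End Std.

(** * Expansion of a sum, decoupling and exchange *)

Section PfaffianMoves.
Variables (R : numFieldType) (T : finType) (m : nat) (h : 'I_(m.*2) -> T).
Hypothesis h_bij : bijective h.
Implicit Types (A B : T -> T -> R).
Local Notation PF := (PF h).
Let h_inj : injective h := bij_inj h_bij.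

(** Each factor of a term chooses [A] or [B], and [I] is the union of the pairs that choose [A]; a
    set [I] separating a pair contributes 0 to that term. The summands keep the full size and the
    numbering of the rows, so no shuffle signs appear. *)
Lemma PF_add A B :
  PF (fun z w => A z w + B z w) =
  \sum_(I : {set T}) PF (fun z w => if z \in I then (if w \in I then A z w else 0)
                                    else if w \in I then 0 else B z w).
Proof.
pose F (I : {set T}) z w := if z \in I then (if w \in I then A z w else 0)
                             else if w \in I then 0 else B z w.
transitivity (\sum_(I : {set T}) PF (F I)) => //.
rewrite /PF /pfaffian -mulr_sumr exchange_big /=; congr (_ * _).
apply: eq_bigr => s _; rewrite -mulr_sumr; congr (_ * _).
have [h' hK h'K] := h_bij.
pose bl z := half_ord ((s^-1)%g (h' z)).
have blev k : bl (h (s (ev_ord k))) = k by rewrite /bl hK permK half_ev.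
have blod k : bl (h (s (od_ord k))) = k by rewrite /bl hK permK half_od.
pose AB (b : bool) k := if b then A (h (s (ev_ord k))) (h (s (od_ord k)))
                        else B (h (s (ev_ord k))) (h (s (od_ord k))).
transitivity (\prod_k \sum_b AB b k).
  by apply: eq_bigr => k _; rewrite mxE big_bool.
rewrite bigA_distr_bigA /=.
pose set_of (f : {ffun 'I_m -> bool}) := [set z | f (bl z)].
pose fun_of (I : {set T}) : {ffun 'I_m -> bool} := [ffun k => h (s (ev_ord k)) \in I].
rewrite [RHS](bigID (fun I => set_of (fun_of I) == I)) /=.
rewrite [X in _ + X]big1 ?addr0 => [|I nI]; last first.
  have [k] : exists k, (h (s (ev_ord k)) \in I) != (h (s (od_ord k)) \in I).
    apply/existsP; apply: contraR nI; rewrite negb_exists => /forallP IE.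
    apply/eqP/setP => z; rewrite inE ffunE.
    case: (block_of h_bij s z) => k [] ->; rewrite ?blev ?blod //.
    by apply/eqP; have /negPn := IE k.
  move=> Ik; rewrite (bigD1 k) //= mxE /F; move: Ik.
  by case: (_ \in I); case: (_ \in I) => // _; rewrite mul0r.
rewrite (reindex_onto set_of fun_of) /=; last by move=> I /eqP.
apply: eq_big => [f|f _].
  suff -> : fun_of (set_of f) = f by rewrite !eqxx.
  by apply/ffunP => k; rewrite ffunE inE blev.
apply: eq_bigr => k _; rewrite mxE /F !inE blev blod /AB.
by case: (f k).
Qed.

(* For [mu] an involution without fixed points, the Pfaffian of [mono mu A] has a single term,
   up to reordering. *)
Definition mono (mu : T -> T) A z w : R := if w == mu z then A z w else 0.

Lemma involutive_eq_sym (mu : T -> T) : involutive mu ->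
  forall z w, (z == mu w) = (w == mu z).
Proof. by move=> muK z w; rewrite eq_sym (inv_eq muK). Qed.

Lemma mono_antisym mu A : involutive mu -> antisym A -> antisym (mono mu A).
Proof.
move=> muK Aas z w; rewrite /mono (involutive_eq_sym muK).
by case: eqP => [e|_]; rewrite ?oppr0 // Aas.
Qed.

(* A row operation with the hypothesised pair makes [A z w] vanish for all [w] in [I]
   but [mu z]; every surviving term then matches [z] with [mu z], so the rest of the
   row of [mu z] can be cleared as well, and [I] loses the pair. *)
Lemma PF_decouple A mu : antisym A -> involutive mu -> (forall z, mu z != z) ->
  (forall I : {set T}, I != set0 -> (forall z, z \in I -> mu z \in I) ->
     exists z lam, [/\ z \in I, A z (mu z) != 0 &
       forall w, w \in I -> w != z -> w != mu z -> A z w = lam * A (mu z) w]) ->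
  PF A = PF (mono mu A).
Proof.
move=> Aas muK mu_neq step.
(* Intermediate forms of the induction: all entries inside [I] are still present, and elsewhere only
   the matched ones. *)
pose AR (I : {set T}) z w :=
  if (z \in I) && (w \in I) || (w == mu z) then A z w else 0.
have ARas I : antisym (AR I).
  move=> z w; rewrite /AR andbC (involutive_eq_sym muK).
  by case: ifP; rewrite ?oppr0 // Aas.
suff main : forall k (I : {set T}), (#|I| <= k)%N -> (forall z, z \in I -> mu z \in I) ->
    PF (AR I) = PF (AR set0).
  rewrite (@eq_PF _ _ _ h _ (AR setT)); last by move=> z w; rewrite /AR !inE.
  rewrite (main _ _ (leqnn _)) ?inE; last by move=> z; rewrite !inE.
  by apply: eq_PF => z w; rewrite /AR /mono !inE.
elim=> [|k IHk] I Ik muI.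
  by move: Ik; rewrite leqn0 cards_eq0 => /eqP ->.
have [->//|I0] := eqVneq I set0.
have [z [lam [zI Az zE]]] := step I I0 muI.
set z' := mu z in Az zE; have z'I : z' \in I by apply: muI.
have z'z : z' != z by apply: mu_neq.
have muz' : mu z' = z by apply: muK.
pose J := I :\ z :\ z'.
have inJ w : (w \in J) = [&& w != z', w != z & w \in I] by rewrite !inE.
rewrite -(IHk J); first last.
- move=> w; rewrite !inJ => /and3P [w1 w2 wI].
  rewrite -[z']/(mu z) (inj_eq (inv_inj muK)) w2 eq_sym (involutive_eq_sym muK).
  by rewrite -/z' w1 muI.
- rewrite -ltnS; apply: leq_trans Ik; apply: proper_card; apply/properP; split.
    by apply/subsetP => w; rewrite inJ => /and3P [].
  by exists z => //; rewrite inJ eqxx andbF.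
pose B a b : R := if a == z then (b == z)%:R - lam * (b == z')%:R else (a == b)%:R.
pose A1 a b := \sum_c \sum_d B a c * AR I c d * B b d.
have BE a (f : T -> R) : \sum_c B a c * f c = if a == z then f z - lam * f z' else f a.
  have pick c0 : \sum_c (c0 == c)%:R * f c = f c0.
    rewrite (bigD1 c0) //= eqxx mul1r big1 ?addr0 // => c.
    by rewrite eq_sym => /negbTE ->; rewrite mul0r.
  rewrite /B; case: eqP => // _.
  under eq_bigr => c _ do rewrite mulrBl -mulrA [c == z]eq_sym [c == z']eq_sym.
  by rewrite sumrB -mulr_sumr !pick.
have A1E a b : A1 a b =
   let g c := if b == z then AR I c z - lam * AR I c z' else AR I c b in
   if a == z then g z - lam * g z' else g a.
  set g := (X in let g := X in _).
  rewrite -[RHS]/(if a == z then g z - lam * g z' else g a) -(BE a g) /A1.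
  apply: eq_bigr => c _.
  by rewrite /g -(BE b (AR I c)) mulr_sumr; apply: eq_bigr => d _; ring.
have A1as : antisym A1.
  move=> a b; rewrite /A1 exchange_big /= -sumrN; apply: eq_bigr => c _.
  by rewrite -sumrN; apply: eq_bigr => d _; rewrite ARas; ring.
have zz : AR I z z = 0 by apply: antisym_diag.
have z'z' : AR I z' z' = 0 by apply: antisym_diag.
have PFA1 : PF A1 = PF (AR I).
  rewrite (@PF_unitriangular _ _ _ _ h_bij (AR I) B (predC1 z)).
  - rewrite big1 ?mul1r // => a _; rewrite /B; case: eqP => [->|_]; rewrite ?eqxx //.
    by rewrite eq_sym (negbTE z'z) mulr0 subr0.
  - by move=> a b /= /negbTE az; rewrite /B az.
  - by move=> a b /=; rewrite !negbK => /eqP -> /eqP ->; rewrite eqxx.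
rewrite -PFA1.
have A1z' : A1 z z' = A z z'.
  by rewrite A1E /= eqxx (negbTE z'z) z'z' mulr0 subr0 /AR eqxx orbT.
have JE a b : (a == z) || (a == z') -> b != mu a -> AR J a b = 0.
  rewrite /AR inJ => /orP [] /eqP -> /negbTE ->; by rewrite eqxx ?andbF.
apply: (@PF_pin _ _ _ _ h_bij _ _ z z').
- by rewrite eq_sym.
(* After the row operation, row [z] survives only at [z']; the entry at [z] itself cancels by
   antisymmetry. *)
- move=> w wz'; have E : A1 z w = 0.
    rewrite A1E /= eqxx; case: (eqVneq w z) => [_|wz].
      by rewrite zz z'z' [AR I z' z]ARas; ring.
    rewrite /AR zI z'I /= muz' (negbTE wz) -/z' (negbTE wz') !orbF.
    by case: ifP => wI; rewrite ?mulr0 ?subr0 // zE // subrr.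
  have E2 : AR J z w = 0 by apply: JE; rewrite ?eqxx.
  by split; rewrite ?E ?E2 //; [rewrite A1as E | rewrite ARas E2]; rewrite oppr0.
- by rewrite A1z' /AR eqxx orbT.
- by rewrite A1as A1z' /AR muz' eqxx orbT Aas opprK.
- move=> a b az az' bz bz'; rewrite A1E /= (negbTE az) (negbTE bz).
  by rewrite /AR !inJ az az' bz bz'.
Qed.

(* Replaces the matched pairs {a,b}, {c,d} by {a,d}, {b,c}. *)
Lemma PF_exchange A A' a b c d al ga al' ga' : uniq [:: a; b; c; d] ->
  antisym A -> antisym A' -> al' != 0 -> ga' != 0 ->
  (forall w, A a w = if w == b then al else 0) ->
  (forall w, A b w = if w == a then - al else 0) ->
  (forall w, A c w = if w == d then ga else 0) ->
  (forall w, A d w = if w == c then - ga else 0) ->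
  (forall w, A' a w = if w == d then al' else 0) ->
  (forall w, A' d w = if w == a then - al' else 0) ->
  (forall w, A' b w = if w == c then ga' else 0) ->
  (forall w, A' c w = if w == b then - ga' else 0) ->
  (forall z w, z \notin [:: a; b; c; d] -> w \notin [:: a; b; c; d] ->
     A z w = A' z w) ->
  PF A = al * ga / (al' * ga') * PF A'.
Proof.
move=> abcd Aas A'as al'0 ga'0 Aa Ab Ac Ad A'a A'd A'b A'c AA'.
move: abcd; rewrite /= !inE !negb_or -!andbA andbT.
case/and5P => ab ac ad bc /andP [bd cd].
pose co z := if z == a then al / al' else if z == c then ga / ga' else 1.
(* [rho] is the 3-cycle sending [b] to [d], [d] to [c] and [c] to [b]. It carries the pairs of [A]
   to those of [A'] and is even, so only the ratio of entries collected by [co] remains. *)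
pose rho z := tperm b c (tperm b d z).
have ra : rho a = a by rewrite /rho !tpermD // 1?eq_sym.
have rb : rho b = d by rewrite /rho tpermL tpermD.
have rc : rho c = b by rewrite /rho (tpermD bc) 1?eq_sym // tpermR.
have rd : rho d = c by rewrite /rho tpermR tpermL.
have ro z : z \notin [:: a; b; c; d] -> rho z = z.
  rewrite !inE !negb_or => /and4P [za zb zc zd].
  by rewrite /rho [tperm b d z]tpermD 1?eq_sym // tpermD 1?eq_sym.
have rho_inj : injective rho by move=> z w /perm_inj/perm_inj.
transitivity (PF (fun z w => co z * co w * A' (rho z) (rho w))); last first.
  rewrite PF_scale // (bigD1 a) //= (bigD1 c) /=; last by rewrite eq_sym.
  rewrite big1 ?mulr1 => [|z /andP [za zc]]; last by rewrite /co (negbTE za) (negbTE zc).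
  rewrite (@PF_tperm _ _ _ _ h_bij (fun z w => A' (tperm b c z) (tperm b c w))) //.
  rewrite (@PF_tperm _ _ _ _ h_bij A') // opprK; congr (_ * _).
  by rewrite /co eqxx [c == a]eq_sym (negbTE ac) eqxx; field; rewrite ?al'0 ?ga'0.
have coa : co a = al / al' by rewrite /co eqxx.
have coc : co c = ga / ga' by rewrite /co [c == a]eq_sym (negbTE ac) eqxx.
have cob : co b = 1 by rewrite /co [b == a]eq_sym (negbTE ab) (negbTE bc).
have cod : co d = 1 by rewrite /co [d == a]eq_sym (negbTE ad) [d == c]eq_sym (negbTE cd).
have coo z : z \notin [:: a; b; c; d] -> co z = 1.
  by rewrite !inE !negb_or /co => /and4P [/negbTE -> _ /negbTE -> _].
have ea w : (rho w == a) = (w == a) by rewrite -{1}ra (inj_eq rho_inj).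
have eb w : (rho w == d) = (w == b) by rewrite -{1}rb (inj_eq rho_inj).
have ec w : (rho w == b) = (w == c) by rewrite -{1}rc (inj_eq rho_inj).
have ed w : (rho w == c) = (w == d) by rewrite -{1}rd (inj_eq rho_inj).
have E z w : z \in [:: a; b; c; d] -> A z w = co z * co w * A' (rho z) (rho w).
  rewrite !inE => /or4P [] /eqP ->.
  - rewrite Aa ra A'a eb; case: eqP => [->|]; rewrite ?mulr0 //.
    by rewrite coa cob mulr1 divfK.
  - rewrite Ab rb A'd ea; case: eqP => [->|]; rewrite ?mulr0 //.
    by rewrite coa cob mul1r mulrN divfK.
  - rewrite Ac rc A'b ed; case: eqP => [->|]; rewrite ?mulr0 //.
    by rewrite coc cod mulr1 divfK.
  - rewrite Ad rd A'c ec; case: eqP => [->|]; rewrite ?mulr0 //.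
    by rewrite coc cod mul1r mulrN divfK.
apply: eq_PF => z w; have [/E //|nz] := boolP (z \in [:: a; b; c; d]).
have [/E e|nw] := boolP (w \in [:: a; b; c; d]).
  by rewrite Aas e [A' _ _]A'as; ring.
by rewrite !coo // !ro // AA' // !mul1r.
Qed.

End PfaffianMoves.

Section PairedForms.
Variables (R : numFieldType) (T : finType) (m : nat) (h : 'I_(m.*2) -> T).
Hypothesis h_bij : bijective h.
Implicit Types (A B : T -> T -> R).
Local Notation PF := (PF h).
Let h_inj : injective h := bij_inj h_bij.

(** The two rows of a block agree off the block, so decoupling applies with [lam = 1] at any block
    and leaves the standard form. *)
Lemma PF_paired A : antisym A ->
  (forall k, A (h (ev_ord k)) (h (od_ord k)) = 1) ->
  (forall k w, w != h (ev_ord k) -> w != h (od_ord k) ->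
     A (h (ev_ord k)) w = A (h (od_ord k)) w) -> PF A = 1.
Proof.
move=> Aas A1 AE; have [h' hK h'K] := h_bij.
pose flip (i : 'I_(m.*2)) := dbl_ord (half_ord i, ~~ odd i).
have flipK : involutive flip.
  move=> i; rewrite /flip half_dbl odd_dbl negbK; exact: half_ordK.
pose mu z := h (flip (h' z)).
have muK : involutive mu by move=> z; rewrite /mu hK flipK h'K.
have muev k : mu (h (ev_ord k)) = h (od_ord k).
  by rewrite /mu hK /flip half_ev /= odd_double.
have muod k : mu (h (od_ord k)) = h (ev_ord k) by rewrite -muev muK.
have cases z : exists k, z = h (ev_ord k) \/ z = h (od_ord k).
  rewrite -[z]h'K; case: (ev_odP (h' z)) => [[k ->]|[k ->]]; exists k; [left|right]; by [].
rewrite (@PF_decouple _ _ _ _ h_bij A mu) //.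
- rewrite -(pfaffian_std R m); congr pfaffian; apply/matrixP => i j.
  rewrite !mxE /mono /mu hK (inj_eq h_inj) /std_form.
  case: (eqVneq j (flip i)) => [->|ji].
    rewrite /flip half_dbl eqxx.
    case: (ev_odP i) => [[k ->]|[k ->]]; rewrite ?half_ev ?half_od /= odd_double /dbl_ord /=.
      by rewrite A1 ltnSn.
    by rewrite Aas A1 ltnSn ltnNge leqnSn.
  case: eqP => // e; have oij : odd i = odd j.
    move: ji; rewrite /flip; case: (eqVneq (odd i) (odd j)) => // oij.
    have -> : ~~ odd i = odd j by case: (odd i) (odd j) oij => [] [].
    by rewrite e half_ordK eqxx.
  by rewrite (half_odd_inj e oij) ltnn.
- move=> z; case: (cases z) => k [] ->; rewrite ?muev ?muod (inj_eq h_inj) ?ev_od_neq //.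
  by rewrite eq_sym ev_od_neq.
move=> I I0 muI; have [z zI] : exists z, z \in I by apply/set0Pn.
have [k kI] : exists k, h (ev_ord k) \in I.
  case: (cases z) => k [] e; exists k; first by rewrite -e.
  by rewrite -muod -e muI.
exists (h (ev_ord k)), 1; split=> //; first by rewrite muev A1 oner_neq0.
by move=> w wI w1; rewrite muev => w2; rewrite mul1r AE.
Qed.

End PairedForms.

(** * Sign forms of total orders *)

Section Order.
Variables (R : numFieldType) (T : finType) (m : nat) (h : 'I_(m.*2) -> T).
Hypothesis h_bij : bijective h.
Local Notation PF := (PF h).
Let h_inj : injective h := bij_inj h_bij.

Definition order_form (r : T -> 'I_(m.*2)) z w : R :=
  if (r z < r w)%N then 1 else if (r w < r z)%N then -1 else 0.

Lemma order_form_antisym r : antisym (order_form r).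
Proof. by move=> z w; rewrite /order_form; case: ltngtP; rewrite ?opprK ?oppr0. Qed.

(** The right-hand side is the sign of the permutation that sorts the numbering [h] into the order
    [r]. *)
Lemma PF_order (r : T -> 'I_(m.*2)) : injective r ->
  PF (order_form r) = \prod_(i : 'I_(m.*2)) \prod_(j : 'I_(m.*2) | (i < j)%N) order_form r (h i) (h j).
Proof.
move=> r_inj; pose s := perm (inj_comp r_inj h_inj).
have sE i : r (h i) = s i by rewrite permE.
transitivity ((-1) ^+ s : R); last first.
  rewrite -sign_inversions; apply: eq_bigr => i _; apply: eq_bigr => j ij.
  rewrite /order_form !sE; case: ltngtP => // /val_inj/perm_inj e.
  by rewrite e ltnn in ij.
have bs : bijective (h \o (s^-1)%g).
  by apply: bij_comp => //; exists s; [apply: permKV | apply: permK].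
pose A : 'M[R]_(m.*2) := \matrix_(i, j) if (i < j)%N then 1 else if (j < i)%N then -1 else 0.
transitivity ((-1) ^+ s * pfaffian A).
  rewrite -pfaffian_perm; congr pfaffian; apply/matrixP => i j.
  by rewrite !mxE /order_form !sE.
(* The sign form of the natural order has Pfaffian 1: two consecutive indices compare alike with
   every other index. *)
suff -> : pfaffian A = 1 by rewrite mulr1.
rewrite -(@PF_paired R _ m id _ (fun i j => A i j)).
- by congr pfaffian; apply/matrixP=> i j; rewrite [RHS]mxE.
- by exists id.
- by move=> i j; rewrite !mxE; case: ltngtP; rewrite ?opprK ?oppr0.
- by move=> k; rewrite mxE /= ltnSn.
move=> k i i1 i2; rewrite !mxE.
have hi : half_ord i != half_ord (ev_ord k).
  apply/eqP => e; case: (boolP (odd i)) => oi.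
    by move/eqP: i2; case; apply: half_odd_inj; rewrite ?half_od ?e ?half_ev //= odd_double.
  by move/eqP: i1; case; apply: half_odd_inj => //=; rewrite odd_double (negbTE oi).
have hi' : half_ord i != half_ord (od_ord k) by move: hi; rewrite half_od half_ev.
by rewrite !ltn_half_ord // 1?eq_sym // half_od half_ev.
Qed.
End Order.

(** * Pfaffian of a direct sum *)

Section Block.
Variables (R : numFieldType) (D : finType) (n m : nat).
Local Notation T := (D + 'I_(n.*2))%type.
Variable h : 'I_(m.*2) -> T.
Hypothesis h_bij : bijective h.

Definition dsum (A : D -> D -> R) (S : 'I_(n.*2) -> 'I_(n.*2) -> R) (z w : T) : R :=
  match z, w with
  | inl d, inl d' => A d d'
  | inr x, inr x' => S x x'
  | _, _ => 0
  end.

Lemma PF_dsum_perm A S (s : 'S_(n.*2)) :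
  PF h (dsum A (fun x x' => S (s x) (s x'))) = (-1) ^+ s * PF h (dsum A S).
Proof.
have [ts -> /= dts] := prod_tpermP s.
elim: ts S dts => [|[a b] ts IHts] S /=.
  by rewrite !big_nil odd_perm1 mul1r => _; apply: eq_PF => -[d|x] [d'|x'] //=; rewrite !perm1.
case/andP=> ab /IHts IH; rewrite !big_cons /= odd_permM odd_tperm.
rewrite /dpair /= in ab; rewrite ab signr_addb -mulrA -IH mulN1r.
have tl d : tperm (inr a) (inr b) (inl d : T) = inl d by rewrite tpermD.
have tr x : tperm (inr a) (inr b) (inr x : T) = inr (tperm a b x).
  by rewrite inj_tperm // => x1 x2 [].
rewrite -(@PF_tperm _ _ _ _ h_bij _ (inr a) (inr b)) //.
by apply: eq_PF => -[d|x] [d'|x'] /=; rewrite ?tl ?tr //= !permM.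
Qed.

(** Each term, antisymmetrised over relabellings of the second summand, is a multiple of [pfaffian]
    of [S] whose coefficient does not depend on [S]. The total coefficient is then read off at
    [std_form], where that Pfaffian is 1. *)
Lemma PF_dsum A S :
  PF h (dsum A S) = pfaffian (\matrix_(i, j) S i j) * PF h (dsum A (@std_form R n)).
Proof.
(* The contribution of a fixed [s], antisymmetrised over the relabellings [t]; the average costs the
   factor [(n.*2)!], cancelled at the end. *)
pose L s S := \sum_(t : 'S_(n.*2)) (-1) ^+ t *
  \prod_(k < m) dsum A (fun x x' => S (t x) (t x') : R) (h ((s : 'S_(m.*2)) (ev_ord k))) (h (s (od_ord k))).
suff [g gE] : exists g : 'S_(m.*2) -> R, forall s S, L s S = g s * pfaffian (\matrix_(i, j) S i j).
  have E S0 : (n.*2)`!%:R * PF h (dsum A S0) = ((2 ^ m * m`!)%:R)^-1 *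
       (\sum_(s : 'S_(m.*2)) (-1) ^+ s * g s) * pfaffian (\matrix_(i, j) S0 i j).
    transitivity (\sum_(t : 'S_(n.*2)) (-1) ^+ t * PF h (dsum A (fun x x' => S0 (t x) (t x')))).
      under eq_bigr => t _ do rewrite PF_dsum_perm signrMK.
      by rewrite sumr_const card_Sn mulr_natl.
    rewrite /PF /pfaffian.
    under eq_bigr => t _ do rewrite mulrCA mulr_sumr.
    rewrite -mulr_sumr -mulrA; congr (_ * _); rewrite exchange_big /= mulr_suml.
    apply: eq_bigr => s _; rewrite -mulrA -[_ * (_ * \sum_t _)]gE /L mulr_sumr.
    apply: eq_bigr => t _; rewrite mulrCA; congr (_ * (_ * _)).
    by apply: eq_bigr => k _; rewrite mxE.
  have := E (@std_form R n); rewrite pfaffian_std mulr1 => E1.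
  have := E S; rewrite -E1 -mulrA => /mulfI; rewrite pnatr_eq0 -lt0n fact_gt0 => -> //.
  by rewrite mulrC.
suff gE s : exists g, forall S, L s S = g * pfaffian (\matrix_(i, j) S i j).
  by have [g] := fin_all_exists gE; exists g.
pose isr (z : T) := if z is inr _ then true else false.
have [/existsP [k kE]|/existsPn kE] :=
    boolP [exists k, isr (h (s (ev_ord k))) != isr (h (s (od_ord k)))].
  exists 0 => S0; rewrite mul0r /L big1 // => t _; rewrite (bigD1 k) //=.
  by move: kE; case: (h _) => [d|x]; case: (h _) => [d'|x'] //=; rewrite !(mul0r, mulr0).
have {}kE k : isr (h (s (od_ord k))) = isr (h (s (ev_ord k))).
  by have := kE k; rewrite negbK => /eqP.
(* The pairs lying entirely in the second summand. No pair is mixed at this point, so there are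
   exactly [n] of them. *)
pose K := [set k | isr (h (s (ev_ord k)))].
have cardK : #|K| = n.
  apply: double_inj; rewrite -[RHS]card_ord -[RHS]sum1_card.
  have -> : (\sum_(x in 'I_(n.*2)) 1 = \sum_(z : T) isr z)%N.
    by rewrite big_sumType big1 // Monoid.mul1m.
  rewrite (reindex h) /=; last exact: onW_bij.
  rewrite (reindex_inj (@perm_inj _ s)) /= big_ev_od /= -mul2n -sum1_card big_distrr /= big_mkcond.
  by apply: eq_bigr => k _; rewrite kE inE; case: (isr _).
pose kap (j : 'I_n) : 'I_m := enum_val (cast_ord (esym cardK) j).
have kapK j : kap j \in K by apply: enum_valP.
have kap_inj : injective kap by move=> i j /enum_val_inj/cast_ord_inj.
have rE (i : 'I_(n.*2)) : exists x, h (s (dbl_ord (kap (half_ord i), odd i))) = inr x.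
  have := kapK (half_ord i); rewrite inE /dbl_ord /=; case: (odd i); first rewrite -kE;
    by case: (h _) => // x _; exists x.
have [r {}rE] := fin_all_exists rE.
have r_inj : injective r.
  move=> i j e; have := rE i; rewrite e -rE => /(bij_inj h_bij)/perm_inj.
  by move/(can_inj (@dbl_ordK m)) => [/kap_inj]; apply: half_odd_inj.
pose rho := perm r_inj.
pose a := \prod_(k | k \notin K) dsum A (fun _ _ => 1 : R) (h (s (ev_ord k))) (h (s (od_ord k))).
exists (a * ((-1) ^+ rho * (2 ^ n * n`!)%:R)) => S0.
have LE t : \prod_k dsum A (fun x x' => S0 (t x) (t x')) (h (s (ev_ord k))) (h (s (od_ord k))) =
   a * \prod_(j < n) S0 (t (rho (ev_ord j))) (t (rho (od_ord j))).
  rewrite (bigID (mem K)) /= mulrC; congr (_ * _).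
    apply: eq_bigr => k; rewrite inE => kK; move: (kE k) kK.
    by case: (h _) => [d|x]; case: (h _) => [d'|x'].
  rewrite (big_enum_val (fun k => dsum A _ (h (s (ev_ord k))) (h (s (od_ord k))))) /=.
  rewrite (reindex (cast_ord (esym cardK))) /=; last first.
    by exists (cast_ord cardK) => j _; rewrite ?cast_ordK ?cast_ordKV.
  apply: eq_bigr => j _; rewrite -/(kap j).
  have := rE (ev_ord j); have := rE (od_ord j).
  by rewrite half_ev half_od /dbl_ord /= odd_double /= !permE => -> ->.
rewrite /L; under eq_bigr => t _ do rewrite LE mulrCA.
rewrite -mulr_sumr -mulrA; congr (_ * _).
rewrite /pfaffian -mulrA mulVKf ?pnatr_eq0 ?muln_eq0 ?negb_or ?expn_eq0 /= -?lt0n ?fact_gt0 //.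
rewrite (reindex_inj (mulgI (rho^-1)%g)) /= mulr_sumr; apply: eq_bigr => t _.
rewrite odd_permM odd_permV signr_addb -mulrA; congr (_ * (_ * _)).
by apply: eq_bigr => k _; rewrite mxE !permM !permK.
Qed.
End Block.

(** * The plane *)

(* A [realFieldType] is needed to run [lra] and [nra] on real and imaginary parts. *)
Record creal (C : numClosedFieldType) :=
  CReal {creal_val :> C; creal_valP : creal_val \is Num.real}.

Section CrealStructure.
Variable C : numClosedFieldType.
Local Notation R := (creal C).

HB.instance Definition _ := [isSub for @creal_val C].
HB.instance Definition _ := [Choice of R by <:].
HB.instance Definition _ := [SubChoice_isSubIntegralDomain of R by <:].
HB.instance Definition _ := [SubIntegralDomain_isSubField of R by <:].
HB.instance Definition _ : Order.isPOrder ring_display R :=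
  Order.CancelPartial.Pcan _ valK.

Fact creal_val_zmod_morphism : zmod_morphism (@creal_val C). Proof. by []. Qed.
HB.instance Definition _ :=
  GRing.isZmodMorphism.Build R C (@creal_val C) creal_val_zmod_morphism.

Fact creal_total : total (<=%O : rel R).
Proof. by move=> x y; apply/real_leVge/valP/valP. Qed.
HB.instance Definition _ := Order.POrder_isTotal.Build _ R creal_total.

Definition creal_norm (x : R) : R := CReal (normr_real (val x)).
Fact creal_ler_normD x y : creal_norm (x + y) <= creal_norm x + creal_norm y.
Proof. exact: ler_normD. Qed.
Fact creal_normr0_eq0 x : creal_norm x = 0 -> x = 0.
Proof. by move=> /(congr1 val)/normr0_eq0 x0; apply: val_inj. Qed.
Fact creal_normrMn x n : creal_norm (x *+ n) = creal_norm x *+ n.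
Proof. by apply: val_inj; rewrite /= !raddfMn /= normrMn. Qed.
Fact creal_normrN x : creal_norm (- x) = creal_norm x.
Proof. by apply: val_inj; apply: normrN. Qed.
HB.instance Definition _ := Num.Zmodule_isNormed.Build _ R
  creal_ler_normD creal_normr0_eq0 creal_normrMn creal_normrN.

Fact creal_addr_gt0 (x y : R) : 0 < x -> 0 < y -> 0 < x + y.
Proof. exact: (@addr_gt0 C). Qed.
Fact creal_ger_leVge (x y : R) : 0 <= x -> 0 <= y -> (x <= y) || (y <= x).
Proof. exact: (@ger_leVge C). Qed.
Fact creal_normrM : {morph creal_norm : x y / x * y}.
Proof. by move=> x y; apply: val_inj; apply: normrM. Qed.
Fact creal_ler_def (x y : R) : (x <= y) = (creal_norm (y - x) == y - x).
Proof. exact: (@ler_def C). Qed.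
HB.instance Definition _ := Num.isNumRing.Build R
  creal_addr_gt0 creal_ger_leVge creal_normrM creal_ler_def.

Definition re (z : C) : R := CReal (Creal_Re z).
Definition im (z : C) : R := CReal (Creal_Im z).

Lemma re_im_inj z w : re z = re w -> im z = im w -> z = w.
Proof. by move=> /(congr1 val) /= r /(congr1 val) /= i; apply/eqCP. Qed.
Lemma reD z w : re (z + w) = re z + re w.
Proof. by apply: val_inj => /=; rewrite raddfD. Qed.
Lemma imD z w : im (z + w) = im z + im w.
Proof. by apply: val_inj => /=; rewrite raddfD. Qed.
Lemma reN z : re (- z) = - re z.
Proof. by apply: val_inj => /=; rewrite raddfN. Qed.
Lemma imN z : im (- z) = - im z.
Proof. by apply: val_inj => /=; rewrite raddfN. Qed.
Lemma re_mul z w : re (z * w) = re z * re w - im z * im w.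
Proof. by apply: val_inj => /=; rewrite ReM. Qed.
Lemma im_mul z w : im (z * w) = re z * im w + re w * im z.
Proof. by apply: val_inj => /=; rewrite ImM. Qed.
Lemma re_i : re 'i = 0. Proof. by apply: val_inj; apply: Re_i. Qed.
Lemma im_i : im 'i = 1. Proof. by apply: val_inj; apply: Im_i. Qed.
Lemma re_conj z : re z^* = re z.
Proof. by apply: val_inj; apply: Re_conj. Qed.
Lemma im_conj z : im z^* = - im z.
Proof. by apply: val_inj; apply: Im_conj. Qed.
Lemma re_real (x : R) : re x = x.
Proof. by apply: val_inj; apply/Creal_ReP/valP. Qed.
Lemma im_real (x : R) : im x = 0.
Proof. by apply: val_inj; apply/Creal_ImP/valP. Qed.

End CrealStructure.

(* Two segments that meet only in common endpoints are graphs over the height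
   intervals [a1, a2] and [b1, b2]; [D h] is the horizontal distance between them
   at height [h].  A comparison of the endpoints' heights is traded for a
   comparison of which endpoints lie on which side of the other segment. *)
Lemma interleaving_parity (R : realFieldType) (a1 a2 b1 b2 k d : R) :
  let D h := d + h * k in a1 < a2 -> b1 < b2 ->
  (forall h, a1 <= h <= a2 -> b1 <= h <= b2 -> D h = 0 ->
     ((h == a1) || (h == a2)) && ((h == b1) || (h == b2))) ->
  (a1 = b1 -> D a1 = 0) -> (a2 = b2 -> D a2 = 0) ->
  ((a1 < b1) || (a1 == b1) && (k < 0)) (+) ((a2 < b2) || (a2 == b2) && (k < 0))
    (+) (a1 < b2) (+) (a2 <= b1) =
  ((a1 < b1 < a2) && (0 < D b1)) (+) ((a1 < b2 < a2) && (0 < D b2))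
    (+) ((b1 < a1 < b2) && (D a1 < 0)) (+) ((b1 < a2 < b2) && (D a2 < 0)).
Proof.
move=> D a12 b12 Z s1 s2.
have Dmid h1 h2 : a1 <= h1 <= a2 -> b1 <= h1 <= b2 -> a1 <= h2 <= a2 -> b1 <= h2 <= b2 ->
    0 < D h1 -> D h2 < 0 -> false.
  move=> /andP [h1a1 h1a2] /andP [h1b1 h1b2] /andP [h2a1 h2a2] /andP [h2b1 h2b2] D1 D2.
  have hne : h1 != h2 by apply: contraTneq D1 => ->; rewrite -leNgt ltW.
  (* The affine function [D] changes sign between [h1] and [h2]. Its zero [h0] is interior to both
     intervals, where the two segments may not meet. *)
  pose t := D h1 / (D h1 - D h2).
  have den : 0 < D h1 - D h2 by lra.
  have t0 : 0 < t by rewrite divr_gt0.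
  have t1 : t < 1 by rewrite ltr_pdivrMr // mul1r; lra.
  have tE : t * (D h1 - D h2) = D h1 by rewrite divfK ?gt_eqF.
  pose h0 := h1 + t * (h2 - h1).
  have D0 : D h0 = 0.
    rewrite /h0; transitivity (D h1 - t * (D h1 - D h2)); first by rewrite /D; ring.
    by rewrite tE subrr.
  have [lt|lt|e] := ltgtP h1 h2; last by rewrite e eqxx in hne.
    have i1 : h1 < h0 by rewrite /h0; nra.
    have i2 : h0 < h2 by rewrite /h0; nra.
    have := Z h0; rewrite D0; case/(_ _ _ erefl)/andP; [lra|lra|].
    by case/orP => /eqP; lra.
  have i1 : h2 < h0 by rewrite /h0; nra.
  have i2 : h0 < h1 by rewrite /h0; nra.
  have := Z h0; rewrite D0; case/(_ _ _ erefl)/andP; [lra|lra|].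
  by case/orP => /eqP; lra.
have Dle h1 h2 : a1 <= h1 <= a2 -> b1 <= h1 <= b2 -> a1 <= h2 <= a2 -> b1 <= h2 <= b2 ->
    D h1 != 0 -> D h2 != 0 -> (0 < D h1) = (0 < D h2).
  move=> i1 i2 i3 i4 n1 n2.
  have [p1|m1|z1] := ltgtP 0 (D h1); have [p2|m2|z2] := ltgtP 0 (D h2) => //.
  - by have := Dmid h1 h2 i1 i2 i3 i4 p1 m2.
  - by rewrite -z2 eqxx in n2.
  - by have := Dmid h2 h1 i3 i4 i1 i2 p2 m1.
  - by rewrite -z1 eqxx in n1.
have Dneg h : D h != 0 -> (D h < 0) = ~~ (0 < D h) by case: ltgtP.
have [le1|lt1] := leP a2 b1.
  have -> : (a1 < b1) = true by lra.
  have -> : (a2 < b2) = true by lra.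
  have -> : (a1 < b2) = true by lra.
  have -> : (b1 < a1) = false by lra.
  have -> : (b2 < a2) = false by lra.
  by rewrite ?andbF.
have [le2|lt2] := leP b2 a1.
  have -> : (a1 < b1) = false by lra.
  have -> : (a1 == b1) = false by lra.
  have -> : (a2 < b2) = false by lra.
  have -> : (a2 == b2) = false by lra.
  by rewrite ?andbF.
have a1r : a1 <= a1 <= a2 by lra.
have a2r : a1 <= a2 <= a2 by lra.
have b1r : b1 <= b1 <= b2 by lra.
have b2r : b1 <= b2 <= b2 by lra.
have [lta|gta|ea] := ltgtP a1 b1; have [ltb|gtb|eb] := ltgtP a2 b2; rewrite ?andbT ?andbF /=.
all: rewrite ?lt1 ?lt2 ?lta ?ltb /=.
- have n1 : D b1 != 0 by apply/eqP => z; have := Z b1 _ _ z; lra.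
  have n2 : D a2 != 0 by apply/eqP => z; have := Z a2 _ _ z; lra.
  have e : (0 < D b1) = (0 < D a2) by apply: Dle => //; lra.
  by rewrite Dneg // e; case: (0 < D a2).
- have n1 : D b1 != 0 by apply/eqP => z; have := Z b1 _ _ z; lra.
  have n2 : D b2 != 0 by apply/eqP => z; have := Z b2 _ _ z; lra.
  have e : (0 < D b1) = (0 < D b2) by apply: Dle => //; lra.
  by rewrite e; case: (0 < D b2).
- have n1 : D b1 != 0 by apply/eqP => z; have := Z b1 _ _ z; lra.
  have -> : (0 < D b1) = (k < 0).
    have Db1 : D b1 = (b1 - a2) * k by rewrite -[LHS]subr0 -(s2 eb) /D; ring.
    by apply/idP/idP; rewrite Db1; nra.
  by case: (k < 0).
- have n1 : D a1 != 0 by apply/eqP => z; have := Z a1 _ _ z; lra.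
  have n2 : D a2 != 0 by apply/eqP => z; have := Z a2 _ _ z; lra.
  have e : (0 < D a1) = (0 < D a2) by apply: Dle => //; lra.
  by rewrite !Dneg // e; case: (0 < D a2).
- have n1 : D a1 != 0 by apply/eqP => z; have := Z a1 _ _ z; lra.
  have n2 : D b2 != 0 by apply/eqP => z; have := Z b2 _ _ z; lra.
  have e : (0 < D a1) = (0 < D b2) by apply: Dle => //; lra.
  by rewrite Dneg // e; case: (0 < D b2).
- have -> : (D a1 < 0) = ~~ (k < 0).
    have n1 : D a1 != 0 by apply/eqP => z; have := Z a1 _ _ z; lra.
    have Da1 : D a1 = (a1 - a2) * k by rewrite -[LHS]subr0 -(s2 eb) /D; ring.
    rewrite -leNgt; apply/idP/idP; rewrite Da1 in n1 *; first by nra.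
    by rewrite le_eqVlt => /orP [/eqP k0|]; [rewrite -k0 mulr0 eqxx in n1 | nra].
  by case: (k < 0).
- have -> : (D a2 < 0) = (k < 0).
    have Da2 : D a2 = (a2 - a1) * k by rewrite -[LHS]subr0 -(s1 ea) /D; ring.
    by apply/idP/idP; rewrite Da2; nra.
  by case: (k < 0).
- have -> : (0 < D b2) = ~~ (k < 0).
    have n1 : D b2 != 0 by apply/eqP => z; have := Z b2 _ _ z; lra.
    have Da1 : D b2 = (b2 - a1) * k by rewrite -[LHS]subr0 -(s1 ea) /D; ring.
    rewrite -leNgt; apply/idP/idP; rewrite Da1 in n1 *; first by nra.
    by rewrite le_eqVlt => /orP [/eqP k0|]; [rewrite -k0 mulr0 eqxx in n1 | nra].
  by case: (k < 0).
(* With both pairs of ends at equal heights, [D] vanishes at both ends, hence everywhere, and the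
   midpoint is a forbidden meeting point. *)
- pose mid := (a1 + a2) / 2.
  have k0 : k = 0.
    have : (a2 - a1) * k = 0 by rewrite -[RHS](subrr 0) -{1}(s2 eb) -(s1 ea) /D; ring.
    by move/eqP; rewrite mulf_eq0 subr_eq0 gt_eqF //= => /eqP.
  have Dm : D mid = 0 by rewrite -(s1 ea) /D k0 !mulr0.
  have := Z mid _ _ Dm; rewrite /mid; lra.
Qed.

(** * Generic directions, half-angles and cotangents *)

Section Complex.
Variable C : numClosedFieldType.
Local Notation R := (creal C).
Implicit Types z w a q : C.

Lemma re_im_neq0 z : z != 0 -> (re z != 0) || (im z != 0).
Proof.
apply: contraR; rewrite negb_or !negbK => /andP [/eqP r /eqP i].
by apply/eqP/re_im_inj; rewrite ?r ?i; apply: val_inj => /=; rewrite ?raddf0.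
Qed.

(** For [om = 1 + i t], the imaginary part of [om * z] is [im z + t * re z], a nonzero polynomial in
    [t]. Any [t] avoiding the roots of the product of these polynomials works. *)
Lemma generic_direction (s : seq C) : all (fun z => z != 0) s ->
  exists om, om != 0 /\ all (fun z => im (om * z) != 0) s.
Proof.
move=> s0; pose p : {poly R} := \prod_(z <- s) ((im z)%:P + re z *: 'X).
have p0 : p != 0.
  rewrite prodf_seq_neq0; apply: sub_all s0 => z /re_im_neq0 z0.
  apply/eqP => /polyP E; have := E 0%N; have := E 1%N.
  rewrite !coefD !coefC !coefZ !coefX ?coef0 /= ?mulr0 ?mulr1 ?addr0 ?add0r => e1 e2.
  by rewrite e1 e2 eqxx in z0.
have [t pt] : exists t : R, p.[t] != 0.
  (* These are [size p] distinct integers, more than [p] has roots. *)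
  pose rs := [seq i%:R : R | i <- iota 0 (size p)].
  have [/allP ar|] := boolP (all (root p) rs).
    have := max_poly_roots p0 (introT allP ar).
    rewrite map_inj_uniq ?iota_uniq => [/(_ isT)|i j /eqP]; last by rewrite eqr_nat => /eqP.
    by rewrite size_map size_iota ltnn.
  by case/allPn => t _ tp; exists t.
exists (1 + 'i * creal_val t); split.
  apply/eqP => /(congr1 (@re C)); rewrite reD re_mul re_i im_i re_real im_real.
  have -> : re (1 : C) = 1 := re_real 1.
  have -> : re (0 : C) = 0 := re_real 0.
  by rewrite mul0r mulr0 subrr addr0 => /eqP; rewrite oner_eq0.
apply/allP => z zs; apply: contraNneq pt => e.
rewrite /p horner_prod prodf_seq_eq0; apply/hasP; exists z => //=.
rewrite !hornerE; apply/eqP; rewrite -[RHS]e im_mul reD imD re_mul im_mul re_i im_i re_real im_real.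
have -> : re (1 : C) = 1 := re_real 1.
have -> : im (1 : C) = 0 := im_real 1.
ring.
Qed.

Lemma im_sqrtC_gt0 z : im z != 0 -> 0 < im (sqrtC z).
Proof.
move=> z0; have i0 : 0 <= im (sqrtC z) by apply: (Im_rootC_ge0 z (isT : (1 < 2)%N)).
rewrite lt_def i0 andbT; apply: contra z0 => /eqP e.
by rewrite -[z]sqrtCK expr2 im_mul e; apply/eqP; ring.
Qed.

Lemma halfexp_eq z q : q ^+ 2 = z -> 0 < re q -> halfexp z = q.
Proof.
move=> qz q0; rewrite /halfexp.
have : sqrtC z ^+ 2 == q ^+ 2 by rewrite sqrtCK qz.
rewrite eqf_sqr => /orP [] /eqP ->; first by rewrite ifT.
by rewrite ifF ?opprK //; apply: (@lt_gtF _ R (re (- q)) 0); rewrite reN oppr_lt0.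
Qed.

(** The cotangent of the argument. It decreases along the open upper half-plane, so it compares
    arguments there without introducing angles. *)
Definition cot z : R := re z / im z.

Lemma im_divE z w : im (z / w) = (re w * im z - re z * im w) / (re w ^+ 2 + im w ^+ 2).
Proof. by apply: val_inj => /=; rewrite Im_div normC2_Re_Im. Qed.

Lemma im_div_cot z w : 0 < im z -> 0 < im w ->
  im (z / w) = im z * im w * (cot w - cot z) / (re w ^+ 2 + im w ^+ 2).
Proof.
move=> z0 w0; rewrite im_divE /cot; field.
by rewrite !gt_eqF // addrC ltr_pwDl ?exprn_gt0 ?sqr_ge0.
Qed.

Lemma im_div_gt0 z w : 0 < im z -> 0 < im w -> (0 < im (z / w)) = (cot z < cot w).
Proof.
move=> z0 w0; rewrite im_div_cot // pmulr_lgt0; last first.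
  by rewrite invr_gt0 addrC ltr_pwDl ?exprn_gt0 ?sqr_ge0.
by rewrite pmulr_rgt0 ?mulr_gt0 // subr_gt0.
Qed.

(** [upper] tests for an argument in [(0, pi]]; halving the argument turns this into the closed
    right half of the upper half-plane. *)
Lemma upperE q : 0 < im q -> upper (q ^+ 2) = (0 <= re q).
Proof.
move=> q0; rewrite /upper.
have -> : (0 < 'Im (q ^+ 2)) = (0 < im (q ^+ 2)) by [].
have -> : ('Re (q ^+ 2) < 0) = (re (q ^+ 2) < 0) by [].
have -> : ('Im (q ^+ 2) == 0) = (im (q ^+ 2) == 0) by [].
rewrite expr2 im_mul re_mul.
move: (re q) (im q) q0 => {q} x y y0.
have [x0|x0|<-] := ltgtP 0 x.
- by rewrite -mulr2n pmulrn_lgt0 // mulr_gt0.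
- have xy : x * y + x * y < 0 by rewrite -mulr2n pmulrn_llt0 // pmulr_llt0.
  by rewrite lt_gtF // lt_eqF.
- by rewrite !mul0r addr0 ltxx eqxx sub0r oppr_lt0 mulr_gt0.
Qed.

(** The counterclockwise angles from [a] lie in [(0, 2 pi)]. Their halves are the arguments of [q1]
    and [q2] in [(0, pi)], where the cotangent decreases. *)
Lemma ccw_beforeE a (q1 q2 : C) z w : a != 0 -> 0 < im q1 -> 0 < im q2 ->
  z / a = q1 ^+ 2 -> w / a = q2 ^+ 2 -> ccw_before a z w = (cot q2 < cot q1).
Proof.
move=> a0 i1 i2 e1 e2; rewrite /ccw_before e1 e2 !upperE //.
have -> : (cot q2 < cot q1) = (re q2 * im q1 < re q1 * im q2).
  by rewrite /cot ltr_pdivrMr // mulrAC ltr_pdivlMr.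
have -> : (0 < 'Im ((q1 ^+ 2)^* * q2 ^+ 2)) = (0 < im ((q1 ^+ 2)^* * q2 ^+ 2)) by [].
rewrite im_mul re_conj im_conj !expr2 !re_mul !im_mul.
move: (re q1) (re q2) (im q1) (im q2) i1 i2 => {z w a a0 e1 e2} x1 x2 y1 y2 i1 i2.
(* The double-angle formula for the sine, applied to the product of [q2] with the conjugate of
   [q1]. *)
have -> : (x1 * x1 - y1 * y1) * (x2 * y2 + x2 * y2) +
   (x2 * x2 - y2 * y2) * - (x1 * y1 + x1 * y1) = 2 * ((x1 * x2 + y1 * y2) * (x1 * y2 - y1 * x2)) by ring.
rewrite pmulr_rgt0 //.
have [h1|h1] := leP 0 x1; have [h2|h2] := leP 0 x2 => /=.
- by rewrite pmulr_rgt0 ?subr_gt0 ?[x2 * _]mulrC //; nra.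
- by apply/esym; nra.
- by apply/esym/negbTE; rewrite -leNgt; nra.
- by rewrite pmulr_rgt0 ?subr_gt0 ?[x2 * _]mulrC //; nra.
Qed.
End Complex.

Local Notation rev := Defs.rev.

Section Darts.
Variables (V E : finType) (ends : E -> V * V).
Local Notation dart := (E * bool)%type.
Local Notation org := (org ends).
Local Notation ter := (ter ends).

Lemma dart_revK : involutive (@rev E).
Proof. by case=> f b; rewrite /rev /= negbK. Qed.
Lemma org_rev d : org (rev d) = ter d.
Proof. by case: d => f []. Qed.
Lemma ter_rev d : ter (rev d) = org d.
Proof. by case: d => f []. Qed.
Lemma rev_neq (d : dart) : rev d != d.
Proof. by case: d => f b; rewrite -pair_eqE /= eqxx; case: b. Qed.
Lemma endptP v (d : dart) : reflect (v = org d \/ v = ter d) (endpt ends v d.1).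
Proof.
rewrite /endpt /Defs.org /Defs.ter; apply: (iffP orP).
  by case=> /eqP <-; case: d.2; [left|right|right|left].
by case=> ->; case: d.2; [left|right|right|left].
Qed.
Lemma same_edge (d d' : dart) : d.1 = d'.1 -> d' = d \/ d' = rev d.
Proof.
case: d d' => f b [g c] /= ->; have [->|] := eqVneq c b; first by left.
move=> ne; right; congr pair; by case: b c ne => [] [].
Qed.
End Darts.

(** * Heights and half-angles of the darts of a planar drawing *)

Section Planar.
Variables (C : numClosedFieldType) (V E : finType) (pos : V -> C)
          (ends : E -> V * V).
Local Notation R := (creal C).
Local Notation dart := (E * bool)%type.
Local Notation org := (org ends).
Local Notation ter := (ter ends).
Local Notation udir := (udir pos ends).
Hypothesis planar : planar_embedding pos ends.

Lemma org_neq_ter (d : dart) : org d != ter d.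
Proof.
by case: planar => e _ _ _; case: d => f []; rewrite /Defs.org /Defs.ter //= eq_sym.
Qed.

Lemma pos_inj : injective pos. Proof. by case: planar. Qed.

Definition vec (d : dart) : C := pos (ter d) - pos (org d).

Lemma vec_neq0 d : vec d != 0.
Proof. by rewrite subr_eq0 (inj_eq pos_inj) eq_sym org_neq_ter. Qed.

Lemma norm_udir d : `|udir d| = 1.
Proof.
by rewrite /Defs.udir normrM normfV normr_id divff // normr_eq0 vec_neq0.
Qed.

Lemma udir_neq0 d : udir d != 0.
Proof. by rewrite -normr_eq0 norm_udir oner_neq0. Qed.

Lemma udir_rev d : udir (rev d) = - udir d.
Proof.
by rewrite /Defs.udir org_rev ter_rev -opprB normrN mulNr.
Qed.

Definition len d : R := CReal (normr_real (vec d)).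
Lemma len_gt0 d : 0 < len d.
Proof. by change (0 < `|vec d|); rewrite normr_gt0 vec_neq0. Qed.
Lemma vecE d : vec d = udir d * creal_val (len d).
Proof. by rewrite /= divfK // normr_eq0 vec_neq0. Qed.

Lemma segC (a b z : C) : seg a b z -> seg b a z.
Proof.
case=> t [t0 t1 ->]; exists (1 - t); split; rewrite ?subr_ge0 //; last by ring.
by rewrite lerBlDr lerDl.
Qed.

Lemma eseg_dart (d : dart) z : seg (pos (org d)) (pos (ter d)) z -> eseg pos ends d.1 z.
Proof. by case: d => f []; rewrite /eseg /Defs.org /Defs.ter //= => /segC. Qed.

(** The end of the shorter dart lies on the longer edge, hence is a vertex of it. If the darts
    differed, their edges would share both ends, therefore also a midpoint, which is not a vertex of
    either. *)
Lemma ray_inj d d' (lam : R) : org d = org d' -> 0 < lam ->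
  vec d' = creal_val lam * vec d -> d' = d.
Proof.
have [_ _ cross vert] := planar.
wlog le1 : d d' lam / lam <= 1.
  move=> W od l0 v; have [/W|gt1] := leP lam 1; first exact.
  apply/esym; apply: (W d' d lam^-1) => //.
  - by rewrite invf_le1 // ltW.
  - by rewrite invr_gt0.
  - rewrite v mulrA.
    have -> : creal_val (lam^-1) * creal_val lam = creal_val (lam^-1 * lam) by [].
    by rewrite mulVf ?gt_eqF // mul1r.
move=> od l0 v.
have td' : pos (ter d') = pos (org d) + creal_val lam * (pos (ter d) - pos (org d)).
  by rewrite -/(vec d) -v /vec -od addrC subrK.
have : endpt ends (ter d') d.1.
  apply: vert; apply: eseg_dart; exists (creal_val lam); split=> //.
  exact: (ltW l0 : 0 <= lam).
case/(endptP ends) => [e|tt]; first by have := org_neq_ter d'; rewrite e od eqxx.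
have [e|ne] := eqVneq d.1 d'.1.
  case: (same_edge e) => // e'; have := org_neq_ter d.
  by rewrite od e' org_rev eqxx.
have half0 : 0 <= 2^-1 :> C by rewrite invr_ge0 ler0n.
have half1 : 2^-1 <= 1 :> C by rewrite invf_le1 ?ler1n ?ltr0n.
have [u [u1 u2 zu]] : exists u, [/\ endpt ends u d.1, endpt ends u d'.1 &
    pos (org d) + 2^-1 * (pos (ter d) - pos (org d)) = pos u].
  apply: (cross _ _ _ ne); apply: eseg_dart; exists 2^-1; split=> //.
  by rewrite -od tt.
have v0 := vec_neq0 d; case/(endptP ends): u1 => e; rewrite e in zu.
  move: zu; rewrite -/(vec d) -[RHS]addr0 => /addrI/eqP.
  by rewrite mulf_eq0 (negbTE v0) invr_eq0 pnatr_eq0.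
have : vec d = 0.
  have -> : vec d = 2 * (pos (ter d) - (pos (org d) + 2^-1 * (pos (ter d) - pos (org d)))).
    by rewrite /vec; field.
  by rewrite zu subrr mulr0.
by move/eqP; rewrite (negbTE v0).
Qed.

Section Direction.
Variable om : C.
Hypothesis om_generic : forall v w, v != w -> im (om * (pos v - pos w)) != 0.

Definition ht v : R := im (om * pos v).
Definition abscissa v : R := re (om * pos v).
Local Notation H := ht.
Local Notation X := abscissa.

Lemma ht_inj : injective H.
Proof.
move=> v w e; apply/eqP; apply: contraT => /om_generic.
by rewrite mulrBr imD imN -/(H v) -/(H w) e subrr eqxx.
Qed.

Lemma scale_vec d : im (om * vec d) = H (ter d) - H (org d) /\
  re (om * vec d) = X (ter d) - X (org d).
Proof. by rewrite /vec mulrBr imD imN reD reN. Qed.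

Lemma im_udir d : H (ter d) - H (org d) = len d * im (om * udir d).
Proof.
have [<- _] := scale_vec d; rewrite vecE mulrA im_mul re_real im_real mulr0 add0r.
by [].
Qed.

Lemma re_udir d : X (ter d) - X (org d) = len d * re (om * udir d).
Proof.
have [_ <-] := scale_vec d; rewrite vecE mulrA re_mul re_real im_real mulr0 subr0.
by rewrite mulrC.
Qed.

(** The root in the upper half-plane. Its argument is half the direction angle of [d] in the plane
    rotated by [om], taken in [(0, 2 pi)]; the cut is never reached since no edge is horizontal
    there. *)
Definition root_dir d : C := sqrtC (om * udir d).
Local Notation p := root_dir.

Lemma im_root d : 0 < im (p d).
Proof.
apply: im_sqrtC_gt0; have := im_udir d.
have : H (ter d) - H (org d) != 0 by rewrite subr_eq0 (inj_eq ht_inj) eq_sym org_neq_ter.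
by move=> n e; rewrite e mulf_eq0 negb_or in n; case/andP: n.
Qed.

Lemma root_sqr d : p d ^+ 2 = om * udir d. Proof. exact: sqrtCK. Qed.

Lemma root_neq0 d : p d != 0.
Proof.
apply/eqP => e; have := im_root d; rewrite e.
by have -> : im (0 : C) = 0 := im_real 0; rewrite ltxx.
Qed.

Lemma root_eq d q : q ^+ 2 = om * udir d -> 0 < im q -> p d = q.
Proof.
move=> q2 q0; have : p d ^+ 2 == q ^+ 2 by rewrite root_sqr q2.
rewrite eqf_sqr => /orP [] /eqP // e; have := im_root d.
by rewrite e imN oppr_gt0 ltNge ltW.
Qed.

Lemma re_root_gt0 d : (0 < re (p d)) = (H (org d) < H (ter d)).
Proof.
rewrite -[RHS]subr_gt0 im_udir pmulr_rgt0 ?len_gt0 // -root_sqr expr2 im_mul.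
by rewrite -mulr2n pmulrn_lgt0 // pmulr_lgt0 ?im_root.
Qed.

Lemma re_root_neq0 d : re (p d) != 0.
Proof.
apply/eqP => e; have := im_udir d; rewrite -root_sqr expr2 im_mul e !mul0r addr0 mulr0.
by move/eqP; rewrite subr_eq0 (inj_eq ht_inj) eq_sym (negbTE (org_neq_ter d)).
Qed.

Lemma root_rev d : p (rev d) = (if H (org d) < H (ter d) then 'i else - 'i) * p d.
Proof.
apply: root_eq.
  rewrite exprMn root_sqr udir_rev.
  by case: ifP => _; rewrite ?sqrrN sqrCi mulN1r mulrN.
have im_i_mul q : im ('i * q) = re q.
  by rewrite im_mul re_i im_i mul0r add0r mulr1.
have := re_root_neq0 d; rewrite neq_lt orbC -re_root_gt0.
case: ifP => [//|_ /=]; first by rewrite im_i_mul.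
by rewrite mulNr imN im_i_mul oppr_gt0.
Qed.

(** The cotangent of half the direction angle. It is strictly decreasing all the way around a
    vertex, from the cut back to the cut, and thus orders linearly the darts leaving it. *)
Definition angle d : R := cot (p d).
Local Notation c := angle.

Lemma angle_inj d d' : org d = org d' -> c d = c d' -> d' = d.
Proof.
move=> od e; pose t := im (p d') / im (p d).
have t0 : 0 < t by rewrite divr_gt0 ?im_root.
have pE : p d' = creal_val t * p d.
  have id0 : im (p d) != 0 by rewrite gt_eqF ?im_root.
  have id'0 : im (p d') != 0 by rewrite gt_eqF ?im_root.
  apply: re_im_inj.
    rewrite re_mul re_real im_real mul0r subr0.
    have -> : re (p d') = c d' * im (p d') by rewrite /angle /cot divfK.
    by rewrite -e /t /angle /cot; field.
  by rewrite im_mul re_real im_real mulr0 addr0 /t divfK.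
have om0 : om != 0.
  have := root_neq0 d; apply: contraNneq => o0.
  by have := root_sqr d; rewrite o0 mul0r => /eqP; rewrite sqrf_eq0.
have uE : udir d' = (creal_val t) ^+ 2 * udir d.
  by apply: (mulfI om0); rewrite [RHS]mulrCA -root_sqr -[om * _]root_sqr pE exprMn.
apply: (@ray_inj d d' (t ^+ 2 * len d' / len d)) => //.
  apply: divr_gt0; last exact: len_gt0.
  by apply: mulr_gt0; [apply: exprn_gt0 | apply: len_gt0].
rewrite [LHS]vecE uE vecE.
have -> : creal_val (t ^+ 2 * len d' / len d) =
   creal_val t * creal_val t * creal_val (len d') * (creal_val (len d))^-1 by [].
have : creal_val (len d) != 0 by rewrite normr_eq0 vec_neq0.
move: (creal_val (len d)) (creal_val (len d')) (creal_val t) => x y z x0.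
by field.
Qed.

Lemma root_div_im d d' : (0 < im (p d / p d')) = (c d < c d').
Proof. by rewrite im_div_gt0 ?im_root. Qed.

Lemma udir_div d d' : udir d / udir d' = (p d / p d') ^+ 2.
Proof.
have om0 : om != 0.
  have := root_neq0 d; apply: contraNneq => o0.
  by have := root_sqr d; rewrite o0 mul0r => /eqP; rewrite sqrf_eq0.
rewrite exprMn exprVn !root_sqr.
have := udir_neq0 d'; move: (udir d) (udir d') => x y y0.
by field; rewrite y0 om0.
Qed.

(** The turn from [rev d] to [d'] has unit ratio minus the square of [p d' / p d], whose roots are
    that quotient times ['i] or [- 'i]. Positivity of the real part of the root is the comparison of
    the two angles; this is how half-angle phases become comparisons. *)
Lemma hw_rev d d' : org d = org d' -> d != d' ->
  hw pos ends (rev d) d' = (if c d < c d' then 1 else -1) * 'i * (p d' / p d).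
Proof.
move=> od dd'; apply: halfexp_eq.
  rewrite udir_rev invrN mulrN udir_div exprMn.
  case: ifP => _; rewrite ?mulN1r ?mul1r ?sqrrN sqrCi; ring.
have reE : re ('i * (p d' / p d)) = - im (p d' / p d).
  by rewrite re_mul re_i im_i mul0r mul1r sub0r.
have cc : c d != c d' by apply: contra dd' => /eqP /(angle_inj od) ->.
case: (ltgtP (c d) (c d')) cc => //= lt _; last first.
  by rewrite mulN1r mulNr reN reE opprK root_div_im.
rewrite mul1r reE im_div_cot ?im_root // oppr_gt0 pmulr_llt0; last first.
  by rewrite invr_gt0 ltr_pwDr ?exprn_gt0 ?sqr_ge0 ?im_root.
by rewrite pmulr_rlt0 ?mulr_gt0 ?im_root // subr_lt0.
Qed.

(** The cyclic order from [d0] is the decreasing order of [angle] cut at [d0]: two darts on the same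
    side of [d0] are met in decreasing order, otherwise the one of smaller angle than [d0] comes
    first. *)
Lemma ccw_before_angle d0 d1 d2 : org d1 = org d0 -> org d2 = org d0 ->
  d1 != d0 -> d2 != d0 -> d2 != d1 ->
  ccw_before (udir d0) (udir d1) (udir d2) =
  (((c d1 < c d0) == (c d2 < c d0)) == (c d2 < c d1)).
Proof.
move=> o1 o2 n1 n2 n12.
have cne d d' : org d = org d0 -> org d' = org d0 -> d != d' -> c d != c d'.
  by move=> e e'; apply: contra => /eqP h; rewrite (angle_inj _ h) ?e ?e'.
have om0 : om != 0.
  have := root_neq0 d0; apply: contraNneq => o0.
  by have := root_sqr d0; rewrite o0 mul0r => /eqP; rewrite sqrf_eq0.
(* The sign that brings the quotient of roots into the upper half-plane, as [ccw_beforeE]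
   requires. *)
pose s d : C := if c d < c d0 then 1 else -1.
pose q d := s d * (p d / p d0).
have s2 d : s d ^+ 2 = 1 by rewrite /s; case: ifP => _; rewrite ?sqrrN expr1n.
have q0 d : org d = org d0 -> d != d0 -> 0 < im (q d).
  move=> od nd; have := cne _ _ od erefl nd; rewrite /q /s; case: (ltgtP (c d) (c d0)) => //= lt _.
    by rewrite mul1r root_div_im.
  rewrite mulN1r imN im_div_cot ?im_root // -mulNr -mulrN.
  by rewrite divr_gt0 ?mulr_gt0 ?im_root ?opprB ?subr_gt0 // ltr_pwDr ?exprn_gt0 ?sqr_ge0 ?im_root.
have q2 d : udir d / udir d0 = q d ^+ 2 by rewrite exprMn s2 mul1r udir_div.
rewrite (ccw_beforeE (udir_neq0 _) (q0 d1 _ _) (q0 d2 _ _) (q2 _) (q2 _)) //.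
rewrite -im_div_gt0 ?q0 //.
have -> : q d2 / q d1 = s d2 * s d1 * (p d2 / p d1).
  have s1 : (s d1)^-1 = s d1 by rewrite /s; case: ifP => _; rewrite ?invrN invr1.
  have s0 : s d1 != 0 by rewrite -sqrf_eq0 s2 oner_neq0.
  rewrite -[in RHS]s1 /q; move: (root_neq0 d0) (root_neq0 d1) s0.
  move: (p d0) (p d1) (p d2) (s d1) (s d2) => x0 x1 x2 t1 t2 n0 n1' nt.
  by field; rewrite n0 n1' nt.
have c12 := cne _ _ o2 o1 n12.
have neg : (0 < im (- (p d2 / p d1))) = ~~ (c d2 < c d1).
  rewrite imN oppr_gt0 im_div_cot ?im_root // pmulr_llt0; last first.
    by rewrite invr_gt0 ltr_pwDr ?exprn_gt0 ?sqr_ge0 ?im_root.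
  rewrite pmulr_rlt0 ?mulr_gt0 ?im_root // subr_lt0.
  by rewrite -/(c d1) -/(c d2); case: ltgtP c12.
have -> : s d2 * s d1 = if (c d1 < c d0) == (c d2 < c d0) then 1 else -1.
  by rewrite /s; case: (c d1 < c d0); case: (c d2 < c d0); rewrite /= ?mulrNN ?mulr1 ?mul1r.
case: ((c d1 < c d0) == (c d2 < c d0)); first by rewrite mul1r root_div_im.
by rewrite mulN1r neg; case: (c d2 < c d1).
Qed.

End Direction.
End Planar.

(** * The order of the darts *)

Section Gauge.
Variables (C : numClosedFieldType) (V E : finType) (pos : V -> C)
          (ends : E -> V * V).
Local Notation R := (creal C).
Local Notation dart := (E * bool)%type.
Local Notation org := (org ends).
Local Notation ter := (ter ends).
Local Notation udir := (udir pos ends).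
Hypothesis planar : planar_embedding pos ends.
Variable om : C.
Hypothesis om_generic : forall v w, v != w -> im (om * (pos v - pos w)) != 0.
Local Notation H := (ht pos om).
Local Notation X := (abscissa pos om).
Local Notation p := (root_dir pos ends om).
Local Notation c := (angle pos ends om).

Lemma angle_neq d d' : org d = org d' -> d' != d -> c d != c d'.
Proof. by move=> od; apply: contra => /eqP /(angle_inj planar om_generic od) ->. Qed.

Section Eta.
Variable eta : dart -> C.
Hypothesis eta_sqr : forall d, eta d ^+ 2 = udir d.

Lemma eta_conj d : (eta d)^* = (eta d)^-1.
Proof.
have n1 : `|eta d| = 1.
  apply/eqP; rewrite -(@pexpr_eq1 _ _ 2) ?normr_ge0 // -normrX eta_sqr.
  by rewrite (norm_udir planar).
by rewrite invC_norm n1 expr1n invr1 mul1r.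
Qed.

Lemma eta_neq0 d : eta d != 0.
Proof. by rewrite -sqrf_eq0 eta_sqr (udir_neq0 planar). Qed.

Lemma dir_neq0 (d : dart) : om != 0.
Proof.
have := root_neq0 planar om_generic d; apply: contraNneq => o0.
by rewrite -sqrf_eq0 root_sqr o0 mul0r.
Qed.

(* Dividing [eta d] by the root of [om * udir d] in the upper half-plane leaves a sign,
   and the half-angle phases of the Kac-Ward matrix become comparisons of slopes. *)
Definition gauge_sign d : C := eta d * sqrtC om / p d.
Local Notation s := gauge_sign.

Lemma gauge_sqr d : s d * s d = 1.
Proof.
rewrite -expr2 /gauge_sign !exprMn exprVn sqrtCK root_sqr eta_sqr.
by rewrite [udir d * om]mulrC divff // mulf_neq0 ?dir_neq0 ?(udir_neq0 planar).
Qed.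

Lemma eta_gauge d : eta d = s d * (p d / sqrtC om).
Proof.
have o0 : sqrtC om != 0 by rewrite sqrtC_eq0 (dir_neq0 d).
rewrite /gauge_sign; have := root_neq0 planar om_generic d.
by move: (p d) (eta d) (sqrtC om) o0 => x y z z0 x0; field; rewrite x0 z0.
Qed.

(** The roots in [eta d] and in the inverse of [eta d'] cancel the quotient of roots in [hw_rev],
    and the two factors ['i] cancel the sign in front. *)
Lemma vertex_entry d d' : org d = org d' -> d != d' ->
  - ('i * eta d * (eta d')^* * hw pos ends (rev d) d') =
  s d * s d' * (if c d < c d' then 1 else -1).
Proof.
move=> od dd'; rewrite eta_conj (hw_rev planar om_generic od dd').
have o0 : sqrtC om != 0 by rewrite sqrtC_eq0 (dir_neq0 d).
have s0 e : s e != 0 by apply/eqP => e0; have := gauge_sqr e; rewrite e0 mul0r => /esym/eqP; rewrite oner_eq0.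
have sV e : (s e)^-1 = s e by rewrite -[LHS]mul1r -(gauge_sqr e) mulfK.
rewrite -[in RHS](sV d') (eta_gauge d) (eta_gauge d').
have p0 := root_neq0 planar om_generic.
set b : C := if _ then _ else _.
transitivity (- ('i ^+ 2) * (s d * (s d')^-1 * b)); last by rewrite sqrCi opprK mul1r.
move: (p0 d) (p0 d') (s0 d') o0.
move: (p d) (p d') (s d) (s d') (sqrtC om) 'i b => x x' y y' z i b x0 x'0 y0 z0.
by field; rewrite x0 x'0 y0 z0.
Qed.

Lemma edge_entry d :
  'i * eta d * (eta (rev d))^* = s d * s (rev d) * (if H (org d) < H (ter d) then 1 else -1).
Proof.
rewrite eta_conj.
have o0 : sqrtC om != 0 by rewrite sqrtC_eq0 (dir_neq0 d).
have s0 e : s e != 0 by apply/eqP => e0; have := gauge_sqr e; rewrite e0 mul0r => /esym/eqP; rewrite oner_eq0.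
have sV e : (s e)^-1 = s e by rewrite -[LHS]mul1r -(gauge_sqr e) mulfK.
rewrite -[in RHS](sV (rev d)) (eta_gauge d) (eta_gauge (rev d)) (root_rev planar om_generic).
have p0 := root_neq0 planar om_generic d.
have i0 : 'i != 0 :> C by apply: neq0Ci.
case: ifP => _; move: (s0 (rev d)) o0 p0 i0.
  move: (p d) (s d) (s (rev d)) (sqrtC om) 'i => x y y' z i y0 z0 x0 i0.
  by field; rewrite x0 y0 z0 i0.
move: (p d) (s d) (s (rev d)) (sqrtC om) 'i => x y y' z i y0 z0 x0 i0.
by field; rewrite x0 y0 z0 i0.
Qed.
End Eta.

(** Passing from the cyclic order to the linear order of angles changes the arc tests of [x] and [y]
    by the same boolean, the comparison of [a] with [b], so separation is unaffected. *)
Lemma crossingE a b x y : ter b = ter a -> ter x = ter a -> ter y = ter a ->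
  a != b -> x != a -> x != b -> y != a -> y != b ->
  crossing pos ends a b x y =
  (((c (rev a) < c (rev x)) == (c (rev x) < c (rev b))) !=
   ((c (rev a) < c (rev y)) == (c (rev y) < c (rev b)))).
Proof.
move=> tb tx ty ab xa xb ya yb; rewrite /crossing.
have revI := inv_inj (@dart_revK E).
have cneg z w : ter z = ter a -> ter w = ter a -> z != w ->
    (c (rev z) < c (rev w)) = ~~ (c (rev w) < c (rev z)).
  move=> tz tw zw; have : c (rev w) != c (rev z).
    by apply: angle_neq; rewrite ?org_rev ?tz ?tw // (inj_eq revI).
  by case: ltgtP.
have arcE z : ter z = ter a -> z != a -> z != b ->
    ccw_before (udir (rev a)) (udir (rev z)) (udir (rev b)) =
    (((c (rev a) < c (rev z)) == (c (rev z) < c (rev b))) != (c (rev a) < c (rev b))).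
  move=> tz za zb; rewrite (ccw_before_angle planar om_generic) ?org_rev ?(inj_eq revI) //;
    rewrite 1?eq_sym //.
  rewrite (cneg z a) // (cneg b a) 1?[b == a]eq_sym // (cneg b z) 1?[b == z]eq_sym //.
  by case: (_ < _); case: (_ < _); case: (_ < _).
rewrite !arcE //; case: (c (rev a) < c (rev b));
by case: (_ < _); case: (_ < _); case: (_ < _); case: (_ < _).
Qed.

(** Horizontal displacement per unit of height: edges are viewed as graphs over the height axis. *)
Definition slope f : R := (X (ends f).2 - X (ends f).1) / (H (ends f).2 - H (ends f).1).
Definition line f h : R := X (ends f).1 + (h - H (ends f).1) * slope f.

Lemma ht_neq (d : dart) : H (ter d) - H (org d) != 0.
Proof. by rewrite subr_eq0 (inj_eq (ht_inj om_generic)) eq_sym (org_neq_ter planar). Qed.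

Lemma slopeE d : slope d.1 = (X (ter d) - X (org d)) / (H (ter d) - H (org d)).
Proof.
have := ht_neq d; case: d => f [] n0; rewrite /slope /Defs.org /Defs.ter //= in n0 *.
have n1 : H (ends f).2 - H (ends f).1 != 0 by rewrite -oppr_eq0 opprB.
by field; rewrite n0 n1.
Qed.

Lemma line_dart d h : line d.1 h = X (org d) + (h - H (org d)) * slope d.1.
Proof.
case: d => f []; rewrite /line /Defs.org //=.
have := ht_neq (f, true); rewrite /slope /Defs.org /Defs.ter /= => n0.
by field.
Qed.

Lemma line_org d : line d.1 (H (org d)) = X (org d).
Proof. by rewrite line_dart subrr mul0r addr0. Qed.
Lemma line_ter d : line d.1 (H (ter d)) = X (ter d).
Proof. by rewrite -org_rev -[d.1]/((rev d).1) line_org. Qed.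

(** The double-angle formula for the cotangent: the slope is the cotangent of the direction angle,
    [c d] that of its half. *)
Lemma slope_root d : slope d.1 = (c d - (c d)^-1) / 2.
Proof.
rewrite slopeE (im_udir planar) (re_udir planar) -!root_sqr !expr2 im_mul re_mul.
have := gt_eqF (len_gt0 planar d); have := gt_eqF (im_root planar om_generic d).
have := re_root_neq0 planar om_generic d; rewrite /angle /cot.
move: (re (p d)) (im (p d)) (len _ _ d) => x y l x0 /negbT y0 /negbT l0.
by field; rewrite y0 x0 l0 -mulr2n mulrn_eq0 mulf_neq0 ?x0 ?y0.
Qed.

Lemma angle_gt0 d : (0 < c d) = (H (org d) < H (ter d)).
Proof.
rewrite -(re_root_gt0 planar om_generic) /angle /cot.
by rewrite pmulr_lgt0 // invr_gt0 (im_root planar om_generic).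
Qed.

Lemma angle_neq0 d : c d != 0.
Proof.
rewrite /angle /cot mulf_neq0 ?(re_root_neq0 planar om_generic) //.
by rewrite invr_eq0 gt_eqF ?(im_root planar om_generic).
Qed.

(** The map from half-angle cotangent to slope is increasing on each half-line, so among darts that
    all go up, or all go down, comparing angles is comparing slopes. *)
Lemma slope_mono (x y : R) : x != 0 -> y != 0 -> (0 < x) = (0 < y) ->
  ((x - x^-1) / 2 < (y - y^-1) / 2) = (x < y).
Proof.
move=> x0 y0 xy; have pos_xy : 0 < x * y.
  have [xp|xp|e] := ltgtP 0 x; last by rewrite -e eqxx in x0.
    by rewrite mulr_gt0 // -xy.
  rewrite -mulrNN mulr_gt0 ?oppr_gt0 //.
  by rewrite lt_neqAle y0 leNgt -xy -leNgt ltW.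
rewrite -subr_gt0 -[RHS]subr_gt0.
have -> : (y - y^-1) / 2 - (x - x^-1) / 2 = (y - x) * ((1 + (x * y)^-1) / 2).
  by field; rewrite ?pnatr_eq0 ?x0 ?y0.
by rewrite pmulr_lgt0 // divr_gt0 // addr_gt0 // invr_gt0.
Qed.

Lemma line_meet f g h : f != g ->
  (H (ends f).1 <= h <= H (ends f).2) || (H (ends f).2 <= h <= H (ends f).1) ->
  (H (ends g).1 <= h <= H (ends g).2) || (H (ends g).2 <= h <= H (ends g).1) ->
  line f h = line g h -> exists v, [/\ endpt ends v f, endpt ends v g & h = H v].
Proof.
move=> fg hf hg e.
have pt f' : (H (ends f').1 <= h <= H (ends f').2) || (H (ends f').2 <= h <= H (ends f').1) ->
  exists z, [/\ eseg pos ends f' z, re (om * z) = line f' h & im (om * z) = h].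
  move=> hf'; have n0 := ht_neq (f', true); rewrite /Defs.org /Defs.ter /= in n0.
  pose t := (h - H (ends f').1) / (H (ends f').2 - H (ends f').1).
  have t0 : 0 <= t /\ t <= 1.
    case/orP: hf' => /andP [h1 h2].
      have d0 : 0 < H (ends f').2 - H (ends f').1 by rewrite lt_def n0 subr_ge0 (le_trans h1 h2).
      split; first by apply: divr_ge0; rewrite subr_ge0 //; apply: le_trans h1 h2.
      by rewrite ler_pdivrMr // mul1r lerD2r.
    have d0 : H (ends f').2 - H (ends f').1 < 0 by rewrite lt_def eq_sym n0 subr_le0 (le_trans h1 h2).
    split; first by rewrite nmulr_lge0 ?invr_lt0 // subr_le0.
    by rewrite ler_ndivrMr // mul1r lerD2r.
  exists (pos (ends f').1 + creal_val t * (pos (ends f').2 - pos (ends f').1)).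
  have omE : om * (pos (ends f').1 + creal_val t * (pos (ends f').2 - pos (ends f').1)) =
     om * pos (ends f').1 + creal_val t * (om * pos (ends f').2 - om * pos (ends f').1) by ring.
  have aux (a b : C) : re (a + creal_val t * (b - a)) = re a + t * (re b - re a) /\
     im (a + creal_val t * (b - a)) = im a + t * (im b - im a).
    by rewrite reD imD re_mul im_mul re_real im_real reD imD reN imN; split; ring.
  rewrite omE; have [-> ->] := aux (om * pos (ends f').1) (om * pos (ends f').2).
  split; first by exists (creal_val t); case: t0.
    by rewrite /line /slope /t -/(X (ends f').1) -/(X (ends f').2); field.
  by rewrite -/(H (ends f').1) -/(H (ends f').2) /t; field.
have [z [zf zx zh]] := pt f hf; have [z' [zg zx' zh']] := pt g hg.
have zz : z = z'.
  apply: (mulfI (dir_neq0 (f, true))); apply: re_im_inj; rewrite ?zx ?zx' ?zh ?zh' //.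
rewrite -zz in zg.
have [_ _ cross _] := planar.
have [v [vf vg zv]] := cross _ _ _ fg zf zg.
by exists v; rewrite -zh zv.
Qed.

Definition up_dart f : dart := (f, H (ends f).1 < H (ends f).2).
Local Notation ud := up_dart.

Lemma up_dartP f : H (org (ud f)) < H (ter (ud f)).
Proof.
have := ht_neq (f, true); rewrite /Defs.org /Defs.ter /= subr_eq0 => n0.
by rewrite /up_dart /=; case: ifP => //= /negbT; rewrite -leNgt le_eqVlt (negbTE n0).
Qed.

Definition dart_lt (d d' : dart) :=
  (H (org d) < H (org d')) || (org d == org d') && (c d < c d').

Lemma dart_lt_angle d d' : org d = org d' -> dart_lt d d' = (c d < c d').
Proof. by move=> od; rewrite /dart_lt od ltxx eqxx. Qed.

Lemma dart_ltxx d : dart_lt d d = false.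
Proof. by rewrite dart_lt_angle // ltxx. Qed.

Lemma dart_lt_trans : transitive dart_lt.
Proof.
move=> d2 d1 d3; rewrite /dart_lt => /orP [l1|/andP [/eqP o1 l1]] /orP [l2|/andP [/eqP o2 l2]].
- by rewrite (lt_trans l1 l2).
- by rewrite -o2 l1.
- by rewrite o1 l2.
- by rewrite o1 o2 eqxx (lt_trans l1 l2) orbT.
Qed.

Lemma dart_lt_total d d' : d != d' -> dart_lt d d' || dart_lt d' d.
Proof.
move=> dd'; rewrite /dart_lt [org d' == _]eq_sym.
have [od|nod] := eqVneq (org d) (org d').
  by rewrite od ltxx /= -neq_lt angle_neq // eq_sym.
by rewrite !orbF -neq_lt (inj_eq (ht_inj om_generic)).
Qed.

(** Darts leaving one vertex are consecutive in the order; this lets a pair at a vertex be decoupled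
    from all other vertices. *)
Lemma dart_lt_org d d' w : org d = org d' -> org w != org d ->
  dart_lt d w = dart_lt d' w.
Proof. by move=> od; rewrite eq_sym => /negbTE ow; rewrite /dart_lt -od ow. Qed.

Lemma dart_lt_rev d : dart_lt d (rev d) = (H (org d) < H (ter d)).
Proof. by rewrite /dart_lt org_rev (negbTE (org_neq_ter planar d)) orbF. Qed.

Definition left_of f v :=
  (H (org (ud f)) < H v < H (ter (ud f))) && (X v < line f (H v)).

Lemma left_of_org f (b : bool) : left_of f (org (f, b)) = false.
Proof.
rewrite /left_of; have [->|->] := same_edge (erefl : (ud f).1 = (f, b).1).
  by rewrite ltxx.
by rewrite org_rev ltxx andbF.
Qed.

(** This is [interleaving_parity] for two edges drawn as graphs over heights, [D h] being the
    difference of their abscissas. Equal heights mean a common vertex, where the comparison of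
    slopes decides. *)
Lemma up_dart_parity f g : f != g ->
  dart_lt (ud f) (ud g) (+) dart_lt (rev (ud f)) (rev (ud g))
    (+) dart_lt (ud f) (rev (ud g)) (+) dart_lt (rev (ud f)) (ud g) =
  left_of f (org (ud g)) (+) left_of f (ter (ud g))
    (+) left_of g (org (ud f)) (+) left_of g (ter (ud f)).
Proof.
move=> fg; have uf := up_dartP f; have ug := up_dartP g.
pose k := slope f - slope g; pose d := line f 0 - line g 0.
have DE h : d + h * k = line f h - line g h by rewrite /d /k /line; ring.
have lo f' : line f' (H (org (ud f'))) = X (org (ud f')) := line_org (ud f').
have hi f' : line f' (H (ter (ud f'))) = X (ter (ud f')) := line_ter (ud f').
have heq v w : (H v == H w) = (v == w) by rewrite (inj_eq (ht_inj om_generic)).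
have between f' h : H (org (ud f')) <= h <= H (ter (ud f')) ->
    (H (ends f').1 <= h <= H (ends f').2) || (H (ends f').2 <= h <= H (ends f').1).
  by rewrite /up_dart /Defs.org /Defs.ter /=; case: ifP => _ ->; rewrite ?orbT.
have endpt_h f' h v : endpt ends v f' -> h = H v -> (h == H (org (ud f'))) || (h == H (ter (ud f'))).
  by move=> /(endptP _ _ (ud f')) [] -> ->; rewrite eqxx ?orbT.
have meet h : H (org (ud f)) <= h <= H (ter (ud f)) ->
    H (org (ud g)) <= h <= H (ter (ud g)) -> d + h * k = 0 ->
    ((h == H (org (ud f))) || (h == H (ter (ud f)))) &&
    ((h == H (org (ud g))) || (h == H (ter (ud g)))).
  move=> hf hg; rewrite DE => /eqP; rewrite subr_eq0 => /eqP e.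
  have [v [vf vg hv]] := line_meet fg (between _ _ hf) (between _ _ hg) e.
  by rewrite (endpt_h f h v) // (endpt_h g h v).
have low : H (org (ud f)) = H (org (ud g)) -> d + H (org (ud f)) * k = 0.
  by move=> e; rewrite DE {2}e !lo; move/(ht_inj om_generic): e => ->; rewrite subrr.
have high : H (ter (ud f)) = H (ter (ud g)) -> d + H (ter (ud f)) * k = 0.
  by move=> e; rewrite DE {2}e !hi; move/(ht_inj om_generic): e => ->; rewrite subrr.
have := interleaving_parity uf ug meet low high; rewrite /=.
have cu f' : 0 < c (ud f') by rewrite angle_gt0 up_dartP.
have cd f' : c (rev (ud f')) < 0.
  rewrite lt_neqAle angle_neq0 leNgt angle_gt0 org_rev ter_rev.
  by rewrite -leNgt ltW ?up_dartP.
have -> : (H (org (ud f)) < H (org (ud g))) || (H (org (ud f)) == H (org (ud g))) && (k < 0) =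
     dart_lt (ud f) (ud g).
  rewrite /dart_lt heq /k subr_lt0 (slope_root (ud f)) (slope_root (ud g)).
  by rewrite slope_mono ?angle_neq0 // !cu.
have -> : (H (ter (ud f)) < H (ter (ud g))) || (H (ter (ud f)) == H (ter (ud g))) && (k < 0) =
     dart_lt (rev (ud f)) (rev (ud g)).
  rewrite /dart_lt !org_rev heq /k subr_lt0 (slope_root (rev (ud f))) (slope_root (rev (ud g))).
  by rewrite slope_mono ?angle_neq0 // (lt_gtF (cd f)) (lt_gtF (cd g)).
(* Downward darts have negative angle and precede upward ones at the same vertex. Hence a tie in
   height counts as false here and as true in the next comparison. *)
have udE : (H (org (ud f)) < H (ter (ud g))) = dart_lt (ud f) (rev (ud g)).
  by rewrite /dart_lt org_rev (lt_gtF (lt_trans (cd g) (cu f))) andbF orbF.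
have -> : (H (ter (ud f)) <= H (org (ud g))) = dart_lt (rev (ud f)) (ud g).
  by rewrite /dart_lt org_rev (lt_trans (cd f) (cu g)) andbT le_eqVlt heq orbC.
rewrite -udE => ->; rewrite !DE /left_of.
have -> : (0 < line f (H (org (ud g))) - line g (H (org (ud g)))) =
  (X (org (ud g)) < line f (H (org (ud g)))) by rewrite subr_gt0 lo.
have -> : (0 < line f (H (ter (ud g))) - line g (H (ter (ud g)))) =
  (X (ter (ud g)) < line f (H (ter (ud g)))) by rewrite subr_gt0 hi.
by rewrite !subr_lt0 lo hi.
Qed.

Definition bsign (b : bool) : C := if b then 1 else -1.

Definition side f v : C := bsign (~~ left_of f v).

(** The left-hand side takes all four darts together, so reorienting the edges upwards only permutes
    its factors and [up_dart_parity] applies. *)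
Lemma dart_lt_cross f g : f != g ->
  bsign (dart_lt (f, true) (g, true)) * bsign (dart_lt (f, true) (g, false)) *
   (bsign (dart_lt (f, false) (g, true)) * bsign (dart_lt (f, false) (g, false))) =
  side f (ends g).1 * side f (ends g).2 * (side g (ends f).1 * side g (ends f).2).
Proof.
move=> /up_dart_parity.
have bsignM b b' : bsign b * bsign b' = bsign (b == b').
  by case: b b' => [] []; rewrite /bsign ?mulrNN !(mul1r, mulr1).
rewrite /side !bsignM => par; congr bsign; move: par.
rewrite /up_dart /rev /Defs.org /Defs.ter /=.
case: (H _ < H _); case: (H _ < H _) => /=;
move: (dart_lt (f, true) (g, true)) (dart_lt (f, true) (g, false))
      (dart_lt (f, false) (g, true)) (dart_lt (f, false) (g, false))
      (left_of f _) (left_of f _) (left_of g _) (left_of g _);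
by do 8 case.
Qed.

Lemma side_org f b : side f (org (f, b)) = 1.
Proof. by rewrite /side left_of_org. Qed.

Lemma side_sqr f v : side f v * side f v = 1.
Proof. by rewrite /side /bsign; case: ifP => _; rewrite ?mulrNN mulr1. Qed.
End Gauge.

(** * Noncrossing pairings *)

Section Pairings.
Variables (V E : finType) (ends : E -> V * V).
Local Notation dart := (E * bool)%type.
Local Notation org := (org ends).
Local Notation ter := (ter ends).
Variable lt : rel dart.
Hypothesis ltxx : irreflexive lt.
Hypothesis lt_trans : transitive lt.
Hypothesis lt_total : forall d d', d != d' -> lt d d' || lt d' d.

Lemma lt_neg d d' : d != d' -> lt d' d = ~~ lt d d'.
Proof.
move=> /lt_total; case l1: (lt d d'); case l2: (lt d' d) => //= _.
by have := lt_trans l1 l2; rewrite ltxx.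
Qed.

Definition between (a b x : dart) := lt (rev a) (rev x) != lt (rev b) (rev x).

Lemma betweenC a b x : between a b x = between b a x.
Proof. by rewrite /between eq_sym. Qed.

Lemma between_nest a b x x' z : a != b -> x != a -> x != b -> x' != a -> x' != b ->
  between a b x -> between a b x' -> between x x' z ->
  [&& z != a, z != b & between a b z].
Proof.
have revI := inv_inj (@dart_revK E).
wlog lab : a b / lt (rev a) (rev b).
  move=> W ab xa xb x'a x'b; have : rev a != rev b by rewrite (inj_eq revI).
  case/lt_total/orP => [/W|/W]; first exact.
  rewrite ![between b a _]betweenC [(z != b) && _]andbCA; apply; by rewrite // eq_sym.
wlog lx : x x' / lt (rev x) (rev z).
  move=> W ab xa xb x'a x'b bx bx' xz.
  case l1: (lt (rev x) (rev z)); first by apply: (W x x').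
  by apply: (W x' x) => //; [move: xz; rewrite /between l1; case: (lt _ _) | rewrite betweenC].
move=> ab xa xb x'a x'b.
have inside y : y != a -> y != b -> between a b y -> lt (rev a) (rev y) && lt (rev y) (rev b).
  move=> ya yb; rewrite /between (lt_neg (d := rev y) (d' := rev b)) ?(inj_eq revI) //.
  case l1: (lt (rev a) (rev y)); case l2: (lt (rev y) (rev b)) => //= _.
  have l3 : lt (rev b) (rev y) by rewrite (lt_neg (d := rev y)) ?(inj_eq revI) // l2.
  by have := lt_trans lab l3; rewrite l1.
move=> /(inside _ xa xb)/andP [ax _] /(inside _ x'a x'b)/andP [_ x'b'] xz.
have nx'z : ~~ lt (rev x') (rev z) by move: xz; rewrite /between lx; case: (lt _ _).
have zb : lt (rev z) (rev b).
  have [->//|ne] := eqVneq z x'; apply: lt_trans x'b'.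
  by rewrite (lt_neg (d := rev x')) ?(inj_eq revI) // eq_sym.
have az := lt_trans ax lx; apply/and3P; split.
- by apply: contraTneq az => ->; rewrite ltxx.
- by apply: contraTneq zb => ->; rewrite ltxx.
rewrite /between az; case l: (lt (rev b) (rev z)) => //.
by have := lt_trans zb l; rewrite ltxx.
Qed.

Definition noncrossing_lt (P : {set dart}) (pi : dart -> dart) :=
  forall a b, a \in P -> b \in P -> ter a = ter b -> b != a -> b != pi a ->
  between a (pi a) b = between a (pi a) (pi b).

(** A pair with the fewest elements of [I] between its two darts is chosen. By noncrossing, an
    element between them has its partner there as well, and that pair would enclose strictly
    fewer. *)
Lemma innermost_pair (P I : {set dart}) pi : pairing ends P pi -> noncrossing_lt P pi ->
  I \subset P -> I != set0 -> (forall d, d \in I -> pi d \in I) ->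
  exists2 a, a \in I & forall x, x \in I -> ter x = ter a -> x != a -> x != pi a ->
    lt (rev a) (rev x) = lt (rev (pi a)) (rev x).
Proof.
move=> pair nc /subsetP IP /set0Pn [d0 d0I] piI.
pose S a := [set x in I | [&& ter x == ter a, x != a, x != pi a & between a (pi a) x]].
pose a := [arg min_(a < d0 in I) #|S a|].
have [aI amin] : a \in I /\ forall a', a' \in I -> (#|S a| <= #|S a'|)%N.
  by rewrite /a; case: arg_minnP.
exists a => // x xI xv xa xpa; apply/eqP/negPn/negP => bx.
have [paP pav /eqP pane paK] := pair _ (IP _ aI).
have [pxP pxv /eqP pxne pxK] := pair _ (IP _ xI).
have pxa : pi x != a by apply: contraNneq xpa => <-; rewrite pxK.
have pxpa : pi x != pi a.
  by apply: contraNneq xa => /(congr1 pi); rewrite pxK paK => ->.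
have bpx : between a (pi a) (pi x).
  by rewrite -(nc a x) ?IP.
have := amin x xI; rewrite leqNgt => /negP; apply; apply: proper_card; apply/properP; split.
  apply/subsetP => z; rewrite !inE => /and5P [zI /eqP zv zx zpx bz].
  have /and3P [-> -> ->] : [&& z != a, z != pi a & between a (pi a) z].
    by apply: (between_nest _ xa xpa pxa pxpa bx bpx bz); rewrite eq_sym.
  by rewrite zI zv xv eqxx.
exists x; first by rewrite !inE xI xv eqxx xa xpa.
by rewrite !inE !eqxx /= ?andbF.
Qed.

Definition vertex_rank (P : {set dart}) d :=
  #|[set x in P | (ter x == ter d) && lt (rev x) (rev d)]|.

Lemma vertex_rank_lt (P : {set dart}) a b : a \in P -> ter a = ter b ->
  lt (rev a) (rev b) = (vertex_rank P a < vertex_rank P b)%N.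
Proof.
have revI := inv_inj (@dart_revK E).
have mono a' b' : a' \in P -> ter a' = ter b' -> lt (rev a') (rev b') ->
    (vertex_rank P a' < vertex_rank P b')%N.
  move=> aP ab l; apply: proper_card; apply/properP; split.
    apply/subsetP => x; rewrite !inE ab => /and3P [-> -> l2] /=; exact: lt_trans l.
  by exists a'; rewrite !inE aP ab eqxx ?l ?ltxx.
move=> aP ab; have [->|ne] := eqVneq a b; first by rewrite ltxx ltnn.
case l: (lt (rev a) (rev b)); first by rewrite mono.
apply/esym/negbTE; rewrite -leqNgt.
apply: subset_leq_card; apply/subsetP => x; rewrite !inE ab => /and3P [-> -> l2] /=.
by apply: lt_trans l2 _; rewrite (lt_neg (d := rev a)) ?l // (inj_eq revI).
Qed.

Lemma vertex_rank_inj (P : {set dart}) a b : a \in P -> b \in P -> ter a = ter b ->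
  vertex_rank P a = vertex_rank P b -> a = b.
Proof.
move=> aP bP ab e; apply/eqP; apply: contraT => ne.
have := @lt_total (rev a) (rev b); rewrite (inj_eq (inv_inj (@dart_revK E))).
by case/(_ ne)/orP; rewrite (@vertex_rank_lt P) // ?ab // e ltnn.
Qed.

Lemma vertex_rank_surj (P : {set dart}) d j : d \in P -> (j < #|[set x in P | ter x == ter d]|)%N ->
  exists2 a, (a \in P) && (ter a == ter d) & vertex_rank P a = j.
Proof.
set Pv := [set x in P | ter x == ter d]; move=> dP jK.
have rk_lt a : a \in Pv -> (vertex_rank P a < #|Pv|)%N.
  rewrite inE => /andP [aP /eqP av]; apply: proper_card; apply/properP; split.
    by apply/subsetP => x; rewrite !inE av => /and3P [-> ->].
  by exists a; rewrite !inE ?aP ?av ?eqxx ?ltxx.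
have rk_lt' (a : seq_sub (enum Pv)) : (vertex_rank P (val a) < #|Pv|)%N.
  by apply: rk_lt; rewrite -mem_enum (valP a).
pose rk a : 'I_#|Pv| := Ordinal (rk_lt' a).
have rk_inj : injective rk.
  move=> a b /(congr1 val) /= e; apply: val_inj.
  have := valP a; have := valP b; rewrite !mem_enum !inE => /andP [bP /eqP bv] /andP [aP /eqP av].
  by apply: (@vertex_rank_inj P) => //; rewrite av bv.
have card_eq : (#|'I_#|Pv| | <= #|{: seq_sub (enum Pv)}|)%N.
  by rewrite card_ord card_seq_sub ?enum_uniq // -cardE.
have /codomP [a ja] : Ordinal jK \in codom rk by apply: inj_card_onto.
exists (val a); first by have := valP a; rewrite mem_enum inE.
by have /(congr1 val) /= := ja.
Qed.

(** At each vertex the darts are paired consecutively in the order, ranks 0 with 1, 2 with 3, and so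
    on; nothing lies between the members of a pair. *)
Lemma noncrossing_exists (P : {set dart}) : (forall v, ~~ odd #|[set d in P | ter d == v]|) ->
  exists pi, pairing ends P pi /\ noncrossing_lt P pi.
Proof.
move=> evenP.
pose nxt j := if odd j then j.-1 else j.+1.
have nxtK j : nxt (nxt j) = j.
  rewrite /nxt; case oj: (odd j) => /=; last by rewrite oj.
  by case: j oj => //= k /negbTE ->.
have nxt_neq j : nxt j != j.
  by rewrite /nxt; case: ifP => o; apply/eqP; case: j o => //=; lia.
have nxt_lt j i : i != j -> i != nxt j -> (j < i)%N = (nxt j < i)%N.
  by move=> /eqP i1 /eqP; rewrite /nxt; case: ifP; case: j i1 => [|j] i1 //= _ /eqP i2; lia.
pose pi d := odflt d [pick a | [&& a \in P, ter a == ter d & vertex_rank P a == nxt (vertex_rank P d)]].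
have piP d : d \in P -> [/\ pi d \in P, ter (pi d) = ter d & vertex_rank P (pi d) = nxt (vertex_rank P d)].
  move=> dP; rewrite /pi; case: pickP => [a /and3P [? /eqP ? /eqP ?] //|no].
  have [|a /andP [aP av] ra] := @vertex_rank_surj P d (nxt (vertex_rank P d)) dP.
    have lt1 : (vertex_rank P d < #|[set x in P | ter x == ter d]|)%N.
      apply: proper_card; apply/properP; split.
        by apply/subsetP => x; rewrite !inE => /and3P [-> ->].
      by exists d; rewrite !inE ?dP ?eqxx ?ltxx.
    have := evenP (ter d); rewrite /nxt; case: ifP => o; first by move=> _; lia.
    move: lt1; rewrite leq_eqVlt => /orP [/eqP <-|//]; by rewrite /= o.
  by have := no a; rewrite aP av ra eqxx.
have pairP : pairing ends P pi.
  move=> d dP; have [pP pv pr] := piP d dP; have [ppP ppv ppr] := piP _ pP; split=> //.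
    by move=> e; have := nxt_neq (vertex_rank P d); rewrite -pr e eqxx.
  by apply: (vertex_rank_inj ppP dP); rewrite ?ppv // ppr pr nxtK.
exists pi; split=> // a b aP bP ab ba bpa.
have [pP pv pr] := piP a aP; have [qP qv qr] := piP b bP.
have [_ _ _ piK] := pairP _ aP; have [_ _ _ piK'] := pairP _ bP.
have cons x : x \in P -> ter a = ter x -> x != a -> x != pi a -> between a (pi a) x = false.
  move=> xP ax xa xpa; rewrite /between !(@vertex_rank_lt P) ?pv // pr.
  rewrite -nxt_lt ?eqxx // -?pr; apply/eqP => e.
    by case/eqP: xa; apply: (vertex_rank_inj xP aP).
  by case/eqP: xpa; apply: (vertex_rank_inj xP pP); rewrite ?pv.
rewrite !cons // ?qv //.
- by apply: contraNneq bpa => <-; rewrite piK'.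
- by apply: contraNneq ba => /(congr1 pi); rewrite piK piK' => ->.
Qed.
End Pairings.

Section Rank.
Variables (T : finType) (m : nat) (r : rel T).
Hypotheses (rxx : irreflexive r) (r_trans : transitive r)
  (r_total : forall x y, x != y -> r x y || r y x) (cardT : #|T| = m).

Lemma rank_of_lt z : (#|[set x | r x z]| < m)%N.
Proof.
rewrite -cardT -cardsT; apply: proper_card; apply/properP; split; first exact/subsetT.
by exists z; rewrite !inE ?rxx.
Qed.
Definition rank_of z : 'I_m := Ordinal (rank_of_lt z).

Lemma rank_ofE x y : (rank_of x < rank_of y)%N = r x y.
Proof.
have mono a b : r a b -> (rank_of a < rank_of b)%N.
  move=> ab; apply: proper_card; apply/properP; split.
    by apply/subsetP => z; rewrite !inE => /r_trans; apply.
  by exists a; rewrite !inE ?ab ?rxx.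
have [->|ne] := eqVneq x y; first by rewrite rxx ltnn.
apply/idP/idP => [lt_xy|]; last exact: mono.
case/orP: (r_total ne) => // /mono; by rewrite ltnNge ltnW.
Qed.

Lemma rank_of_inj : injective rank_of.
Proof.
move=> x y e; apply/eqP; apply: contraT => /r_total.
by rewrite -!rank_ofE e ltnn.
Qed.
End Rank.

Lemma prod_offdiag (R : comPzRingType) m (F : 'I_m -> 'I_m -> R) :
  \prod_k \prod_l F k l = \prod_k F k k *
    \prod_(k : 'I_m) \prod_(l : 'I_m | (k < l)%N) (F k l * F l k).
Proof.
have -> : \prod_(k : 'I_m) \prod_(l : 'I_m | (k < l)%N) (F k l * F l k) =
  \prod_(k : 'I_m) (\prod_(l : 'I_m | (k < l)%N) F k l * \prod_(l : 'I_m | (l < k)%N) F k l).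
  under eq_bigr do rewrite big_split /=.
  rewrite !big_split /=; congr (_ * _).
  rewrite (exchange_big_dep predT) //=.
rewrite -big_split /=; apply: eq_bigr => k _.
rewrite (bigD1 k) //= (bigID (fun l : 'I_m => (k < l)%N)) /=; congr (_ * (_ * _)).
  by apply: eq_bigl => l; case: (ltngtP k l) => [lt_kl||/val_inj->]; rewrite ?andbF ?eqxx // -val_eqE /= gtn_eqF.
apply: eq_bigl => l; case: (ltngtP k l) => [||/val_inj->]; rewrite ?andbF ?eqxx // => lt_lk.
by rewrite -val_eqE /= ltn_eqF.
Qed.

(** * Numbering of the darts and of the marked points *)

Section Slots.
Variables (E : finType) (n : nat).
Local Notation dart := (E * bool)%type.
Local Notation T := (dart + 'I_(n.*2))%type.
Local Notation m := #|{: E + 'I_n}|.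

(** The two darts of an edge, or two consecutive marked points, occupy one block. A matching that
    pairs the darts of each edge is then aligned with the blocks. *)
Definition slot (i : 'I_(m.*2)) : T :=
  match enum_val (half_ord i) with
  | inl f => inl (f, ~~ odd i)
  | inr j => inr (dbl_ord (j, odd i))
  end.

Definition slot_inv (z : T) : 'I_(m.*2) :=
  match z with
  | inl d => dbl_ord (enum_rank (inl d.1 : E + 'I_n), ~~ d.2)
  | inr x => dbl_ord (enum_rank (inr (half_ord x) : E + 'I_n), odd x)
  end.

Lemma slotK : cancel slot slot_inv.
Proof.
move=> i; rewrite /slot; case e: (enum_val (half_ord i)) => [f|j] /=.
  by rewrite negbK -e enum_valK half_ordK.
by rewrite half_dbl odd_dbl -e enum_valK half_ordK.
Qed.

Lemma slot_invK : cancel slot_inv slot.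
Proof.
case=> [[f b]|x]; rewrite /slot /= half_dbl odd_dbl enum_rankK ?negbK //=.
by rewrite half_ordK.
Qed.

Lemma slot_bij : bijective slot.
Proof. exact: Bijective slotK slot_invK. Qed.

Lemma slot_ev k : slot (ev_ord k) =
  match enum_val k with inl f => inl (f, true) | inr j => inr (ev_ord j) end.
Proof. by rewrite /slot half_ev /= odd_double. Qed.
Lemma slot_od k : slot (od_ord k) =
  match enum_val k with inl f => inl (f, false) | inr j => inr (od_ord j) end.
Proof. by rewrite /slot half_od /= odd_double. Qed.
End Slots.

(** * Matchings attached to configurations *)

Section Matching.
Variables (C : numClosedFieldType) (V E : finType) (ends : E -> V * V) (n : nat).
Local Notation dart := (E * bool)%type.
Local Notation org := (org ends).
Local Notation ter := (ter ends).
Local Notation bs := (bsign C).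
Hypothesis org_neq_ter : forall d : dart, org d != ter d.
Variable lt : rel dart.
Hypothesis ltxx : irreflexive lt.
Hypothesis lt_trans : transitive lt.
Hypothesis lt_total : forall d d', d != d' -> lt d d' || lt d' d.
Hypothesis lt_org : forall d d' w, org d = org d' -> org w != org d -> lt d w = lt d' w.
Variable sg : dart -> C.
Hypothesis sg_sqr : forall d, sg d * sg d = 1.

Local Notation T := (dart + 'I_(n.*2))%type.
Local Notation PF := (PF (@slot E n)).
Let revI := inv_inj (@dart_revK E).

(** The Kac-Ward entries without the weights, in the gauge [sg]: nonzero between opposite darts and
    between distinct darts with a common origin. *)
Definition dart_form (d d' : dart) : C :=
  if (d' == rev d) || ((org d == org d') && (d != d'))
  then sg d * sg d' * bs (lt d d') else 0.

Lemma bs_neq0 b : bs b != 0.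
Proof. by case: b; rewrite /bsign ?oppr_eq0 oner_eq0. Qed.
Lemma sg_neq0 d : sg d != 0.
Proof. by apply: contraTneq (oner_neq0 C) => e; rewrite -(sg_sqr d) e mul0r negbK. Qed.

Lemma dart_form_antisym : antisym dart_form.
Proof.
move=> d d'; rewrite /dart_form [org d' == _]eq_sym [d' == d]eq_sym.
have -> : (d == rev d') = (d' == rev d) by rewrite (involutive_eq_sym (@dart_revK E)).
case: ifP => [c|]; last by rewrite oppr0.
have dd' : d != d'.
  case/orP: c => [/eqP ->|/andP [_ //]]; by rewrite eq_sym rev_neq.
rewrite (lt_neg ltxx lt_trans lt_total dd') [sg d' * _]mulrC.
by case: (lt _ _); rewrite /bsign /= ?mulr1 ?mulrN1 ?opprK.
Qed.

Lemma dart_form_neq0 d d' : (d' == rev d) || ((org d == org d') && (d != d')) -> dart_form d d' != 0.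
Proof. by rewrite /dart_form => ->; rewrite !mulf_neq0 ?sg_neq0 ?bs_neq0. Qed.

Section State.
Variables (P : {set dart}) (pi : dart -> dart) (e : 'I_(n.*2) -> option dart)
  (nu : 'I_(n.*2) -> 'I_(n.*2)) (S : 'I_(n.*2) -> 'I_(n.*2) -> C).

(* The dart [d] stands for the row of the half-edge [rev d], leaving [org d]: it is
   coupled at its vertex if that half-edge is in [P], along its edge otherwise. *)
Definition config_form (z w : T) : C :=
  match z, w with
  | inl d, inl d' => if rev d \in P then
                       (if (rev d' \in P) && (org d == org d') then dart_form d d' else 0)
                     else if rev d' \in P then 0 else if d' == rev d then dart_form d d' else 0
  | inl d, inr x => if rev d \in P then 0 else (e x == Some d)%:R
  | inr x, inl d => if rev d \in P then 0 else - (e x == Some d)%:R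
  | inr x, inr x' => if (e x == None) && (e x' == None) then S x x' else 0
  end.

Definition mate (z : T) : T :=
  match z with
  | inl d => if rev d \in P then inl (rev (pi (rev d)))
             else if [pick x | e x == Some d] is Some x then inr x else inl (rev d)
  | inr x => if e x is Some d then inl d else inr (nu x)
  end.

Definition weight (z w : T) : C :=
  match z, w with
  | inl d, inl d' => dart_form d d'
  | inl _, inr _ => 1
  | inr _, inl _ => -1
  | inr x, inr x' => S x x'
  end.

(* [e x = Some d]: the not yet peeled part of the path from the marked point [x]
   starts with the dart [d]; [e x = None]: that path is exhausted and [x] is matched
   directly to [nu x]. *)
Record state : Prop := State {
  st_pair : pairing ends P pi;
  st_free : forall x d, e x = Some d -> rev d \notin P;
  st_inj : forall x x' d, e x = Some d -> e x' = Some d -> x = x';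
  st_end : forall x d, e x = Some d -> d \notin P -> exists x', e x' = Some (rev d);
  st_full : forall d, d \in P -> rev d \notin P -> exists x, e x = Some d;
  st_nuK : involutive nu;
  st_nu_neq : forall x, nu x != x;
  st_nu_None : forall x, e x = None -> e (nu x) = None }.

Hypothesis st : state.

Lemma pick_marked d x : e x = Some d -> [pick x | e x == Some d] = Some x.
Proof.
move=> ex; case: pickP => [x' /eqP ex'|/(_ x)]; last by rewrite ex eqxx.
by rewrite (st_inj st ex' ex).
Qed.

Lemma mate_cases d : [\/ rev d \in P /\ mate (inl d) = inl (rev (pi (rev d))),
  exists x, [/\ rev d \notin P, e x = Some d & mate (inl d) = inr x] |
  [/\ rev d \notin P, d \notin P, mate (inl d) = inl (rev d) & forall x, e x <> Some d]].
Proof.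
rewrite /=; case: ifP => [|/negbT] rP; first by constructor 1.
case: pickP => [x /eqP ex|no]; first by constructor 2; exists x.
constructor 3; split=> //; last by move=> x ex; have := no x; rewrite ex eqxx.
by apply/negP => /(st_full st)/(_ rP) [x ex]; have := no x; rewrite ex eqxx.
Qed.

Lemma mateK : involutive mate.
Proof.
case=> [d|x].
  case: (mate_cases d) => [[dP ->]|[x [dP ex ->]]|[rP dP -> no]].
  - have [pP _ _ pK] := st_pair st dP.
    by rewrite /= dart_revK pP pK dart_revK.
  - by rewrite /= ex.
  - rewrite /= dart_revK (negbTE dP); case: pickP => [x /eqP ex|//].
    have [x' ex'] := st_end st ex rP; rewrite dart_revK in ex'.
    by case: (no x').
case ex: (e x) => [d|]; rewrite /= ex /=; last first.
  by rewrite (st_nu_None st ex) (st_nuK st).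
by rewrite (negbTE (st_free st ex)) (pick_marked ex).
Qed.

Lemma mate_neq z : mate z != z.
Proof.
case: z => [d|x]; last by rewrite /=; case: (e x) => [d|] //; apply: (st_nu_neq st).
case: (mate_cases d) => [[dP ->]|[x [dP ex ->]]|[rP dP -> no]] //.
  have [_ _ /eqP pn _] := st_pair st dP; apply: contra pn => /eqP [ed].
  by apply/eqP/revI; rewrite ed dart_revK.
by rewrite (inj_eq (@inl_inj _ _)) rev_neq.
Qed.

Hypothesis S_antisym : antisym S.
Hypothesis S_nu : forall x, S x (nu x) != 0.
Hypothesis S0 : forall x x', x' != nu x -> S x x' = 0.

Lemma config_form_antisym : antisym config_form.
Proof.
case=> [d|x] [d'|x'] /=.
- rewrite [org d' == _]eq_sym -(involutive_eq_sym (@dart_revK E)).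
  case: (rev d \in P); case: (rev d' \in P); rewrite /= ?oppr0 //; case: ifP; rewrite ?oppr0 //.
    by rewrite dart_form_antisym.
  by rewrite dart_form_antisym.
- by case: ifP; rewrite ?oppr0.
- by case: ifP; rewrite ?oppr0 ?opprK.
- by rewrite andbC; case: ifP; rewrite ?oppr0.
Qed.

Lemma weight_antisym : antisym weight.
Proof. by case=> [d|x] [d'|x'] /=; rewrite ?opprK // dart_form_antisym. Qed.

Lemma dart_form_vertex a x : a \in P -> x \in P -> ter a = ter x -> x != a ->
  dart_form (rev a) (rev x) = sg (rev a) * sg (rev x) * bs (lt (rev a) (rev x)).
Proof. by move=> aP xP ax xa; rewrite /dart_form !org_rev ax eqxx [rev a == rev x](inj_eq revI) [a == x]eq_sym xa orbT. Qed.

(** Decoupling needs, in each nonempty set closed under [mate], one row that can be cleared. A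
    marked point and an edge-coupled dart see only their mate in the set; for vertex-coupled darts
    an innermost pair is used. *)
Lemma PF_config_mono : noncrossing_lt ends lt P pi -> PF config_form = PF (mono mate weight).
Proof.
move=> nc; rewrite (@PF_decouple _ _ _ _ (slot_bij E n) config_form mate).
- apply: eq_PF => z w; rewrite /mono; case: eqP => // ->; case: z => [d|x].
    case: (mate_cases d) => [[dP ->]|[x [dP ex ->]]|[rP dP -> no]].
    + have [pP pv _ _] := st_pair st dP.
      by rewrite /= dP dart_revK pP org_rev pv -[in ter _]/(rev d) ter_rev eqxx.
    + by rewrite /= (negbTE dP) ex eqxx.
    + by rewrite /= (negbTE rP) dart_revK (negbTE dP) eqxx.
  rewrite /=; case ex: (e x) => [d|] /=.
    by rewrite ?ex eqxx (negbTE (st_free st ex)).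
  by rewrite ?ex (st_nu_None st ex).
- exact: config_form_antisym.
- exact: mateK.
- exact: mate_neq.
move=> I /set0Pn [z0 z0I] mI.
have [/existsP [x xI]|/existsPn noX] := boolP [exists x, inr x \in I].
  exists (inr x), 0; split=> //.
    rewrite /=; case ex: (e x) => [d|].
      by rewrite ?ex eqxx (negbTE (st_free st ex)) oppr_eq0 oner_eq0.
    by rewrite ?ex (st_nu_None st ex) /=.
  move=> w wI _; rewrite mul0r /=; case ex: (e x) => [d|]; case: w wI => [d'|x'] wI /= wm.
  - case: ifP => // _; case: eqP => [[e']|]; last by rewrite oppr0.
    by rewrite e' eqxx in wm.
  - by [].
  - by case: ifP; rewrite ?oppr0.
  - by case: ifP => // _; apply: S0.
have [/existsP [d0 /andP [d0I d0P]]|/existsPn noP] :=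
    boolP [exists d, (inl d \in I) && (rev d \in P)].
  pose J := [set a in P | inl (rev a) \in I].
  have JP : J \subset P by apply/subsetP => a; rewrite inE => /andP [].
  have [|d|a aJ amin] := innermost_pair ltxx lt_trans lt_total (st_pair st) nc JP.
  + by apply/set0Pn; exists (rev d0); rewrite inE d0P dart_revK.
  + rewrite !inE => /andP [dP dI]; have [pP _ _ _] := st_pair st dP.
    by have := mI _ dI; rewrite /= dart_revK dP pP.
  have [aP aI] : a \in P /\ inl (rev a) \in I by move: aJ; rewrite inE => /andP.
  have [pP pv /eqP pn pK] := st_pair st aP.
  (* Nothing in [I] separates the two darts at their vertex, so their rows agree up to the gauge
     signs, whose product is [lam]. *)
  exists (inl (rev a)), (sg (rev a) * sg (rev (pi a))).
  have maE : mate (inl (rev a)) = inl (rev (pi a)) by rewrite /= dart_revK aP.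
  split=> //.
    rewrite maE /= !dart_revK aP pP !org_rev pv eqxx /= dart_form_neq0 //.
    by rewrite !org_rev pv eqxx [rev a == _](inj_eq revI) [a == _]eq_sym pn orbT.
  move=> [d'|x'] wI; last by have := noX x'; rewrite wI.
  rewrite maE !(inj_eq (@inl_inj _ _)) => wa wpa; rewrite /= !dart_revK aP pP /= !org_rev pv.
  have [rP|] := boolP (rev d' \in P); last by rewrite mulr0.
  case: eqP => [av|]; last by rewrite mulr0.
  have tx : ter (rev d') = ter a by rewrite ter_rev.
  have nx : rev d' != a by apply: contra wa => /eqP <-; rewrite dart_revK.
  have npx : rev d' != pi a by apply: contra wpa => /eqP <-; rewrite dart_revK.
  have := dart_form_vertex aP rP (esym tx) nx; have := dart_form_vertex pP rP (etrans pv (esym tx)) npx.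
  rewrite !dart_revK => -> ->; have := amin (rev d'); rewrite !dart_revK => -> //.
    set b := bs _; set q := sg (rev (pi a)). rewrite /=.
    transitivity (sg (rev a) * (q * q) * (sg d' * b)); last by ring.
    by rewrite sg_sqr; ring.
  by rewrite inE rP dart_revK.
case: z0 z0I => [d|x] zI; last by have := noX x; rewrite zI.
have zmI := mI _ zI; have := noP d; rewrite zI /= => rP.
case: (mate_cases d) => [[dP _]|[x [dP ex mE]]|[_ dP mE no]].
- by rewrite dP in rP.
- by rewrite mE (negbTE (noX x)) in zmI.
rewrite mE in zmI.
exists (inl d), 0; split=> //.
  by rewrite mE /= (negbTE rP) dart_revK (negbTE dP) eqxx dart_form_neq0 // eqxx.
move=> [d'|x'] wI; last by have := noX x'; rewrite wI.
rewrite mE mul0r !(inj_eq (@inl_inj _ _)) /= (negbTE rP) => _ /negbTE ->.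
by case: ifP.
Qed.
End State.

Lemma mono_row (mu : T -> T) (W : T -> T -> C) z b v :
  mu z = b -> W z b = v -> forall w, mono mu W z w = if w == b then v else 0.
Proof. by move=> mz <- w; rewrite /mono mz; case: eqP => // ->. Qed.

Definition set_end (e : 'I_(n.*2) -> option dart) x v : 'I_(n.*2) -> option dart :=
  fun x' => if x' == x then v else e x'.

Lemma set_endE e x v : set_end e x v x = v. Proof. by rewrite /set_end eqxx. Qed.
Lemma set_end_neq e x v x' : x' != x -> set_end e x v x' = e x'.
Proof. by rewrite /set_end => /negbTE ->. Qed.

(** * Peeling and closing the paths *)

Section Moves.
Variables (pi : dart -> dart) (nu : 'I_(n.*2) -> 'I_(n.*2)) (S : 'I_(n.*2) -> 'I_(n.*2) -> C).
Hypothesis S_antisym : antisym S.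

Section Peel.
Variables (P : {set dart}) (e : 'I_(n.*2) -> option dart) (x0 : 'I_(n.*2)) (c0 : dart).
Hypotheses (st : state P pi e nu) (ex0 : e x0 = Some c0) (c0P : c0 \in P).
Let c1 := rev (pi c0).
Let P' := P :\ c0 :\ pi c0.
Let e' := set_end e x0 (Some c1).

Lemma in_peel d : (d \in P') = [&& d != pi c0, d != c0 & d \in P].
Proof. by rewrite !inE. Qed.

Lemma peel_facts : [/\ pi c0 \in P, ter (pi c0) = ter c0, pi c0 != c0, pi (pi c0) = c0 & rev c0 \notin P].
Proof.
have [pP pv /eqP pn pK] := st_pair st c0P; split=> //; exact: (st_free st ex0).
Qed.

Lemma peel_end_neq : c1 != c0 /\ c1 != rev c0.
Proof.
have [pP pv pn pK rP] := peel_facts; split.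
  by apply: contraNneq rP => <-; rewrite dart_revK.
by rewrite (inj_eq revI).
Qed.

Lemma peel_state : state P' pi e' nu.
Proof.
have [pP pv pn pK rP] := peel_facts; have [c1n c1r] := peel_end_neq.
have e'P x d : e' x = Some d -> x = x0 /\ d = c1 \/ x != x0 /\ e x = Some d.
  by rewrite /e' /set_end; case: (eqVneq x x0) => [-> [<-]|]; [left | right].
split.
- move=> d; rewrite !in_peel => /and3P [d1 d2 dP].
  have [qP qv qn qK] := st_pair st dP; split=> //; apply/and3P; split=> //.
    by apply: contra d2 => /eqP/(congr1 pi); rewrite qK pK => ->.
  by apply: contra d1 => /eqP <-; rewrite qK.
- move=> x d /e'P [[_ ->]|[_ ex]]; rewrite in_peel; first by rewrite dart_revK eqxx.
  by rewrite (negbTE (st_free st ex)) !andbF.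
- have key x d : e x = Some d -> d = c1 -> False.
    by move=> ex dc; have := st_free st ex; rewrite dc dart_revK pP.
  move=> x x' d /e'P [[-> dc]|[xn ex]] /e'P [[-> dc']|[xn' ex']] //.
  + by case: (key _ _ ex' dc).
  + by case: (key _ _ ex dc').
  + exact: (st_inj st ex ex').
- move=> x d /e'P [[_ ->]|[xn ex]]; rewrite in_peel.
    rewrite c1n /= negb_and negbK => /orP [/eqP c1p|c1P].
      by have := rev_neq (pi c0); rewrite -/c1 c1p eqxx.
    have [x' ex'] := st_full st pP c1P; exists x'.
    rewrite /e' set_end_neq ?ex' ?dart_revK //; apply: contraNneq pn => ee.
    by move: ex'; rewrite ee ex0 => -[<-].
  case/nandP => [/negPn/eqP dp|/nandP [/negPn/eqP dc|dP]].
  + by exists x0; rewrite /e' set_endE dp.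
  + by rewrite dc in ex; rewrite (st_inj st ex ex0) eqxx in xn.
  + have [x' ex'] := st_end st ex dP; exists x'.
    rewrite /e' set_end_neq //; apply: contraTneq c0P => ee.
    by have := st_free st ex; move: ex'; rewrite ee ex0 => -[->].
- move=> d; rewrite !in_peel => /and3P [d1 d2 dP].
  case/nandP => [/negPn/eqP rd|/nandP [/negPn/eqP rd|rdP]].
  + by exists x0; rewrite /e' set_endE /c1 -rd dart_revK.
  + by move: rP; rewrite -rd dart_revK dP.
  + have [x ex] := st_full st dP rdP; exists x; rewrite /e' set_end_neq //.
    by apply: contraNneq d2 => ee; move: ex; rewrite ee ex0 => -[->].
- exact: (st_nuK st).
- exact: (st_nu_neq st).
- move=> x; rewrite /e' {1}/set_end; case: eqVneq => // xn ex.
  have en := st_nu_None st ex; rewrite set_end_neq //.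
  by apply: contraTneq (erefl true) => ee; move: en; rewrite ee ex0.
Qed.

(** The matching pairs [x0] with [c0], and [rev c0] with [c1] at a vertex. Exchanging gives [x0]
    with [c1], and [c0] with [rev c0] along their edge: the path now starts one dart later. *)
Lemma PF_peel : PF (mono (mate P pi e nu) (weight S)) =
  dart_form (rev c0) c1 / dart_form c0 (rev c0) * PF (mono (mate P' pi e' nu) (weight S)).
Proof.
have [pP pv pn pK rP] := peel_facts; have [c1n c1r] := peel_end_neq.
have st' := peel_state.
have muK := mateK st; have muK' := mateK st'.
have m1 : mate P pi e nu (inr x0) = inl c0 by rewrite /= ex0.
have m2 : mate P pi e nu (inl (rev c0)) = inl c1 by rewrite /= dart_revK c0P.
have m1' : mate P' pi e' nu (inr x0) = inl c1 by rewrite /= /e' set_endE.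
have m2' : mate P' pi e' nu (inl c0) = inl (rev c0).
  rewrite /= in_peel (negbTE rP) !andbF; case: pickP => // x /eqP.
  rewrite /e' /set_end; case: eqVneq => [_ [ee]|xn ex]; first by rewrite ee eqxx in c1n.
  by rewrite (st_inj st ex ex0) eqxx in xn.
have u0 : dart_form c0 (rev c0) != 0 by rewrite dart_form_neq0 // eqxx.
rewrite (@PF_exchange _ _ _ _ (slot_bij E n) _ (mono (mate P' pi e' nu) (weight S))
  (inr x0) (inl c0) (inl (rev c0)) (inl c1) (-1) (dart_form (rev c0) c1) (-1) (dart_form c0 (rev c0))).
- by rewrite -mulf_div divff ?mul1r // oppr_eq0 oner_eq0.
- rewrite /= !inE /= !(inj_eq (@inl_inj _ _)) negb_or andbT.
  by rewrite [c0 == rev c0]eq_sym rev_neq [c0 == c1]eq_sym c1n [rev c0 == c1]eq_sym c1r.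
- exact: (mono_antisym muK (weight_antisym S_antisym)).
- exact: (mono_antisym muK' (weight_antisym S_antisym)).
- by rewrite oppr_eq0 oner_eq0.
- exact: u0.
- exact: mono_row.
- by apply: mono_row; [rewrite -m1 muK | rewrite /= opprK].
- exact: mono_row.
- by apply: mono_row; [rewrite -m2 muK | rewrite /= dart_form_antisym].
- exact: mono_row.
- by apply: mono_row; [rewrite -m1' muK' | rewrite /= opprK].
- exact: mono_row.
- by apply: mono_row; [rewrite -m2' muK' | rewrite /= dart_form_antisym].
move=> z w zn wn; rewrite /mono; congr (if w == _ then _ else _).
case: z zn => [d|x]; rewrite !inE /= ?(inj_eq (@inl_inj _ _)).
  rewrite !negb_or => /and3P [dc0 drc0 dc1].
  have -> : (rev d \in P') = (rev d \in P).
    rewrite in_peel [rev d == c0]eq_sym -(involutive_eq_sym (@dart_revK E)) drc0.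
    have -> // : rev d != pi c0.
    by apply: contra dc1 => /eqP ee; rewrite /c1 -ee dart_revK.
  case: ifP => // _; rewrite (@eq_pick _ _ (fun x => e' x == Some d)) // => x.
  rewrite /e' /set_end; case: (eqVneq x x0) => [->|//].
  rewrite ex0; apply/eqP/eqP => -[ee]; first by rewrite ee eqxx in dc0.
  by rewrite ee eqxx in dc1.
rewrite (inj_eq (@inr_inj _ _)) !orbF => xn.
by rewrite /e' set_end_neq.
Qed.
End Peel.

Section Close.
Variables (P : {set dart}) (e : 'I_(n.*2) -> option dart) (x0 : 'I_(n.*2)) (ea : dart).
Hypotheses (st : state P pi e nu) (ex0 : e x0 = Some ea) (ex1 : e (nu x0) = Some (rev ea)).
Hypothesis S1 : S x0 (nu x0) = 1.
Let e' := set_end (set_end e x0 None) (nu x0) None.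

Lemma close_endP x d : (e' x = Some d) <-> [/\ x != x0, x != nu x0 & e x = Some d].
Proof.
rewrite /e' /set_end; case: (eqVneq x (nu x0)) => [_|]; first by split=> // [[]].
by case: (eqVneq x x0) => [_|] //; split=> // [[]].
Qed.

Lemma close_state : state P pi e' nu.
Proof.
have eaP : ea \notin P by have := st_free st ex1; rewrite dart_revK.
have reaP := st_free st ex0.
split.
- exact: (st_pair st).
- by move=> x d /close_endP [_ _ /(st_free st)].
- by move=> x x' d /close_endP [_ _ ex] /close_endP [_ _ ex']; apply: (st_inj st ex ex').
- move=> x d /close_endP [n0 n1 ex] dP; have [x' ex'] := st_end st ex dP.
  exists x'; apply/close_endP; split=> //.
    apply: contra_neq n1 => ee; move: ex'; rewrite ee ex0 => -[dE].
    by apply: (st_inj st ex); rewrite ex1 dE dart_revK.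
  apply: contra_neq n0 => ee; apply: (st_inj st ex); rewrite ex0; congr Some.
  by apply: revI; apply: Some_inj; rewrite -ex1 -ee.
- move=> d dP rdP; have [x ex] := st_full st dP rdP; exists x; apply/close_endP; split=> //.
    by apply: contraTneq dP => ee; move: ex; rewrite ee ex0 => -[<-].
  by apply: contraTneq dP => ee; move: ex; rewrite ee ex1 => -[<-].
- exact: (st_nuK st).
- exact: (st_nu_neq st).
move=> x; rewrite /e' /set_end; case: (eqVneq x (nu x0)) => [-> _|xn].
  by rewrite (st_nuK st) eqxx if_same.
case: (eqVneq x x0) => [-> _|xn']; first by rewrite eqxx.
by move=> /(st_nu_None st) ->; rewrite !if_same.
Qed.

(** Both ends have reached the same edge from opposite sides. The exchange matches the two marked
    points with each other and returns [ea] and [rev ea] to their edge. *)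
Lemma PF_close : PF (mono (mate P pi e nu) (weight S)) =
  - (dart_form ea (rev ea))^-1 * PF (mono (mate P pi e' nu) (weight S)).
Proof.
have eaP : ea \notin P by have := st_free st ex1; rewrite dart_revK.
have reaP := st_free st ex0; have st' := close_state.
have muK := mateK st; have muK' := mateK st'.
have m1 : mate P pi e nu (inr x0) = inl ea by rewrite /= ex0.
have m2 : mate P pi e nu (inr (nu x0)) = inl (rev ea) by rewrite /= ex1.
have m1' : mate P pi e' nu (inr x0) = inr (nu x0) by rewrite /= /e' /set_end eqxx if_same.
have m2' : mate P pi e' nu (inl ea) = inl (rev ea).
  rewrite /= (negbTE reaP); case: pickP => // x /eqP /close_endP [n0 _ ex].
  by rewrite (st_inj st ex ex0) eqxx in n0.
have u0 : dart_form ea (rev ea) != 0 by rewrite dart_form_neq0 // eqxx.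
rewrite (@PF_exchange _ _ _ _ (slot_bij E n) _ (mono (mate P pi e' nu) (weight S))
  (inr x0) (inl ea) (inl (rev ea)) (inr (nu x0)) (-1) 1 1 (dart_form ea (rev ea))).
- by rewrite mulr1 mul1r mulN1r.
- rewrite /= !inE /= (inj_eq (@inl_inj _ _)) (inj_eq (@inr_inj _ _)).
  by rewrite [x0 == _]eq_sym (st_nu_neq st) orbF [ea == _]eq_sym rev_neq.
- exact: (mono_antisym muK (weight_antisym S_antisym)).
- exact: (mono_antisym muK' (weight_antisym S_antisym)).
- exact: oner_neq0.
- exact: u0.
- exact: mono_row.
- by apply: mono_row; [rewrite -m1 muK | rewrite /= opprK].
- by apply: mono_row => //; rewrite -m2 muK.
- exact: mono_row.
- exact: mono_row.
- by apply: mono_row; [rewrite -m1' muK' | rewrite /= S_antisym S1].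
- exact: mono_row.
- by apply: mono_row; [rewrite -m2' muK' | rewrite /= dart_form_antisym].
move=> z w zn wn; rewrite /mono; congr (if w == _ then _ else _).
case: z zn => [d|x]; rewrite !inE /= ?(inj_eq (@inl_inj _ _)) ?(inj_eq (@inr_inj _ _)).
  rewrite orbF !negb_or => /andP [dea drea].
  case: ifP => // _; rewrite (@eq_pick _ _ (fun x => e' x == Some d)) // => x.
  apply/eqP/eqP => [ex|/close_endP [] //]; apply/close_endP; split=> //.
    by apply: contraNneq dea => ee; move: ex; rewrite ee ex0 => -[->].
  by apply: contraNneq drea => ee; move: ex; rewrite ee ex1 => -[->].
by rewrite negb_or /e' => /andP [x1 x2]; rewrite !set_end_neq.
Qed.
End Close.
End Moves.

Definition flip_ord (i : 'I_(n.*2)) := dbl_ord (half_ord i, ~~ odd i).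

Lemma flip_ordK : involutive flip_ord.
Proof. by move=> i; rewrite /flip_ord half_dbl odd_dbl negbK; apply: half_ordK. Qed.
Lemma flip_ord_neq i : flip_ord i != i.
Proof.
apply/eqP => fi; have := odd_dbl (half_ord i, ~~ odd i).
by rewrite -/(flip_ord i) fi /=; case: (odd i).
Qed.
Lemma flip_ev (k : 'I_n) : flip_ord (ev_ord k) = od_ord k.
Proof. by rewrite /flip_ord half_ev /= odd_double. Qed.
Lemma flip_od (k : 'I_n) : flip_ord (od_ord k) = ev_ord k.
Proof. by rewrite -flip_ev flip_ordK. Qed.

Lemma std_form_antisym : antisym (@std_form C n).
Proof.
move=> i j; rewrite /std_form eq_sym; case: eqP; rewrite ?oppr0 // => _.
by case: ltngtP; rewrite ?opprK ?oppr0.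
Qed.
Lemma std_form_ev_od (k : 'I_n) : std_form C (ev_ord k) (od_ord k) = 1 :> C.
Proof. by rewrite /std_form half_ev half_od eqxx /= ltnSn. Qed.
Lemma std_form_flip i : std_form C i (flip_ord i) != 0.
Proof.
case: (ev_odP i) => [[k ->]|[k ->]].
  by rewrite flip_ev std_form_ev_od oner_neq0.
by rewrite flip_od std_form_antisym std_form_ev_od oppr_eq0 oner_neq0.
Qed.
Lemma std_form0 i j : j != flip_ord i -> std_form C i j = 0.
Proof.
move=> /eqP jf; rewrite /std_form; case: eqP => // hij; case: (ltngtP i j) => // lt_ij.
all: case: jf; apply: half_odd_inj; rewrite /flip_ord ?half_dbl ?odd_dbl //=.
all: case: (eqVneq (odd i) (odd j)) => [o|]; last by case: (odd i); case: (odd j).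
all: by move: lt_ij; rewrite (half_odd_inj hij o) ltnn.
Qed.

Section Paths.
Variables (pi : dart -> dart) (s : 'S_(n.*2)).
Let nu x := s (flip_ord ((s^-1)%g x)).
Let S x x' : C := std_form C ((s^-1)%g x) ((s^-1)%g x').

Lemma perm_nuK : involutive nu.
Proof. by move=> x; rewrite /nu permK flip_ordK permKV. Qed.
Lemma perm_nu_neq x : nu x != x.
Proof.
apply/eqP => /(congr1 (s^-1)%g); rewrite /nu permK.
by move/eqP; rewrite (negbTE (flip_ord_neq _)).
Qed.
Lemma perm_nu_ev (k : 'I_n) : nu (s (ev_ord k)) = s (od_ord k).
Proof. by rewrite /nu permK flip_ev. Qed.
Lemma perm_nu_od (k : 'I_n) : nu (s (od_ord k)) = s (ev_ord k).
Proof. by rewrite -perm_nu_ev perm_nuK. Qed.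
Lemma perm_std_antisym : antisym S.
Proof. by move=> x x'; apply: std_form_antisym. Qed.

Definition is_end (e : 'I_(n.*2) -> option dart) d := [exists x, e x == Some d].

Lemma is_endP e d : reflect (exists x, e x = Some d) (is_end e d).
Proof. by apply: (iffP existsP) => -[x ex]; exists x; apply/eqP. Qed.

(** The predicate [walk] with the marks as a parameter: during peeling the marked darts are the
    current ends of the paths. *)
Definition walk_for (M : pred dart) (P : {set dart}) (c : seq dart) (ea eb : dart) : Prop :=
  [/\ (2 <= size c)%N, nth ea c 0 = ea, last ea c = rev eb,
      forall i, (i.+1 < size c)%N ->
        nth ea c i \in P /\ nth ea c i.+1 = rev (pi (nth ea c i))
    & forall i, (0 < i)%N -> (i.+1 < size c)%N ->
        ~~ M (nth ea c i) /\ ~~ M (rev (nth ea c i))].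

Section Avoid.
Variables (P : {set dart}) (e : 'I_(n.*2) -> option dart) (x0 : 'I_(n.*2)) (c0 : dart).
Hypotheses (st : state P pi e nu) (ex0 : e x0 = Some c0) (c0P : c0 \in P).
Variables (c : seq dart) (xa xb : 'I_(n.*2)) (ea eb : dart).
Hypotheses (exa : e xa = Some ea) (exb : e xb = Some eb) (xb0 : xb != x0).
Hypothesis wk : walk_for (is_end e) P c ea eb.

(** The dart [c0] is marked, so it is not interior to a walk. After [pi c0] a walk continues with
    [rev c0], which must then be its last dart; so the walk would end at [x0]. *)
Lemma walk_avoids i : (i.+1 < size c)%N -> (i = 0%N -> xa != x0) ->
  nth ea c i != c0 /\ nth ea c i != pi c0.
Proof.
have [_ w0 wl ws wi] := wk; have [_ _ _ pK] := st_pair st c0P.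
have mc0 : is_end e c0 by apply/is_endP; exists x0.
move=> ic ix; split.
  case: i ic ix => [|i] ic ix.
    by rewrite w0; apply: contraNneq (ix erefl) => ee; rewrite (st_inj st exa (etrans ex0 (congr1 _ (esym ee)))).
  by apply: contraTneq mc0 => <-; case: (wi i.+1 isT ic).
apply/eqP => ci; have [_] := ws i ic; rewrite ci pK => ci1.
have [lt2|ge2] := ltnP i.+2 (size c).
  by have [_] := wi i.+1 isT lt2; rewrite ci1 dart_revK mc0.
have : last ea c = nth ea c i.+1.
  by rewrite -nth_last; congr nth; apply/eqP; rewrite -eqSS prednK ?eqn_leq ?ge2 // (leq_trans _ ic).
rewrite wl ci1 => /revI ee.
by have := xb0; rewrite (st_inj st exb (etrans ex0 (congr1 _ (esym ee)))) eqxx.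
Qed.

Lemma walk_unmarked i : (0 < i)%N -> (i.+1 < size c)%N -> (i = 1%N -> xa != x0) ->
  let e' := set_end e x0 (Some (rev (pi c0))) in
  ~~ is_end e' (nth ea c i) /\ ~~ is_end e' (rev (nth ea c i)).
Proof.
have [_ w0 wl ws wi] := wk; have [_ _ _ pK] := st_pair st c0P.
move=> i0 ic ix e'; have [m1 m2] := wi i i0 ic.
have is_endE d : is_end e' d -> is_end e d \/ d = rev (pi c0).
  case/is_endP => x; rewrite /e' /set_end; case: (eqVneq x x0) => [_ [<-]|_ ex]; first by right.
  by left; apply/is_endP; exists x.
split; apply/negP => /is_endE [].
- by rewrite (negbTE m1).
- case: i i0 ic ix {m1 m2} => // i _ ic ix ci; have ic' := ltnW ic.
  have [|n1 _] := walk_avoids ic'; first by move=> i0; apply: ix; rewrite i0.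
  have [iP ci1] := ws i ic'; have [_ _ _ pK'] := st_pair st iP.
  move: ci; rewrite ci1 => /revI /(congr1 pi); rewrite pK pK' => ee.
  by rewrite ee eqxx in n1.
- by rewrite (negbTE m2).
move=> /revI ee; have [|_] := walk_avoids ic; first by move=> ie; rewrite ie in i0.
by rewrite ee eqxx.
Qed.
End Avoid.

Variable fac : seq dart -> dart -> dart -> C.
Hypothesis fac_step : forall c0 c1 r eb, org c1 = ter c0 -> c1 != rev c0 ->
  fac [:: c0, c1 & r] c0 eb =
  dart_form (rev c0) c1 / dart_form c0 (rev c0) * fac (if r is [::] then [::] else c1 :: r) c1 eb.
Hypothesis fac_nil : forall ea, fac [::] ea (rev ea) = - (dart_form ea (rev ea))^-1.

Definition valid_paths (P : {set dart}) e (g : 'I_n -> seq dart) := forall k ea eb,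
  e (s (ev_ord k)) = Some ea -> e (s (od_ord k)) = Some eb ->
  (g k = [::] /\ eb = rev ea) \/ walk_for (is_end e) P (g k) ea eb.

Definition path_weight (e : 'I_(n.*2) -> option dart) (g : 'I_n -> seq dart) k :=
  if e (s (ev_ord k)) is Some ea then
    if e (s (od_ord k)) is Some eb then fac (g k) ea eb else 1 else 1.

(** A single dart is not a walk: when the last vertex of a path has been peeled off, both ends lie
    on one edge and the remainder is the empty path. *)
Lemma peel_valid P e g k ea eb r : state P pi e nu -> valid_paths P e g ->
  e (s (ev_ord k)) = Some ea -> e (s (od_ord k)) = Some eb ->
  walk_for (is_end e) P (g k) ea eb -> g k = [:: ea, rev (pi ea) & r] -> ea \in P ->
  valid_paths (P :\ ea :\ pi ea) (set_end e (s (ev_ord k)) (Some (rev (pi ea))))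
    (fun k' => if k' == k then (if r is [::] then [::] else rev (pi ea) :: r) else g k').
Proof.
move=> st vg eka ekb wk gk eaP k' ea' eb'.
have od_ev l : s (od_ord l) != s (ev_ord k).
  by rewrite (inj_eq perm_inj) eq_sym ev_od_neq.
rewrite [set_end _ _ _ (s (od_ord k'))]set_end_neq // => e1 e2.
case: (eqVneq k' k) e1 e2 => [->|nk] e1 e2.
  move: e1 e2; rewrite set_endE ekb => -[<-] [<-].
  have [w2 w0 wl ws wi] := wk.
  case: r gk => [|c2 r] gk; [left | right].
    by split=> //; move: wl; rewrite gk /= => /(congr1 (@Defs.rev E)); rewrite !dart_revK => ->.
  rewrite gk in wl ws wi; split=> //.
  - move=> i ic; have ic' : (i.+2 < size [:: ea, rev (pi ea), c2 & r])%N by [].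
    have [iP i1] := ws i.+1 ic'.
    have [||n1 n2] := walk_avoids st eka eaP eka ekb (od_ev k) wk (i := i.+1); [by rewrite gk | by [] |].
    rewrite gk in n1 n2.
    rewrite (set_nth_default ea) 1?ltnW // [nth _ _ i.+1](set_nth_default ea) //.
    by rewrite in_setD1 in_setD1 n1 n2.
  - move=> i i0 ic.
    have [|||] := walk_unmarked st eka eaP eka ekb (od_ev k) wk (i := i.+1); [by []|by rewrite gk|by case: i i0 ic|].
    by rewrite gk [nth _ (_ :: _) i](set_nth_default ea) 1?ltnW.
move: e1; rewrite set_end_neq ?(inj_eq perm_inj) ?(inj_eq (@ev_inj _)) // => e1.
have [triv|wk'] := vg k' ea' eb' e1 e2; [by left | right].
have ne : s (ev_ord k') != s (ev_ord k) by rewrite (inj_eq perm_inj) (inj_eq (@ev_inj _)).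
have [w2 w0 wl ws wi] := wk'; split=> //.
- move=> i ic; have [iP i1] := ws i ic.
  have [//|//|n1 n2] := walk_avoids st eka eaP e1 e2 (od_ev k') wk' (i := i).
  by rewrite in_setD1 in_setD1 n1 n2.
- move=> i i0 ic.
  by have [] := walk_unmarked st eka eaP e1 e2 (od_ev k') wk' i0 ic.
Qed.

(** A live path counts for the number of its darts plus one, so that closing an empty path also
    decreases the measure. The recurrence of [fac] supplies exactly the factor of each exchange. *)
Lemma reduce_paths N P e g : state P pi e nu -> valid_paths P e g ->
  (\sum_k (if e (s (ev_ord k)) is Some _ then (size (g k)).+1 else 0) <= N)%N ->
  exists (Q : {set dart}) e0, [/\ Q \subset P, state Q pi e0 nu, forall x, e0 x = None &
    PF (mono (mate P pi e nu) (weight S)) =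
    (\prod_k path_weight e g k) * PF (mono (mate Q pi e0 nu) (weight S))].
Proof.
elim: N P e g => [|N IHN] P e g st vg sumN.
all: have [/forallP allN|/forallPn [k ek]] := boolP [forall k, e (s (ev_ord k)) == None].
1,3: exists P, e; split=> //; last first.
1,3: by rewrite big1 ?mul1r // => k _; rewrite /path_weight (eqP (allN k)).
1,2: move=> x; rewrite -[x](permKV s); case: (ev_odP ((s^-1)%g x)) => [[k ->]|[k ->]].
1,3: exact/eqP.
1,2: by rewrite -perm_nu_ev (st_nu_None st) //; apply/eqP.
  move: sumN; rewrite leqn0 (bigD1 k) //= addn_eq0.
  by case: (e _) ek.
have od_ev l : s (od_ord l) != s (ev_ord k).
  by rewrite (inj_eq perm_inj) eq_sym ev_od_neq.
have ev_ev l : l != k -> s (ev_ord l) != s (ev_ord k).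
  by rewrite (inj_eq perm_inj) (inj_eq (@ev_inj _)).
case eka: (e (s (ev_ord k))) ek => [ea|] // _.
case ekb: (e (s (od_ord k))) => [eb|]; last first.
  by have := st_nu_None st ekb; rewrite perm_nu_od eka.
have [[gk ebE]|wk] := vg k ea eb eka ekb.
  rewrite ebE in ekb; pose x0 := s (ev_ord k).
  have ex1 : e (nu x0) = Some (rev ea) by rewrite perm_nu_ev.
  have S1 : S x0 (nu x0) = 1 by rewrite perm_nu_ev /S !permK std_form_ev_od.
  pose e' := set_end (set_end e x0 None) (nu x0) None.
  have st' : state P pi e' nu := close_state st eka ex1.
  have e'_other l : l != k -> e' (s (ev_ord l)) = e (s (ev_ord l)) /\
      e' (s (od_ord l)) = e (s (od_ord l)).
    move=> lk; rewrite /e' /x0 perm_nu_ev; split; rewrite !set_end_neq ?ev_ev //.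
      by rewrite (inj_eq perm_inj) ev_od_neq.
    by rewrite (inj_eq perm_inj) (inj_eq (@od_inj _)).
  have e'_k : e' (s (ev_ord k)) = None by rewrite /e' /set_end eqxx if_same.
  have [|l eal ebl el1 el2||Q [e0 [QP stQ e0N PFQ]]] := IHN P e' g.
  - exact: st'.
  - have lk : l != k by apply: contraTneq (erefl true) => lk; rewrite lk e'_k in el1.
    have [o1 o2] := e'_other l lk; rewrite o1 in el1; rewrite o2 in el2.
    have [triv|[w2 w0 wl ws wi]] := vg l eal ebl el1 el2; [by left | right].
    split=> // i i0 ic; have [m1 m2] := wi i i0 ic.
    have is_end' d : is_end e' d -> is_end e d.
      by case/is_endP => x /close_endP [_ _ ex]; apply/is_endP; exists x.
    by split; [apply: contra m1 | apply: contra m2]; apply: is_end'.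
  - move: sumN; rewrite (bigD1 k) //= eka gk add1n ltnS; apply: leq_trans.
    rewrite (bigD1 k) //= e'_k add0n; apply: eq_leq; apply: eq_bigr => l lk.
    by case: (e'_other l lk) => ->.
  exists Q, e0; split=> //.
  rewrite (PF_close perm_std_antisym st eka ex1 S1) PFQ mulrA; congr (_ * _).
  rewrite (bigD1 k) //= [in RHS](bigD1 k) //= mulrA; congr (_ * _).
    by rewrite /path_weight e'_k mulr1 eka ekb gk fac_nil.
  by apply: eq_bigr => l lk; rewrite /path_weight; case: (e'_other l lk) => -> ->.
have [w2 w0 wl ws wi] := wk.
have [eaP b1] := ws 0%N w2; rewrite w0 in eaP b1.
have [r gk] : exists r, g k = [:: ea, rev (pi ea) & r].
  by case: (g k) w2 w0 b1 => [|a [|b r]] //= _ -> ->; exists r.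
pose c1 := rev (pi ea); pose e' := set_end e (s (ev_ord k)) (Some c1).
pose g' k' := if k' == k then (if r is [::] then [::] else c1 :: r) else g k'.
have st' := peel_state st eka eaP; have vg' := peel_valid st vg eka ekb wk gk eaP.
have e'_k : e' (s (ev_ord k)) = Some c1 by rewrite /e' set_endE.
have e'_od l : e' (s (od_ord l)) = e (s (od_ord l)) by rewrite /e' set_end_neq.
have e'_other l : l != k -> e' (s (ev_ord l)) = e (s (ev_ord l)).
  by move=> lk; rewrite /e' set_end_neq ?ev_ev.
have [|Q [e0 [QP stQ e0N PFQ]]] := IHN _ e' g' st' vg'.
  rewrite (bigD1 k) //= eka gk in sumN; rewrite (bigD1 k) //= e'_k /g' eqxx.
  have -> : (\sum_(i < n | i != k) (if e' (s (ev_ord i)) is Some _ then (size (g' i)).+1 else 0) =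
     \sum_(i < n | i != k) (if e (s (ev_ord i)) is Some _ then (size (g i)).+1 else 0))%N.
    by apply: eq_bigr => l lk; rewrite e'_other // /g' (negbTE lk).
  by move: sumN; case: (r) => [|c2 r'] /=; rewrite addSn ltnS; apply: leq_trans; rewrite leq_add2r.
exists Q, e0; split=> //.
  apply: subset_trans QP _; apply/subsetP => d; rewrite !in_setD1.
  by case/and3P.
rewrite (PF_peel perm_std_antisym st eka eaP) PFQ mulrA; congr (_ * _).
rewrite (bigD1 k) //= [in RHS](bigD1 k) //= mulrA; congr (_ * _).
  rewrite /path_weight e'_k e'_od eka ekb gk /g' eqxx fac_step //.
    by have [_ pv _ _] := st_pair st eaP; rewrite org_rev.
  by have [_ _ /eqP pn _] := st_pair st eaP; rewrite (inj_eq revI).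
by apply: eq_bigr => l lk; rewrite /path_weight e'_od e'_other // /g' (negbTE lk).
Qed.
End Paths.

(** * Loops and the constant [kappa] *)

Section Sweep.
Variable side : E -> V -> C.
Hypothesis side_sqr : forall f v, side f v * side f v = 1.
Hypothesis side_org : forall f b, side f (org (f, b)) = 1.
Hypothesis cross_side : forall f g, f != g ->
  bs (lt (f, true) (g, true)) * bs (lt (f, true) (g, false)) *
   (bs (lt (f, false) (g, true)) * bs (lt (f, false) (g, false))) =
  side f (ends g).1 * side f (ends g).2 * (side g (ends f).1 * side g (ends f).2).

(* The value of the Pfaffian for the empty configuration, in this gauge. *)
Definition kappa : C := (\prod_d sg d) * \prod_f bs (lt (f, true) (f, false)).

Lemma kappa_neq0 : kappa != 0.
Proof.
by rewrite mulf_neq0 //; apply/prodf_neq0 => ? _; rewrite ?sg_neq0 ?bs_neq0.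
Qed.

Variables (Q : {set dart}) (pi : dart -> dart) (e : 'I_(n.*2) -> option dart).
Hypotheses (st : state Q pi e flip_ord) (eN : forall x, e x = None).
Hypothesis nc : noncrossing_lt ends lt Q pi.
Hypothesis evenQ : forall v, ~~ odd #|[set d in Q | ter d == v]|.

Lemma closed_rev d : (rev d \in Q) = (d \in Q).
Proof.
have cl d' : d' \in Q -> rev d' \in Q.
  move=> dQ; apply: contraT => /(st_full st dQ) [x]; by rewrite eN.
by apply/idP/idP => /cl //; rewrite dart_revK.
Qed.

Definition in_loops (z : T) := if z is inl d then d \in Q else false.
Definition block (z : T) := half_ord (slot_inv z).
Definition block_lt (z w : T) : bool :=
  match z, w with
  | inl d, inl d' => lt d d'
  | inr x, inr x' => (x < x')%N
  | _, _ => false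
  end.
(** A total order adapted to the matching. The loops come first, in dart order, so that noncrossing
    pairs at a vertex decouple; everything else comes block by block, so that matched rows are
    adjacent. *)
Definition slot_lt (z w : T) :=
  if in_loops z then (if in_loops w then block_lt z w else true)
  else if in_loops w then false
  else (block z < block w)%N || (block z == block w) && block_lt z w.

Lemma block_eq z w : block z = block w -> z = w \/
  match z with inl d => w = inl (rev d) | inr x => w = inr (flip_ord x) end.
Proof.
move=> bzw; have [o|o] := eqVneq (odd (slot_inv z)) (odd (slot_inv w)).
  by left; apply: (can_inj (@slot_invK E n)); apply: half_odd_inj.
right; have -> : w = slot (dbl_ord (half_ord (slot_inv z), ~~ odd (slot_inv z))).
  rewrite -/(block z) bzw; have -> : ~~ odd (slot_inv z) = odd (slot_inv w).
    by case: (odd _) (odd _) o => [] [].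
  by rewrite half_ordK slot_invK.
case: z {bzw o} => [d|x] /=; rewrite half_dbl odd_dbl /slot half_dbl odd_dbl enum_rankK //=.
by rewrite negbK.
Qed.

Lemma block_inl d : block (inl d) = enum_rank (inl d.1 : E + 'I_n).
Proof. by rewrite /block half_dbl. Qed.
Lemma block_inr x : block (inr x) = enum_rank (inr (half_ord x) : E + 'I_n).
Proof. by rewrite /block half_dbl. Qed.

Lemma mate_out z : in_loops z = false -> mate Q pi e flip_ord z =
  match z with inl d => inl (rev d) | inr x => inr (flip_ord x) end.
Proof.
case: z => [d|x] /=; last by rewrite eN.
by rewrite closed_rev => ->; case: pickP => // x; rewrite eN.
Qed.

Lemma block_mate z : in_loops z = false -> block (mate Q pi e flip_ord z) = block z.
Proof.
move=> /mate_out ->; case: z => [d|x]; first by rewrite !block_inl.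
by rewrite !block_inr /flip_ord half_dbl.
Qed.

Lemma slot_lt_irr : irreflexive slot_lt.
Proof.
move=> z; rewrite /slot_lt ltnn eqxx /=.
have -> : block_lt z z = false by case: z => [d|x] /=; rewrite ?ltxx ?ltnn.
by case: (in_loops z).
Qed.

Lemma block_lt_trans z1 z2 z3 : block_lt z1 z2 -> block_lt z2 z3 -> block_lt z1 z3.
Proof.
case: z1 z2 z3 => [d1|x1] [d2|x2] [d3|x3] //=; [exact: lt_trans | exact: ltn_trans].
Qed.

Lemma slot_lt_trans : transitive slot_lt.
Proof.
move=> z2 z1 z3; rewrite /slot_lt.
case: (in_loops z1); case: (in_loops z2); case: (in_loops z3) => //.
  exact: block_lt_trans.
case/orP => [l1|/andP [/eqP b1 l1]] /orP [l2|/andP [/eqP b2 l2]].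
- by rewrite (ltn_trans l1 l2).
- by rewrite -b2 l1.
- by rewrite b1 l2.
- by rewrite b1 b2 eqxx (block_lt_trans l1 l2) orbT.
Qed.

Lemma slot_lt_total z w : z != w -> slot_lt z w || slot_lt w z.
Proof.
move=> zw; rewrite /slot_lt.
case lz: (in_loops z); case lw: (in_loops w) => //.
  case: z w lz lw zw => [d|x] [d'|x'] //= _ _ zw; apply: lt_total.
  by apply: contra zw => /eqP ->.
case: (ltngtP (block z) (block w)) => [//|_|/val_inj bE]; first by rewrite orbT.
rewrite bE eqxx /=.
have [ee|] := block_eq bE; first by rewrite ee eqxx in zw.
case: z lz zw bE => [d|x] lz zw bE we; rewrite we /=.
  by apply: lt_total; rewrite eq_sym rev_neq.
rewrite -neq_ltn; have := flip_ord_neq x; by rewrite eq_sym.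
Qed.

Lemma card_slots : #|{: T}| = #|{: E + 'I_n}|.*2.
Proof. by rewrite -(bij_eq_card (slot_bij E n)) card_ord. Qed.

Definition slot_rank := rank_of slot_lt_irr card_slots.
Definition slot_form : T -> T -> C := order_form C slot_rank.

Lemma slot_formE z w : z != w -> slot_form z w = bs (slot_lt z w).
Proof.
move=> zw; rewrite /slot_form /order_form !(rank_ofE _ slot_lt_trans slot_lt_total).
case l: (slot_lt z w) => //.
by have := slot_lt_total zw; rewrite l /= => ->.
Qed.

(** Each vertex is the end of an even number of darts of [Q], so every sign occurs to an even
    power. *)
Lemma side_even f : \prod_(d in Q) side f (ter d) = 1.
Proof.
rewrite (partition_big ter predT) //= big1 // => v _.
rewrite (eq_bigr (fun=> side f v)) => [|d /andP [_ /eqP -> //]].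
rewrite prodr_const.
have -> : #|[pred d in Q | ter d == v]| = #|[set d in Q | ter d == v]|.
  by apply: eq_card => d; rewrite !inE.
by rewrite -[#|_|]odd_double_half (negbTE (evenQ v)) -mul2n exprM expr2 side_sqr expr1n.
Qed.

(* Two edges not both in the loops are ordered blockwise and give 1; two edges in
   the loops give sides, whose product over the even set [Q] is 1. *)
Lemma PF_slot_form : PF slot_form = \prod_f bs (lt (f, true) (f, false)).
Proof.
rewrite (PF_order _ (slot_bij E n)) /=; last first.
  exact: (@rank_of_inj _ _ _ slot_lt_irr slot_lt_trans slot_lt_total card_slots).
rewrite (prod_lt_ev_od (fun i j => slot_form (slot i) (slot j))).
have sneq i j : i != j -> slot i != slot j :> T by rewrite (inj_eq (bij_inj (slot_bij E n))).
have blockE i : block (slot i) = half_ord i by rewrite /block slotK.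
pose loop (k : 'I_#|{: E + 'I_n}|) := if enum_val k is inl f then (f, true) \in Q else false.
have loop_ev k : in_loops (slot (ev_ord k)) = loop k.
  by rewrite slot_ev /loop; case: (enum_val k).
have loop_od k : in_loops (slot (od_ord k)) = loop k.
  rewrite slot_od /loop; case: (enum_val k) => //= f.
  by rewrite -(closed_rev (f, true)).
(* The sides of edge [k] on which the ends of edge [l] lie. The four comparisons between the two
   blocks give [G k l * G l k], so the product over pairs becomes one over all ordered pairs. *)
pose G (k l : 'I_#|{: E + 'I_n}|) : C := match enum_val k, enum_val l with
  | inl f, inl g => if ((f, true) \in Q) && ((g, true) \in Q)
                    then side f (ends g).1 * side f (ends g).2 else 1
  | _, _ => 1 end.
have crossE (k l : 'I_#|{: E + 'I_n}|) : (k < l)%N ->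
  slot_form (slot (ev_ord k)) (slot (ev_ord l)) * slot_form (slot (ev_ord k)) (slot (od_ord l)) *
  (slot_form (slot (od_ord k)) (slot (ev_ord l)) * slot_form (slot (od_ord k)) (slot (od_ord l)))
  = G k l * G l k.
  move=> kl; have klne : k != l by rewrite neq_ltn kl.
  rewrite !slot_formE ?sneq ?(inj_eq (@ev_inj _)) ?(inj_eq (@od_inj _)) ?ev_od_neq //;
    last by rewrite eq_sym ev_od_neq.
  have same b : (forall i j, half_ord i = k -> half_ord j = l -> slot_lt (slot i) (slot j) = b) ->
      ~~ (loop k && loop l) -> bs (slot_lt (slot (ev_ord k)) (slot (ev_ord l))) *
      bs (slot_lt (slot (ev_ord k)) (slot (od_ord l))) *
      (bs (slot_lt (slot (od_ord k)) (slot (ev_ord l))) *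
       bs (slot_lt (slot (od_ord k)) (slot (od_ord l)))) = G k l * G l k.
    move=> bE; rewrite !bE ?half_ev ?half_od // /loop /G => nl.
    have -> : bs b * bs b * (bs b * bs b) = 1 by case: b {bE}; rewrite /bsign ?mulrNN !mulr1.
    case: (enum_val k) (enum_val l) nl => [f|j] [g|j'] /=; rewrite ?mulr1 //.
    by rewrite [((g, true) \in Q) && _]andbC => /negbTE ->; rewrite mulr1.
  have loopE i : in_loops (slot i) = loop (half_ord i).
    by case: (ev_odP i) => [[k' ->]|[k' ->]]; rewrite ?loop_ev ?loop_od ?half_ev ?half_od.
  have [lk|lk] := boolP (loop k); have [ll|ll] := boolP (loop l).
  - move: lk ll; rewrite /loop /G !slot_ev !slot_od.
    have : enum_val k != enum_val l by rewrite (inj_eq enum_val_inj).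
    case: (enum_val k) (enum_val l) => [f|j] [g|j'] //= fg fQ gQ.
    have fQ' : (f, false) \in Q by rewrite -(closed_rev (f, false)).
    have gQ' : (g, false) \in Q by rewrite -(closed_rev (g, false)).
    rewrite /slot_lt /= fQ gQ fQ' gQ' /= cross_side //.
  - apply: (same true); last by rewrite lk.
    by move=> i j hi hj; rewrite /slot_lt !loopE hi hj lk (negbTE ll).
  - apply: (same false); last by rewrite (negbTE lk).
    by move=> i j hi hj; rewrite /slot_lt !loopE hi hj ll (negbTE lk).
  apply: (same true); last by rewrite (negbTE lk).
  by move=> i j hi hj; rewrite /slot_lt !loopE !blockE hi hj (negbTE ll) (negbTE lk) kl.
rewrite [X in _ * X](_ : _ = 1) ?mulr1; last first.
  transitivity (\prod_(k : 'I_#|{: E + 'I_n}|) \prod_(l : 'I_#|{: E + 'I_n}| | (k < l)%N) (G k l * G l k)).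
    by apply: eq_bigr => k _; apply: eq_bigr => l; apply: crossE.
  have Gkk k : G k k = 1.
    rewrite /G; case: (enum_val k) => // f; case: ifP => // _.
    by rewrite -[X in side f X * _]/(org (f, true)) -[X in _ * side f X]/(org (f, false)) !side_org mulr1.
  have := prod_offdiag G; rewrite [X in _ = X * _]big1 // mul1r => <-.
  apply: big1 => k _; rewrite /G; case: (enum_val k) => [f|j]; last by rewrite big1.
  case fQ: ((f, true) \in Q); last by apply: big1 => l _; case: (enum_val l).
  rewrite (reindex (@enum_rank _)) /=; last by apply: onW_bij; apply: enum_rank_bij.
  rewrite big_sumType /= [X in _ * X]big1 ?mulr1 => [|j _]; last by rewrite enum_rankK.
  rewrite -[RHS](side_even f) [RHS]big_mkcond /=.
  rewrite [RHS](eq_bigr (fun d => (fun g b => if (g, b) \in Q then side f (ter (g, b)) else 1) d.1 d.2));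
    last by case.
  rewrite -(pair_bigA _ (fun g b => if (g, b) \in Q then side f (ter (g, b)) else 1)) /=.
  apply: eq_bigr => g _; rewrite enum_rankK big_bool -(closed_rev (g, true)) /=.
  by rewrite -[rev _]/(g, false); case: ifP => _; rewrite ?mulr1 // mulrC.
transitivity (\prod_(k : 'I_#|{: E + 'I_n}|)
   (if enum_val k is inl f then bs (lt (f, true) (f, false)) else 1)).
  apply: eq_bigr => k _; rewrite slot_formE ?sneq ?ev_od_neq // /slot_lt loop_ev loop_od.
  rewrite !blockE half_ev half_od ltnn eqxx /= slot_ev slot_od.
  by case: (loop k); case: (enum_val k) => [f|j] //=; rewrite ltnSn.
rewrite (reindex (@enum_rank _)) /=; last by apply: onW_bij; apply: enum_rank_bij.
rewrite big_sumType /= [X in _ * X]big1 ?mulr1 => [|j _]; last by rewrite enum_rankK.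
by apply: eq_bigr => f _; rewrite enum_rankK.
Qed.

(** The form of the loops collapses to a matching. Up to the gauge signs its entries are those of
    [slot_form], and decoupling read backwards rebuilds the whole sign form, whose Pfaffian is
    known. *)
Lemma PF_loops : PF (config_form Q e (@std_form C n)) = kappa.
Proof.
have std_flip x : std_form C x (flip_ord x) != 0 := std_form_flip x.
rewrite (PF_config_mono st std_form_antisym std_flip (fun x x' => @std_form0 x x') nc).
pose co (z : T) := if z is inl d then sg d else 1.
have slot_as : antisym slot_form by apply: order_form_antisym.
have mK := mateK st; have m_neq := mate_neq st.
have -> : PF (mono (mate Q pi e flip_ord) (weight (@std_form C n))) =
   PF (fun z w => co z * co w * mono (mate Q pi e flip_ord) slot_form z w).
  apply: eq_PF => z w; rewrite /mono; case: eqP => [->|]; last by rewrite mulr0.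
  rewrite slot_formE; last by rewrite eq_sym m_neq.
  case lz: (in_loops z).
    case: z lz => [d|//] /= dQ; rewrite -closed_rev in dQ; rewrite dQ.
    have [pQ pv /eqP pn _] := st_pair st dQ.
    rewrite /= /slot_lt /= -[d \in Q]closed_rev dQ closed_rev pQ /= /dart_form.
    rewrite org_rev pv ter_rev eqxx /= ifT //.
    by apply/orP; right; apply: contra pn => /eqP {2}->; rewrite dart_revK.
  have bm := block_mate lz; have mo := mate_out lz.
  have lm : in_loops (mate Q pi e flip_ord z) = false.
    by rewrite mo; case: (z) lz => //= d; rewrite closed_rev.
  rewrite /slot_lt lz lm bm ltnn eqxx mo /=.
  case: (z) => [d|x] /=; first by rewrite /dart_form eqxx.
  rewrite !mul1r; case: (ev_odP x) => [[k ->]|[k ->]]; rewrite ?flip_ev ?flip_od.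
    by rewrite std_form_ev_od /= ltnSn.
  by rewrite std_form_antisym std_form_ev_od /= ltnNge leqnSn.
rewrite (PF_scale (slot_bij E n)); congr (_ * _).
  by rewrite big_sumType /= [X in _ * X]big1 ?mulr1.
rewrite -PF_slot_form; apply/esym; apply: (PF_decouple (slot_bij E n)) => //.
move=> I /set0Pn [z0 z0I] mI.
have form_neq0 z : slot_form z (mate Q pi e flip_ord z) != 0.
  by rewrite slot_formE ?bs_neq0 // eq_sym m_neq.
have [/existsP [d0 /andP [d0I d0Q]]|/existsPn noQ] :=
    boolP [exists d, (inl d \in I) && (rev d \in Q)].
  pose J := [set a in Q | inl (rev a) \in I].
  have JQ : J \subset Q by apply/subsetP => a; rewrite inE => /andP [].
  have [|d|a aJ amin] := innermost_pair ltxx lt_trans lt_total (st_pair st) nc JQ.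
  + by apply/set0Pn; exists (rev d0); rewrite inE d0Q dart_revK.
  + rewrite !inE => /andP [dQ dI]; have [pQ _ _ _] := st_pair st dQ.
    by have := mI _ dI; rewrite /= dart_revK dQ pQ.
  have [aQ aI] : a \in Q /\ inl (rev a) \in I by move: aJ; rewrite inE => /andP.
  have [pQ pv /eqP pn pK] := st_pair st aQ.
  have maE : mate Q pi e flip_ord (inl (rev a)) = inl (rev (pi a)) by rewrite /= dart_revK aQ.
  exists (inl (rev a)), 1; split=> // w wI; rewrite mul1r maE => wa wpa.
  rewrite !slot_formE 1?eq_sym // /slot_lt /= !closed_rev aQ pQ.
  congr bs; case: w wI wa wpa => [d'|//] wI wa wpa /=; case: ifP => // dQ'.
  have nx : rev d' != a by apply: contra wa => /eqP <-; rewrite dart_revK.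
  have npx : rev d' != pi a by apply: contra wpa => /eqP <-; rewrite dart_revK.
  have [tx|tx] := eqVneq (ter (rev d')) (ter a).
    have := amin (rev d'); rewrite !dart_revK => -> //.
    by rewrite inE closed_rev dQ' dart_revK.
  (* A loop dart at another vertex compares alike with both members of the pair. *)
  by apply: lt_org; rewrite ?org_rev ?pv // -ter_rev.
have outI z : z \in I -> in_loops z = false.
  case: z => [d|x] //= dI; rewrite -closed_rev; apply/negbTE.
  by have := noQ d; rewrite dI.
exists z0, 1; split=> // w wI wz wm; rewrite mul1r.
have lz := outI _ z0I; have lm := outI _ (mI _ z0I); have lw := outI _ wI.
have bw : block z0 != block w.
  apply: contra wm => /eqP /block_eq [ee|]; first by rewrite ee eqxx in wz.
  by rewrite (mate_out lz); case: (z0) => [d|x] ->.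
rewrite !slot_formE 1?eq_sym // /slot_lt lz lm lw block_mate //.
by rewrite (negbTE bw) !orbF.
Qed.
End Sweep.

Lemma pairing_even P pi v : pairing ends P pi -> ~~ odd #|[set d in P | ter d == v]|.
Proof.
move=> pair; set A := [set d in P | ter d == v].
pose B := [set d in A | lt d (pi d)].
have piA d : d \in A -> [/\ pi d \in A, pi d != d & pi (pi d) = d].
  rewrite !inE => /andP [dP dv]; have [pP pv /eqP pn pK] := pair d dP.
  by rewrite pP pv dv.
have inB d : (d \in B) = (d \in A) && lt d (pi d) by rewrite /B in_set.
have -> : A = B :|: pi @: B.
  apply/setP => d; rewrite in_setU; apply/idP/orP => [dA|[|/imsetP [b bB ->]]].
  - have [pA pn pK] := piA d dA; case/orP: (lt_total pn) => l.
      by right; apply/imsetP; exists (pi d); rewrite // inB pA pK.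
    by left; rewrite inB dA.
  - by rewrite inB => /andP [].
  - by move: bB; rewrite inB => /andP [/piA []].
have dis : B :&: pi @: B = set0.
  apply/setP => d; rewrite in_setI in_set0; apply/negP => /andP [dB /imsetP [b bB e]].
  move: dB bB; rewrite !inB => /andP [dA l] /andP [bA lb]; have [_ _ pK] := piA b bA.
  by move: l; rewrite e pK => l; have := lt_trans lb l; rewrite ltxx.
rewrite cardsU dis cards0 subn0 card_in_imset ?addnn ?odd_double // => x x'.
by rewrite !inB => /andP [/piA [_ _ k1] _] /andP [/piA [_ _ k2] _] e; rewrite -k1 e k2.
Qed.

(** * Expansion over the subgraphs *)

Section Expansion.
Variables (y : E -> C) (e : 'I_(n.*2) -> option dart) (S : 'I_(n.*2) -> 'I_(n.*2) -> C).

Definition kac_ward (d d' : dart) : C :=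
  dart_form d d' * (if d' == rev d then 1 else y d.1 * y d'.1).

Definition bordered (z w : T) : C :=
  match z, w with
  | inl d, inl d' => kac_ward d d'
  | inl d, inr x => (e x == Some d)%:R
  | inr x, inl d => - (e x == Some d)%:R
  | inr x, inr x' => if (e x == None) && (e x' == None) then S x x' else 0
  end.

(** The matrix is split into its vertex entries and the rest, and [PF_add] chooses the rows using
    vertex entries. These rows are the half-edges of [P]; marked points have no vertex entries and
    are never chosen. *)
Lemma PF_bordered :
  PF bordered = \sum_(P : {set dart}) xw y P * PF (config_form P e S).
Proof.
pose vertex (z w : T) : C := match z, w with
  | inl d, inl d' => if org d == org d' then dart_form d d' * (y d.1 * y d'.1) else 0
  | _, _ => 0 end.
pose rest (z w : T) : C := match z, w with
  | inl d, inl d' => if d' == rev d then dart_form d d' else 0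
  | _, _ => bordered z w end.
have -> : PF bordered = PF (fun z w => vertex z w + rest z w).
  apply: eq_PF => -[d|x] [d'|x'] /=; rewrite ?add0r // /kac_ward.
  have [->|nr] := eqVneq d' (rev d).
    by rewrite org_rev (negbTE (org_neq_ter d)) add0r mulr1.
  rewrite addr0; case: ifP => // od.
  by rewrite /dart_form (negbTE nr) od /= mul0r.
rewrite (PF_add (slot_bij E n)).
pose dom (P : {set dart}) : {set T} := [set z | if z is inl d then rev d \in P else false].
pose codom (I : {set T}) : {set dart} := [set d | inl (rev d) \in I].
rewrite (bigID (fun I : {set T} => [exists x, inr x \in I])) /= big1 ?add0r => [|I /existsP [x xI]]; last first.
  by apply: (PF_row0 (slot_bij E n) (z := inr x)) => [[d|x']|[d|x']]; rewrite xI /=; case: ifP.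
rewrite (reindex_onto dom codom) /=; last first.
  move=> I /existsPn noX; apply/setP => -[d|x]; rewrite !inE ?dart_revK //.
  by rewrite (negbTE (noX x)).
apply: eq_big => [P|P _].
  have -> : codom (dom P) = P by apply/setP => d; rewrite !inE dart_revK.
  by rewrite eqxx andbT; apply/existsPn => x; rewrite inE.
pose co (z : T) : C := if z is inl d then (if rev d \in P then y d.1 else 1) else 1.
have -> : xw y P = \prod_z co z.
  rewrite big_sumType /= [X in _ * X]big1 // mulr1 /xw big_mkcond /=.
  rewrite (reindex_inj revI) /=; apply: eq_bigr => d _.
  by case: ifP.
rewrite -(PF_scale (slot_bij E n)); apply: eq_PF => z w; rewrite !inE.
case: z w => [d|x] [d'|x'] /=; rewrite ?mulr1 ?mul1r //.
- case: (rev d \in P); case: (rev d' \in P) => /=; rewrite ?mulr0 ?mulr1 ?mul1r //.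
  by case: ifP; rewrite ?mulr0 // mulrC.
all: by case: (rev _ \in P); rewrite ?mulr0 ?mul1r.
Qed.

(** The darts leaving [v] whose half-edge is in [P] are coupled only among themselves. *)
Lemma PF_config_odd (P : {set dart}) v : odd #|[set d in P | ter d == v]| -> PF (config_form P e S) = 0.
Proof.
move=> oddv; apply: (@PF_odd _ _ _ _ (slot_bij E n) _ (inl @: (@Defs.rev E @: [set d in P | ter d == v]))).
  by rewrite card_imset ?card_imset //; exact: inl_inj.
have memE d : (inl d : T) \in inl @: (@Defs.rev E @: [set d in P | ter d == v]) =
    (rev d \in P) && (org d == v).
  rewrite (mem_imset _ _ (@inl_inj _ _)) -{1}[d]dart_revK (mem_imset _ _ revI) inE.
  by rewrite ter_rev.
have memX x : (inr x : T) \in inl @: (@Defs.rev E @: [set d in P | ter d == v]) = false.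
  by apply/negP => /imsetP [].
move=> [d|x] [d'|x']; rewrite ?memE ?memX //=.
- case: (rev d \in P); case: (rev d' \in P) => //=; rewrite ?eqxx //.
  by case: (eqVneq (org d) (org d')) => [->|//]; rewrite eqxx.
all: by case: (rev _ \in P).
Qed.

(** The row of [rev d] could be matched only along its edge or to a mark, but [d] uses a vertex
    entry and no mark is there. *)
Lemma PF_config_half (P : {set dart}) d : d \notin P -> rev d \in P ->
  (forall x, e x != Some (rev d)) -> PF (config_form P e S) = 0.
Proof.
move=> dP rP nm; apply: (PF_row0 (slot_bij E n) (z := inl (rev d))).
  move=> [d'|x] /=; rewrite dart_revK (negbTE dP); last by rewrite (negbTE (nm x)).
  by case: ifP => // rP'; case: eqP => // ee; rewrite ee rP in rP'.
move=> [d'|x] /=; rewrite dart_revK (negbTE dP) /=; last by rewrite (negbTE (nm x)) oppr0.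
case: ifP => // rP'; case: eqP => // ee.
have ed : d' = d by apply: revI; rewrite ee.
by rewrite ed rP in rP'.
Qed.
End Expansion.

Section Marked.
Variables (e0 : 'I_(n.*2) -> dart).
Hypothesis e0_inj : injective e0.
Let e x := Some (e0 x).

Lemma PF_nonconfig (P : {set dart}) S : ~~ in_config ends e0 P -> PF (config_form P e S) = 0.
Proof.
have e0E x d : (e x == Some d) = (e0 x == d) by rewrite /e; apply/eqP/eqP => [[]|->].
rewrite /in_config !negb_and; case/or4P => /forallPn [x].
- rewrite negbK => rP; apply: (PF_row0 (slot_bij E n) (z := inr x)) => -[d|x'] //=.
    by case: ifP => //; rewrite e0E; case: eqP => [<-|]; rewrite ?rP // oppr0.
  by case: ifP => //; rewrite e0E; case: eqP => [<-|]; rewrite ?rP.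
- rewrite negb_imply => /andP [/existsPn nm eP].
  have [rP|rP] := boolP (rev (e0 x) \in P).
    apply: (PF_row0 (slot_bij E n) (z := inr x)) => -[d|x'] //=.
      by case: ifP => //; rewrite e0E; case: eqP => [<-|]; rewrite ?rP // oppr0.
    by case: ifP => //; rewrite e0E; case: eqP => [<-|]; rewrite ?rP.
  (* The mark [x] and the two darts of its edge are coupled only among themselves, and they are
     three. *)
  apply: (@PF_odd _ _ _ _ (slot_bij E n) _ [set inr x; inl (e0 x); inl (rev (e0 x))]).
    rewrite setUC cardsU1 cards2 !inE !(inj_eq (@inl_inj _ _)) /=.
    by rewrite rev_neq.
  have memE d : (inl d : T) \in [set inr x; inl (e0 x); inl (rev (e0 x))] = (d == e0 x) || (d == rev (e0 x)).
    by rewrite !inE !(inj_eq (@inl_inj _ _)).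
  have memX x' : (inr x' : T) \in [set inr x; inl (e0 x); inl (rev (e0 x))] = (x' == x).
    by rewrite !inE (inj_eq (@inr_inj _ _)) !orbF.
  have zero d d' : (d == e0 x) || (d == rev (e0 x)) -> ~~ ((d' == e0 x) || (d' == rev (e0 x))) ->
      config_form P e S (inl d) (inl d') = 0.
    move=> dW; rewrite negb_or => /andP [n1 n2] /=.
    case/orP: dW => /eqP ->; rewrite ?dart_revK ?(negbTE rP) ?(negbTE eP) ?(negbTE n1) ?(negbTE n2) ?if_same //.
  have zero2 d d' : (d == e0 x) || (d == rev (e0 x)) -> ~~ ((d' == e0 x) || (d' == rev (e0 x))) ->
      config_form P e S (inl d') (inl d) = 0.
    move=> dW; rewrite negb_or => /andP [n1 n2] /=.
    have -> : (d == rev d') = false.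
      rewrite -(involutive_eq_sym (@dart_revK E)).
      by case/orP: dW => /eqP ->; rewrite ?dart_revK; apply/negbTE.
    case/orP: dW => /eqP ->; rewrite ?dart_revK ?(negbTE rP) ?(negbTE eP) /= ?if_same //.
  have zeroX d x' : (d == e0 x) || (d == rev (e0 x)) -> x' != x -> (e x' == Some d) = false.
    rewrite e0E => /orP [] /eqP -> nx; first by rewrite (inj_eq e0_inj) (negbTE nx).
    by apply/negbTE; apply: nm.
  have zeroX' d : ~~ ((d == e0 x) || (d == rev (e0 x))) -> (e x == Some d) = false.
    by rewrite e0E negb_or [e0 x == d]eq_sym => /andP [/negbTE].
  move=> [d|x1] [d'|x2]; rewrite ?memE ?memX.
  + case dW: ((d == e0 x) || _); case dW': ((d' == e0 x) || _) => // _.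
      by apply: zero; rewrite ?dW ?dW'.
    by apply: zero2; rewrite ?dW ?dW'.
  + case dW: ((d == e0 x) || _); case: (eqVneq x2 x) => [->|nx] //= _; case: ifP => //.
      by rewrite (zeroX d).
    by rewrite zeroX' ?dW.
  + case dW: ((d' == e0 x) || _); case: (eqVneq x1 x) => [->|nx] //= _; case: ifP => //.
      by rewrite (zeroX d') // oppr0.
    by rewrite zeroX' ?dW // oppr0.
  + by [].
- rewrite negbK; exact: PF_config_odd.
rewrite negb_imply negb_or => /andP [/andP [/existsPn m1 /existsPn m2]].
case t: ((x, true) \in P); case f: ((x, false) \in P) => // _.
  by apply: (@PF_config_half _ _ _ (x, false)); rewrite ?f.
by apply: (@PF_config_half _ _ _ (x, true)); rewrite ?t.
Qed.

Lemma is_end_marked d : is_end e d = marked e0 d.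
Proof. by apply: eq_existsb => x; rewrite /e; apply/eqP/eqP => [[]|->]. Qed.

Lemma config_state (P : {set dart}) pi nu : in_config ends e0 P -> pairing ends P pi ->
  involutive nu -> (forall x, nu x != x) -> state P pi e nu.
Proof.
case/and4P => /forallP c1 /forallP c2 _ /forallP c4 pair nuK nu_neq; split=> //.
- by move=> x d [<-]; apply: c1.
- by move=> x x' d [<-] [/e0_inj].
- move=> x d [<-] eP; have := c2 x; rewrite (negbTE eP) implybF negbK.
  by case/existsP => x' /eqP <-; exists x'.
- move=> d dP rdP; have [/existsP [x /eqP <-]|nm] := boolP (marked e0 d); first by exists x.
  have nm' : ~~ marked e0 (rev d).
    by apply/negP => /existsP [x /eqP ex]; have := c1 x; rewrite ex dart_revK dP.
  have := c4 d.1; case: d dP rdP nm nm' => f b /=; rewrite /rev /=.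
  by case: b => /= dP rdP /negbTE-> /negbTE->; rewrite dP (negbTE rdP).
Qed.

Variable fac : seq dart -> dart -> dart -> C.
Hypothesis fac_step : forall c0 c1 r eb, org c1 = ter c0 -> c1 != rev c0 ->
  fac [:: c0, c1 & r] c0 eb =
  dart_form (rev c0) c1 / dart_form c0 (rev c0) * fac (if r is [::] then [::] else c1 :: r) c1 eb.
Hypothesis fac_nil : forall ea, fac [::] ea (rev ea) = - (dart_form ea (rev ea))^-1.

Variable side : E -> V -> C.
Hypothesis side_sqr : forall f v, side f v * side f v = 1.
Hypothesis side_org : forall f b, side f (org (f, b)) = 1.
Hypothesis cross_side : forall f g, f != g ->
  bs (lt (f, true) (g, true)) * bs (lt (f, true) (g, false)) *
   (bs (lt (f, false) (g, true)) * bs (lt (f, false) (g, false))) =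
  side f (ends g).1 * side f (ends g).2 * (side g (ends f).1 * side g (ends f).2).

Lemma state_change_nu P pi e' nu nu' : state P pi e' nu -> (forall x, e' x = None) ->
  involutive nu' -> (forall x, nu' x != x) -> state P pi e' nu'.
Proof. by case=> *; split. Qed.

Lemma noncrossing_sub (P Q : {set dart}) pi : Q \subset P -> noncrossing_lt ends lt P pi ->
  noncrossing_lt ends lt Q pi.
Proof. by move=> /subsetP QP nc a b aQ bQ; apply: nc; apply: QP. Qed.

(** Peeling the paths leaves the marked points matched as [s] prescribes, next to a union of loops.
    Undoing [s] contributes its sign, and the loops contribute [kappa]. *)
Lemma PF_config (P : {set dart}) pi (s : 'S_(n.*2)) g S : in_config ends e0 P ->
  pairing ends P pi -> noncrossing_lt ends lt P pi ->
  (forall k, (g k = [::] /\ e0 (s (od_ord k)) = rev (e0 (s (ev_ord k)))) \/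
     walk e0 P pi (g k) (e0 (s (ev_ord k))) (e0 (s (od_ord k)))) ->
  PF (config_form P e S) =
    (-1) ^+ s * \prod_k fac (g k) (e0 (s (ev_ord k))) (e0 (s (od_ord k))) * kappa.
Proof.
move=> cfg pair nc wk.
pose nu x := s (flip_ord ((s^-1)%g x)).
pose S' x x' : C := std_form C ((s^-1)%g x) ((s^-1)%g x').
have st := config_state cfg pair (perm_nuK s) (perm_nu_neq s).
have S'_as : antisym S' := perm_std_antisym s.
have S'_nu x : S' x (nu x) != 0 by rewrite /S' /nu permK std_form_flip.
have S'0 x x' : x' != nu x -> S' x x' = 0.
  move=> xx'; apply: std_form0; apply: contra xx' => /eqP ee.
  by rewrite /nu -ee permKV.
(* As long as every path is alive, no entry of [S] appears in the form, so the standard form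
   transported by [s] may be inserted. *)
have -> : PF (config_form P e S) = PF (config_form P e S') by apply: eq_PF => -[d|x] [d'|x'].
rewrite (PF_config_mono st S'_as S'_nu S'0 nc).
have vg : valid_paths pi s P e g.
  move=> k ea eb [<-] [<-]; case: (wk k) => [|[w2 w0 wl ws wi]]; [by left | right].
  by split=> // i i0 ic; rewrite !is_end_marked; apply: wi.
have [Q [e1 [QP stQ e1N ->]]] := reduce_paths fac_step fac_nil st vg (leqnn _).
rewrite mulrAC [_ * \prod__ _]mulrC; congr (_ * _).
rewrite -(PF_config_mono stQ S'_as S'_nu S'0 (noncrossing_sub QP nc)).
pose A d d' := config_form Q e1 S' (inl d) (inl d').
have dE (S0 : 'I_(n.*2) -> 'I_(n.*2) -> C) : PF (config_form Q e1 S0) = PF (dsum A S0).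
  by apply: eq_PF => -[d|x] [d'|x'] //=; rewrite !e1N //; case: ifP; rewrite ?oppr0.
rewrite dE (PF_dsum_perm (slot_bij E n) A (@std_form C n) (s^-1)%g) -dE odd_permV.
congr (_ * _); apply: (PF_loops side_sqr side_org cross_side _ e1N (noncrossing_sub QP nc)).
  exact: (state_change_nu stQ e1N flip_ordK flip_ord_neq).
by move=> v; apply: pairing_even (st_pair stQ).
Qed.
End Marked.

Section Total.
Variable side : E -> V -> C.
Hypothesis side_sqr : forall f v, side f v * side f v = 1.
Hypothesis side_org : forall f b, side f (org (f, b)) = 1.
Hypothesis cross_side : forall f g, f != g ->
  bs (lt (f, true) (g, true)) * bs (lt (f, true) (g, false)) *
   (bs (lt (f, false) (g, true)) * bs (lt (f, false) (g, false))) =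
  side f (ends g).1 * side f (ends g).2 * (side g (ends f).1 * side g (ends f).2).
Variable y : E -> C.

(** With all ends set to [None] the expansion keeps only sets of whole edges of even degree, and
    each of these contributes its weight times [kappa]. *)
Lemma PF_partition : PF (dsum (kac_ward y) (@std_form C n)) = Z_Ising ends y * kappa.
Proof.
pose e (x : 'I_(n.*2)) : option dart := None.
have -> : PF (dsum (kac_ward y) (@std_form C n)) = PF (bordered y e (@std_form C n)).
  by apply: eq_PF => -[d|x] [d'|x'] //=; rewrite oppr0.
rewrite PF_bordered.
pose dom (A : {set E}) : {set dart} := [set d | d.1 \in A].
pose cod (P : {set dart}) : {set E} := [set f | (f, true) \in P].
pose good (P : {set dart}) := [forall d, (rev d \in P) == (d \in P)] &&
   [forall v, ~~ odd #|[set d in P | ter d == v]|].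
rewrite (bigID good) /= [X in _ + X]big1 ?addr0 => [|P]; last first.
  rewrite negb_and => /orP [] /forallPn [x]; last first.
    by rewrite negbK => odd_v; rewrite (PF_config_odd _ _ odd_v) mulr0.
  case dP: (x \in P); case rP: (rev x \in P) => // _.
    by rewrite (@PF_config_half _ _ _ (rev x)) ?mulr0 ?rP ?dart_revK ?dP.
  by rewrite (@PF_config_half _ _ _ x) ?mulr0 ?dP ?rP.
rewrite (eq_bigr (fun P => xw y P * kappa)) => [|P /andP [/forallP cl /forallP ev]]; last first.
  have [pi [pair nc]] := noncrossing_exists ltxx lt_trans lt_total ev.
  congr (_ * _); apply: (PF_loops side_sqr side_org cross_side (pi := pi)) => //.
  split=> //; [move=> d dP rP | exact: flip_ordK | exact: flip_ord_neq].
  by have := cl d; rewrite dP (negbTE rP).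
rewrite -mulr_suml; congr (_ * _).
rewrite /Z_Ising (reindex_onto dom cod) /=; last first.
  move=> P /andP [/forallP cl _]; apply/setP => -[f b]; rewrite !inE /=.
  by case: b => //; rewrite -(eqP (cl (f, true))).
apply: eq_big => [A|A _].
  have -> : cod (dom A) = A by apply/setP => f; rewrite !inE.
  rewrite eqxx andbT /good; have -> : [forall d, (rev d \in dom A) == (d \in dom A)].
    by apply/forallP => d; rewrite !inE.
  rewrite /even_sub /=; apply: eq_forallb => v; congr (~~ odd _).
  have -> : [set d in dom A | ter d == v] = (fun f => (f, (ends f).2 == v)) @: [set f in A | endpt ends v f].
    apply/setP => -[f b]; rewrite !inE /=; apply/andP/imsetP => [[fA /eqP <-]|[f' + [-> ->]]].
      exists f; rewrite ?inE ?fA /endpt /Defs.ter /=; first by case: b; rewrite eqxx ?orbT.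
      congr pair; case: b; rewrite ?eqxx //.
      by apply/esym/negbTE; have := org_neq_ter (f, false).
    rewrite !inE /endpt /Defs.ter /= => /andP [-> ff]; split=> //.
    by case: (eqVneq (ends f').2 v) ff => [-> _|_]; rewrite ?eqxx ?orbF.
  by rewrite card_imset // => f f' [].
rewrite /xw (eq_bigl (fun d : dart => d.1 \in A)) => [|d]; last by rewrite inE.
rewrite big_mkcond /= (eq_bigr (fun d : dart => (fun f (_ : bool) => if f \in A then y f else 1) d.1 d.2)) //.
rewrite -(pair_bigA _ (fun f (_ : bool) => if f \in A then y f else 1)) /= [RHS]big_mkcond /=.
by apply: eq_bigr => f _; rewrite big_bool /=; case: ifP; rewrite ?mulr1 ?expr2.
Qed.

(** Adding to row [x] the combination of dart rows given by row [e0 x] of the inverse [Ki] clears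
    the border and leaves an entry of [Ki] in the corner. *)
Lemma PF_schur (K Ki : dart -> dart -> C) (e0 : 'I_(n.*2) -> dart) : antisym K ->
  (forall d d', \sum_b Ki d b * K b d' = (d == d')%:R) ->
  PF (fun z w => match z, w with
      | inl d, inl d' => K d d'
      | inl d, inr x => (e0 x == d)%:R
      | inr x, inl d => - (e0 x == d)%:R
      | inr _, inr _ => 0 end) = PF (dsum K (fun x x' => Ki (e0 x) (e0 x'))).
Proof.
move=> Kas KiK.
set M := (X in PF X = _).
pose B (z w : T) : C := match z, w with
  | inl d, inl d' => (d == d')%:R
  | inl _, inr _ => 0
  | inr x, inl d => Ki (e0 x) d
  | inr x, inr x' => (x == x')%:R end.
have pick (I : finType) (i : I) (F : I -> C) : \sum_j (i == j)%:R * F j = F i.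
  rewrite (bigD1 i) //= eqxx mul1r big1 ?addr0 // => j.
  by rewrite eq_sym => /negbTE ->; rewrite mul0r.
have -> : PF M = PF (fun z w => \sum_a \sum_b B z a * M a b * B w b).
  rewrite (@PF_unitriangular _ _ _ _ (slot_bij E n) M B (fun z => if z is inl _ then true else false)).
  - by rewrite big1 ?mul1r // => -[d|x] _; rewrite /= eqxx.
  - by case=> [d|x] [d'|x'] //= _; rewrite (inj_eq (@inl_inj _ _)).
  - by case=> [d|x] [d'|x'] //= _ _; rewrite (inj_eq (@inr_inj _ _)) => /negbTE ->.
apply: eq_PF => z w.
pose r b := \sum_a B z a * M a b.
have -> : \sum_a \sum_b B z a * M a b * B w b = \sum_b r b * B w b.
  by rewrite exchange_big /=; apply: eq_bigr => b _; rewrite mulr_suml.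
have rE b : r b = match z, b with
    | inl d, _ => M (inl d) b
    | inr x, inl _ => 0
    | inr x, inr x' => Ki (e0 x) (e0 x') end.
  rewrite /r big_sumType /=; case: z {r} => [d|x] /=.
    by rewrite pick [X in _ + X]big1 ?addr0 // => x _; rewrite mul0r.
  rewrite pick; case: b => [d|x'] /=.
    by rewrite KiK subrr.
  rewrite addr0; under eq_bigr do rewrite mulrC; exact: pick.
under eq_bigr do rewrite rE.
rewrite big_sumType /=; case: z {r rE} => [d|x]; case: w => [d'|x'] /=.
- under eq_bigr do rewrite mulrC.
  by rewrite pick [X in _ + X]big1 ?addr0 // => x _; rewrite mulr0.
- under [X in _ + X]eq_bigr do rewrite mulrC.
  rewrite pick; under eq_bigr => b _ do rewrite Kas mulNr mulrC.
  by rewrite sumrN KiK addrC subrr.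
- by rewrite big1 => [|b _]; rewrite ?mul0r // add0r big1 // => b _; rewrite mulr0.
rewrite big1 => [|b _]; last by rewrite mul0r.
by rewrite add0r; under eq_bigr do rewrite mulrC; rewrite pick.
Qed.
End Total.

(** * Existence of the paths and of the permutation *)

Section Existence.
Variable pi : dart -> dart.

Lemma walk_reverse (M : pred dart) (P : {set dart}) c ea eb : pairing ends P pi ->
  walk_for pi M P c ea eb -> walk_for pi M P [seq rev d | d <- seq.rev c] eb ea.
Proof.
move=> pair [c2 c0 cl cs ci].
have c'E i : (i < size c)%N ->
    nth eb [seq rev d | d <- seq.rev c] i = rev (nth ea c (size c - i.+1)).
  move=> ic; rewrite (nth_map ea) ?size_rev // nth_rev //.
have last_nth : nth ea c (size c).-1 = rev eb by rewrite nth_last.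
have c_gt0 : (0 < size c)%N by apply: leq_trans c2.
split.
- by rewrite size_map size_rev.
- by rewrite c'E // subn1 last_nth dart_revK.
- by rewrite -nth_last size_map size_rev c'E ?ltn_predL // prednK // subnn c0.
- rewrite size_map size_rev => i ic.
  have jE : (size c - i.+1 = (size c - i.+2).+1)%N by rewrite subnSK.
  have jc : ((size c - i.+2).+1 < size c)%N by rewrite -jE ltn_subrL.
  have [jP jn] := cs _ jc; have [pP _ _ pK] := pair _ jP.
  rewrite !c'E //; last exact: ltnW.
  by rewrite jE jn dart_revK pK.
rewrite size_map size_rev => i i0 ic; rewrite c'E; last exact: ltnW.
have j0 : (0 < size c - i.+1)%N by rewrite subn_gt0.
have jc : ((size c - i.+1).+1 < size c)%N by rewrite subnSK ?ltn_subrL ?i0 ?(ltnW ic) // ltnW.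
by have [m1 m2] := ci _ j0 jc; rewrite dart_revK.
Qed.

(** Induction on the size of [P], with the same peeling as for the Pfaffian. When no end continues
    into [P], the ends come in opposite pairs on edges, joined by empty paths. Walks are kept from
    both ends, as the orientation is chosen only later. *)
Lemma walks_exist N (P : {set dart}) e : state P pi e flip_ord -> (forall x, e x != None) ->
  (#|P| <= N)%N ->
  exists (nu : 'I_(n.*2) -> 'I_(n.*2)) (g : 'I_(n.*2) -> seq dart),
  [/\ involutive nu, forall x, nu x != x & forall x ea eb,
    e x = Some ea -> e (nu x) = Some eb ->
    (g x = [::] /\ eb = rev ea) \/ walk_for pi (is_end e) P (g x) ea eb].
Proof.
have edges_only P' e' : state P' pi e' flip_ord -> (forall x, e' x != None) ->
  (forall x, ~~ (if e' x is Some d then d \in P' else false)) ->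
  exists (nu : 'I_(n.*2) -> 'I_(n.*2)) (g : 'I_(n.*2) -> seq dart),
  [/\ involutive nu, forall x, nu x != x & forall x ea eb,
    e' x = Some ea -> e' (nu x) = Some eb ->
    (g x = [::] /\ eb = rev ea) \/ walk_for pi (is_end e') P' (g x) ea eb].
  move=> st eS noP.
  have eE x : exists d, e' x = Some d by case: (e' x) (eS x) => [d|] // _; exists d.
  have partner x : exists x', forall d, e' x = Some d -> e' x' = Some (rev d).
    have [d ex] := eE x; have := noP x; rewrite ex => /(st_end st ex) [x' ex'].
    by exists x' => d' [<-].
  have [nu nuE] := fin_all_exists partner; exists nu, (fun=> [::]).
  split=> [x|x|x ea eb ex ex'].
  - have [d ed] := eE x; apply: (st_inj st (d := d)) => //.
    by rewrite (nuE _ (rev d)) ?dart_revK // (nuE _ d).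
  - apply/eqP => nx; have [d ed] := eE x; have := nuE x d ed.
    by rewrite nx ed => ee; have := rev_neq d; rewrite -(Some_inj ee) eqxx.
  by left; split=> //; apply: Some_inj; rewrite -ex' (nuE _ _ ex).
elim: N P e => [|N IHN] P e st eS cardP;
  have [/existsP [x0 x0P]|/existsPn noP] :=
    boolP [exists x, if e x is Some d then d \in P else false];
  try exact: edges_only st eS noP.
  case ex0: (e x0) x0P => [c0|//] c0P; move: cardP; rewrite leqn0 cards_eq0 => /eqP P0.
  by rewrite P0 inE in c0P.
case ex0: (e x0) x0P => [c0|//] c0P.
have [pP pv pn pK rP] := peel_facts st ex0 c0P.
pose c1 := rev (pi c0); pose P' := P :\ c0 :\ pi c0; pose e' := set_end e x0 (Some c1).
have st' : state P' pi e' flip_ord := peel_state st ex0 c0P.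
have inP' d : (d \in P') = [&& d != pi c0, d != c0 & d \in P] by rewrite !inE.
have [||nu [g [nuK nu_neq gw]]] := IHN P' e' st'.
- by move=> x; rewrite /e' /set_end; case: ifP.
- rewrite -ltnS; apply: leq_trans cardP; apply: proper_card; apply/properP; split.
    by apply/subsetP => d; rewrite inP' => /and3P [].
  by exists c0; rewrite // inP' eqxx andbF.
have is_endE d : is_end e d -> is_end e' d \/ d = c0.
  case/is_endP => x ex; case: (eqVneq x x0) => [xx|xx]; last by left; apply/is_endP; exists x; rewrite /e' set_end_neq.
  by right; move: ex; rewrite xx ex0 => -[].
have widen c ea eb i : walk_for pi (is_end e') P' c ea eb -> (0 < i)%N -> (i.+1 < size c)%N ->
    ~~ is_end e (nth ea c i) /\ ~~ is_end e (rev (nth ea c i)).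
  move=> [w2 w0 wl ws wi] i0 ic; have [m1 m2] := wi i i0 ic.
  have [iP _] := ws i ic; split; apply/negP => /is_endE [].
  - by rewrite (negbTE m1).
  - by move=> ee; move: iP; rewrite ee inP' eqxx andbF.
  - by rewrite (negbTE m2).
  case: i i0 ic m1 m2 iP => // i _ ic _ _ _; have [iP ->] := ws i (ltnW ic).
  have [qP _ _ _] := st_pair st' iP.
  by rewrite dart_revK => ee; move: qP; rewrite ee inP' eqxx andbF.
have sub d : d \in P' -> d \in P by rewrite inP' => /and3P [].
(* The walk in the peeled configuration with [c0] put in front; an empty walk there means that [c1]
   is already the last dart. *)
pose g0 := c0 :: (if g x0 is [::] then [:: c1] else g x0).
have w0 eb : e (nu x0) = Some eb -> walk_for pi (is_end e) P g0 c0 eb.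
  move=> eb1; have ex1 : e' (nu x0) = Some eb by rewrite /e' set_end_neq.
  have ex0' : e' x0 = Some c1 by rewrite /e' set_endE.
  case: (gw x0 c1 eb ex0' ex1) => [[g0E ->]|wk].
    rewrite /g0 g0E; split=> //; first by rewrite /= dart_revK.
    by case=> // _; split.
    by case=> // i; rewrite ltnS ltn0.
  have wd := widen _ _ _ _ wk; have [w2 wh wl ws wi] := wk.
  have -> : g0 = c0 :: g x0 by rewrite /g0; case: (g x0) w2.
  have hd : nth c0 (g x0) 0 = c1 by rewrite (set_nth_default c1) // (leq_trans _ w2).
  split.
  - by rewrite ltnS (leq_trans _ w2).
  - by [].
  - by rewrite /= -wl; case: (g x0) w2.
  - move=> [|i] ic /=; first by split.
    have [iP i1] := ws i ic; rewrite !(set_nth_default c1) //; last exact: ltnW.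
    by split=> //; apply: sub.
  move=> [//|[|i]] _ ic /=; last first.
    by rewrite (set_nth_default c1); [apply: wd | apply: ltnW].
  rewrite hd; have [c1P _] := ws 0%N w2; rewrite wh in c1P.
  split; apply/negP => /is_endP [x ex].
    by have := st_free st ex; rewrite dart_revK pP.
  have xx : x != x0 by apply: contraNneq pn => xx; move: ex; rewrite xx ex0 dart_revK => -[<-].
  have ex' : e' x = Some (rev c1) by rewrite /e' set_end_neq.
  by have := st_free st' ex'; rewrite dart_revK c1P.
exists nu, (fun x => if x == x0 then g0 else if x == nu x0 then [seq rev d | d <- seq.rev g0] else g x).
split=> // x ea eb ex ex'.
have [xx|xx] := eqVneq x x0.
  right; rewrite xx in ex ex'; move: ex; rewrite ex0 => -[<-]; exact: w0.
have [xx1|xx1] := eqVneq x (nu x0).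
  right; rewrite xx1 nuK ex0 in ex'; case: ex' => <-; rewrite xx1 in ex.
  by apply: walk_reverse (w0 _ ex); apply: st_pair st.
have nx : nu x != x0 by apply: contra xx1 => /eqP <-; rewrite nuK.
have [||triv|wk] := gw x ea eb; [by rewrite /e' set_end_neq | by rewrite /e' set_end_neq | by left | right].
have wd := widen _ _ _ _ wk; have [w2 wh wl ws wi] := wk.
by split=> // i ic; have [iP i1] := ws i ic; split=> //; apply: sub.
Qed.

(** The smaller element of each orbit goes to an even position, its image to the odd position that
    follows. *)
Lemma perm_of_involution (nu : 'I_(n.*2) -> 'I_(n.*2)) : involutive nu ->
  (forall x, nu x != x) -> exists s : 'S_(n.*2), forall k, s (od_ord k) = nu (s (ev_ord k)).
Proof.
move=> nuK nu_neq; pose O := [set x : 'I_(n.*2) | (x < nu x)%N].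
have OC : ~: O = nu @: O.
  apply/setP => x; rewrite !inE; apply/idP/imsetP => [|[x' x'O ->]].
    rewrite -leqNgt leq_eqVlt (inj_eq val_inj) (negbTE (nu_neq x)) /= => lt_x.
    by exists (nu x); rewrite ?inE ?nuK.
  by rewrite inE in x'O; rewrite nuK -leqNgt ltnW.
have cardO : #|O| = n.
  apply: double_inj; rewrite -addnn -{2}(card_imset _ (inv_inj nuK)) -OC.
  by rewrite cardsC card_ord.
pose f (i : 'I_(n.*2)) := let x := enum_val (cast_ord (esym cardO) (half_ord i)) in
  if odd i then nu x else x.
have memO j : enum_val (cast_ord (esym cardO) j) \in O by apply: enum_valP.
have f_inj : injective f.
  move=> i j; rewrite /f /=; have := memO (half_ord i); have := memO (half_ord j).
  rewrite !inE; set x := enum_val _; set x' := enum_val _ => lt' lt1.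
  case oi: (odd i); case oj: (odd j) => ee.
  - apply: half_odd_inj; last by rewrite oi oj.
    by apply: (@cast_ord_inj _ _ (esym cardO)); apply: enum_val_inj; apply: (inv_inj nuK).
  - by move: lt1 lt'; rewrite -ee nuK => l1 l2; have := ltn_trans l1 l2; rewrite ltnn.
  - by move: lt1 lt'; rewrite ee nuK => l1 l2; have := ltn_trans l1 l2; rewrite ltnn.
  apply: half_odd_inj; last by rewrite oi oj.
  by apply: (@cast_ord_inj _ _ (esym cardO)); apply: enum_val_inj.
exists (perm f_inj) => k; rewrite !permE /f half_ev half_od /=.
by rewrite odd_double.
Qed.
End Existence.
End Matching.

(** * The Kac-Ward matrix *)

Section Assembly.
Variables (C : numClosedFieldType) (V E : finType) (pos : V -> C)
          (ends : E -> V * V).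
Local Notation dart := (E * bool)%type.
Local Notation org := (org ends).
Local Notation ter := (ter ends).
Local Notation udir := (udir pos ends).
Hypothesis planar : planar_embedding pos ends.
Variable om : C.
Hypothesis om_generic : forall v w, v != w -> im (om * (pos v - pos w)) != 0.
Variable eta : dart -> C.
Hypothesis eta_sqr : forall d, eta d ^+ 2 = udir d.
Local Notation lt := (dart_lt pos ends om).
Local Notation sg := (gauge_sign pos ends om eta).
Local Notation dart_form := (dart_form ends lt sg).
Let revI := inv_inj (@dart_revK E).

Lemma gauge_vertex d d' : org d = org d' -> d != d' ->
  dart_form d d' = - ('i * eta d * (eta d')^* * hw pos ends (rev d) d').
Proof.
move=> od dd'; rewrite (vertex_entry planar om_generic eta_sqr od dd').
by rewrite /dart_form od eqxx dd' orbT /= dart_lt_angle.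
Qed.

Lemma gauge_edge d : dart_form d (rev d) = 'i * eta d * (eta (rev d))^*.
Proof.
by rewrite (edge_entry planar om_generic eta_sqr) /dart_form eqxx /= (dart_lt_rev planar).
Qed.

Lemma hw_sqr d d' : hw pos ends d d' ^+ 2 = udir d' / udir d.
Proof. by rewrite /hw /halfexp; case: ifP => _; rewrite ?sqrrN sqrtCK. Qed.

(** The path carries the inverse of the turning phase and the matrix entry carries the phase itself.
    They are reconciled by the square of the phase being [eta c1 ^+ 2 / eta c0 ^+ 2] and by
    [eta (rev c0) ^+ 2 = - eta c0 ^+ 2]. *)
Lemma path_factor_step c0 c1 r eb : org c1 = ter c0 -> c1 != rev c0 ->
  path_factor pos ends eta [:: c0, c1 & r] c0 eb =
  dart_form (rev c0) c1 / dart_form c0 (rev c0) *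
  path_factor pos ends eta (if r is [::] then [::] else c1 :: r) c1 eb.
Proof.
move=> oc nc.
have -> : path_factor pos ends eta (if r is [::] then [::] else c1 :: r) c1 eb =
    path_factor pos ends eta (c1 :: r) c1 eb.
  by case: r =>//; rewrite /path_factor !big_ord0.
have tailE : \prod_(i < size r) (hw pos ends (nth c0 (c1 :: r) i) (nth c0 (c1 :: r) i.+1))^-1 =
    \prod_(i < size r) (hw pos ends (nth c1 (c1 :: r) i) (nth c1 (c1 :: r) i.+1))^-1.
  by apply: eq_bigr => i _; rewrite !(set_nth_default c1 c0) //= ltnS // ltnW.
rewrite /path_factor /= big_ord_recl /= tailE.
rewrite gauge_vertex ?org_rev ?oc // 1?eq_sym // gauge_edge dart_revK.
have h2 := hw_sqr c0 c1; rewrite -!eta_sqr in h2.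
have r2 : eta (rev c0) ^+ 2 = - eta c0 ^+ 2 by rewrite !eta_sqr (udir_rev pos ends).
rewrite !(eta_conj planar eta_sqr).
have := eta_neq0 planar eta_sqr c0; have := eta_neq0 planar eta_sqr c1.
have := eta_neq0 planar eta_sqr (rev c0).
have h0 : hw pos ends c0 c1 != 0.
  by rewrite -sqrf_eq0 h2 mulf_neq0 ?invr_eq0 ?sqrf_eq0 ?(eta_neq0 planar eta_sqr).
have i0 := neq0Ci C; set Pr := \prod_(_ < _) _.
move: (eta c0) (eta c1) (eta (rev c0)) (eta eb) (hw _ _ _ _) h0 h2 r2 (Pr) => x z w t h h0 h2 r2 q w0 z0 x0.
have -> : 'i * x^-1 * t * (h^-1 * q) = ('i * z^-1 * t * q) * (x^-1 * z * h^-1).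
  by field; rewrite h0 z0 x0.
have -> : - ('i * w * z^-1 * h) / ('i * x * w^-1) * ('i * z^-1 * t * q) =
  ('i * z^-1 * t * q) * (- w ^+ 2 * h * z^-1 * x^-1).
  by field; rewrite i0 x0 w0 z0.
congr (_ * _); rewrite r2 opprK.
have hE : h ^+ 2 * x ^+ 2 = z ^+ 2 by rewrite h2 divfK // sqrf_eq0.
apply: (mulIf (x := x * z * h)); first by rewrite !mulf_neq0.
transitivity (z ^+ 2); first by field; rewrite h0 x0.
by rewrite -hE; field; rewrite x0 z0.
Qed.

Lemma path_factor_nil ea :
  path_factor pos ends eta [::] ea (rev ea) = - (dart_form ea (rev ea))^-1.
Proof.
rewrite /path_factor big_ord0 mulr1 gauge_edge !(eta_conj planar eta_sqr).
have := eta_neq0 planar eta_sqr ea; have := eta_neq0 planar eta_sqr (rev ea).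
move: (eta ea) (eta (rev ea)) => x w w0 x0.
by rewrite !invfM invrK invCi !mulNr opprK.
Qed.

Lemma noncrossing_ltE (P : {set dart}) pi : pairing ends P pi ->
  noncrossing pos ends P pi <-> noncrossing_lt ends lt P pi.
Proof.
move=> pair.
have key a b : a \in P -> b \in P -> ter a = ter b -> b != a -> b != pi a ->
    crossing pos ends a (pi a) b (pi b) =
    (between lt a (pi a) b != between lt a (pi a) (pi b)).
  move=> aP bP ab ba bpa.
  have [paP pav /eqP pan paK] := pair _ aP; have [pbP pbv /eqP pbn pbK] := pair _ bP.
  have pba : pi b != a by apply: contra bpa => /eqP <-; rewrite pbK.
  have pbpa : pi b != pi a.
    by apply: contra ba => /eqP /(congr1 pi); rewrite paK pbK => ->.
  have pan' : a != pi a by rewrite eq_sym.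
  rewrite (crossingE planar om_generic) ?pav ?pbv ?ab //.
  have inlinE z : ter z = ter b -> z != pi a ->
    ((angle pos ends om (rev a) < angle pos ends om (rev z)) ==
     (angle pos ends om (rev z) < angle pos ends om (rev (pi a)))) = between lt a (pi a) z.
    move=> zv zpa; rewrite /between -!dart_lt_angle ?org_rev ?pav ?zv ?ab //.
    have rne : rev (pi a) != rev z by rewrite (inj_eq revI) eq_sym.
    rewrite (lt_neg (dart_ltxx pos ends om) (@dart_lt_trans _ _ _ pos ends om)
      (dart_lt_total planar om_generic) rne).
    by case: (lt _ _) (lt _ _) => [] [].
  by rewrite !inlinE.
split=> nc a b aP bP ab.
  move=> ba bpa; have := nc a b aP bP ab (elimN eqP ba) (elimN eqP bpa).
  by rewrite key // => /negPn /eqP.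
by move=> /eqP ba /eqP bpa; rewrite key // negbK; apply/eqP/nc.
Qed.

Variable y : E -> C.

Lemma KhatE d d' : Khat pos ends y eta (enum_rank d) (enum_rank d') = kac_ward ends lt sg y d d'.
Proof.
pose i := enum_rank d; pose j := enum_rank d'.
have KmxE : Kmx pos ends y i j = (d' == rev d)%:R - Tentry pos ends y (rev d) d'.
  rewrite !mxE (bigD1 (enum_rank (rev d))) //= !mxE !enum_rankK eqxx mul1r big1 ?addr0.
    by rewrite [rev d == d']eq_sym.
  move=> k ki; rewrite !mxE enum_rankK; case: eqP => [e|]; last by rewrite mul0r.
  by rewrite e enum_valK eqxx in ki.
have -> : Khat pos ends y eta i j = 'i * (eta d * Kmx pos ends y i j * (eta d')^*).
  rewrite /Khat 2!mxE (bigD1 j) //= big1 ?addr0 => [|k kj]; last first.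
    by rewrite !mxE [j == k]eq_sym (negbTE kj) rmorph0 mulr0.
  rewrite mxE (bigD1 i) //= big1 ?addr0 => [|k ki]; last first.
    by rewrite mxE [i == k]eq_sym (negbTE ki) mul0r.
  by rewrite !mxE !eqxx !enum_rankK.
rewrite KmxE /Tentry ter_rev dart_revK /kac_ward.
have [->|nr] := eqVneq d' (rev d).
  by rewrite org_rev (negbTE (org_neq_ter planar d)) /= subr0 !mulr1 gauge_edge mulrA.
rewrite /= sub0r; have [od|nod] /= := eqVneq (org d) (org d'); last first.
  by rewrite /dart_form (negbTE nr) (negbTE nod) oppr0 mulr0 !mul0r mulr0.
have [->|dd'] /= := eqVneq d' d.
  rewrite /dart_form !eqxx /= orbF eq_sym (negbTE (rev_neq d)).
  by rewrite oppr0 mulr0 !mul0r mulr0.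
by rewrite gauge_vertex // 1?eq_sym //= ; ring.
Qed.

Lemma kac_ward_antisym : antisym (kac_ward ends lt sg y).
Proof.
move=> d d'; rewrite /kac_ward -(involutive_eq_sym (@dart_revK E)) eq_sym -mulNr.
rewrite -(dart_form_antisym ends (dart_ltxx pos ends om) (@dart_lt_trans _ _ _ pos ends om)
  (dart_lt_total planar om_generic)) [y d.1 * _]mulrC.
by case: eqP.
Qed.

Variables (n : nat) (e : 'I_(n.*2) -> dart).
Hypothesis e_inj : injective e.
Let ltxx := dart_ltxx pos ends om.
Let lt_trans := @dart_lt_trans _ _ _ pos ends om.
Let lt_total := dart_lt_total planar om_generic.
Let lt_org := @dart_lt_org _ _ _ pos ends om.
Let sg_sqr := gauge_sqr planar om_generic eta_sqr.
Let cross := dart_lt_cross planar om_generic.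
Local Notation PF := (PF (@slot E n)).
Local Notation kappa := (kappa lt sg).

Lemma valid_choice_exists P : P \in configs ends e -> exists ch, valid_choice pos ends e P ch.
Proof.
rewrite inE => cfg; have [_ _ /forallP evP _] := and4P cfg.
have [pi [pair nc]] := noncrossing_exists ltxx lt_trans lt_total evP.
have st := config_state e_inj cfg pair (@flip_ordK n) (@flip_ord_neq n).
have [|nu [g [nuK nu_neq gw]]] := walks_exist st _ (leqnn _); first by [].
have [s sE] := perm_of_involution nuK nu_neq.
exists (pi, s, fun k => g (s (ev_ord k))); split=> //; first exact/noncrossing_ltE.
move=> k; have [|[w2 w0 wl ws wi]] := gw (s (ev_ord k)) _ _ erefl erefl.
  by rewrite -sE; left.
by rewrite -sE in wl; right.
Qed.

Lemma PF_config_tau P ch S : P \in configs ends e -> valid_choice pos ends e P ch ->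
  PF (config_form ends lt sg P (fun x => Some (e x)) S) = tau pos ends eta e ch * kappa.
Proof.
rewrite inE; case: ch => [[pi s] g] cfg [pair nc paths].
have nc' := (noncrossing_ltE pair).1 nc.
exact: (PF_config ltxx lt_trans lt_total lt_org sg_sqr e_inj path_factor_step path_factor_nil
  (side_sqr pos ends om) (side_org pos ends om) cross S cfg pair nc' paths).
Qed.

Let kappa0 : kappa != 0 := kappa_neq0 lt sg_sqr.

Lemma PF_kac_ward : PF (dsum (kac_ward ends lt sg y) (@std_form C n)) = Z_Ising ends y * kappa.
Proof.
exact: (PF_partition n (org_neq_ter planar) ltxx lt_trans lt_total lt_org sg_sqr
  (side_sqr pos ends om) (side_org pos ends om) cross y).
Qed.

(** A left kernel vector, extended by 0 to the marked points, makes the direct sum singular, whereas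
    its Pfaffian is [Z_Ising ends y * kappa]. *)
Lemma Khat_unit : Z_Ising ends y != 0 -> Khat pos ends y eta \in unitmx.
Proof.
move=> Z0; rewrite unitmxE unitfE; apply/negP => /eqP /eqP /det0P [v v0 vK].
have := mulf_neq0 Z0 kappa0; rewrite -PF_kac_ward => /eqP; apply.
pose u (z : dart + 'I_(n.*2)) := if z is inl d then v 0 (enum_rank d) else 0.
have [j vj] : exists j, v 0 j != 0.
  apply/existsP; apply: contraR v0 => /existsPn v0; apply/eqP/rowP => j.
  by rewrite mxE; apply/eqP; have := v0 j; rewrite negbK.
apply: (PF_singular (slot_bij E n) (u := u) (z0 := inl (enum_val j))).
- move=> [d|x] [d'|x'] /=; rewrite ?oppr0 //; first exact: kac_ward_antisym.
  exact: std_form_antisym.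
- by rewrite /u enum_valK.
move=> w; rewrite big_sumType /= [X in _ + X]big1 ?addr0 => [|x _]; last by rewrite mul0r.
case: w => [d'|x] /=; last by rewrite big1 // => d _; rewrite mulr0.
have /rowP/(_ (enum_rank d')) := vK; rewrite !mxE => vK0; rewrite -[RHS]vK0.
rewrite [RHS](reindex (@enum_rank _)) /=; last by apply: onW_bij; apply: enum_rank_bij.
by apply: eq_bigr => d _; rewrite KhatE.
Qed.

(** The bordered Pfaffian is computed twice: through the Schur complement it factors into the
    left-hand side, and by expansion it is a sum over subgraphs in which only configurations
    survive. *)
Lemma PF_inverse : Z_Ising ends y != 0 ->
  pfaffian (Kinv_sub pos ends y eta e) * (Z_Ising ends y * kappa) =
  \sum_(P in configs ends e) xw y P * PF (config_form ends lt sg P (fun x => Some (e x)) (fun _ _ => 0)).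
Proof.
move=> Z0; pose Ki := Khat_inv pos ends y eta.
have KiK d d' : \sum_b Ki d b * kac_ward ends lt sg y b d' = (d == d')%:R.
  have /matrixP/(_ (enum_rank d) (enum_rank d')) := mulVmx (Khat_unit Z0).
  rewrite !mxE (inj_eq enum_rank_inj) => <-.
  rewrite [RHS](reindex (@enum_rank _)) /=; last by apply: onW_bij; apply: enum_rank_bij.
  by apply: eq_bigr => b _; rewrite KhatE.
have <- : pfaffian (\matrix_(i, j) Ki (e i) (e j)) * PF (dsum (kac_ward ends lt sg y) (@std_form C n)) =
    pfaffian (Kinv_sub pos ends y eta e) * (Z_Ising ends y * kappa) by rewrite PF_kac_ward.
rewrite -(PF_dsum (slot_bij E n) _ (fun i j => Ki (e i) (e j))).
rewrite -(PF_schur e kac_ward_antisym KiK).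
transitivity (PF (bordered ends lt sg y (fun x => Some (e x)) (fun _ _ => 0))).
  by apply: eq_PF => -[d|x] [d'|x'] //=; rewrite (inj_eq (@Some_inj _)).
rewrite (PF_bordered (org_neq_ter planar)) (bigID (mem (configs ends e))) /=.
rewrite [X in _ + X]big1 ?addr0 // => P; rewrite inE => nc.
by rewrite (PF_nonconfig _ _ e_inj) ?mulr0.
Qed.
End Assembly.

Theorem theorem1p2 (C : numClosedFieldType) (V E : finType) (pos : V -> C)
    (ends : E -> V * V) (y : E -> C) (eta : E * bool -> C)
    (n : nat) (e : 'I_(n.*2) -> E * bool) :
  planar_embedding pos ends ->
  connected_graph ends ->
  (forall d, eta d ^+ 2 = udir pos ends d) ->
  Z_Ising ends y != 0 ->
  injective e ->
  (forall P, P \in configs ends e -> exists ch, valid_choice pos ends e P ch) /\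
  (forall P ch1 ch2, P \in configs ends e ->
     valid_choice pos ends e P ch1 -> valid_choice pos ends e P ch2 ->
     tau pos ends eta e ch1 = tau pos ends eta e ch2) /\
  (forall choice : {set E * bool} -> choice_t E n,
     (forall P, P \in configs ends e -> valid_choice pos ends e P (choice P)) ->
     pfaffian (Kinv_sub pos ends y eta e) =
     (Z_Ising ends y)^-1 *
       \sum_(P in configs ends e) tau pos ends eta e (choice P) * xw y P).
Proof.
move=> planar _ eta_sqr Z0 e_inj.
(* A direction generic for all differences of distinct vertices gives distinct heights. *)
pose diffs := [seq pos vw.1 - pos vw.2 | vw <- enum [pred vw : V * V | vw.1 != vw.2]].
have [|om [_ /allP omP]] := @generic_direction C diffs.
  apply/allP => z /mapP [[v w]]; rewrite mem_enum inE /= => vw ->.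
  by rewrite subr_eq0 (inj_eq (pos_inj planar)).
have om_generic v w : v != w -> im (om * (pos v - pos w)) != 0.
  by move=> vw; apply: omP; apply/mapP; exists (v, w); rewrite ?mem_enum.
have k0 := kappa_neq0 (dart_lt pos ends om) (gauge_sqr planar om_generic eta_sqr).
have tauE := PF_config_tau planar om_generic eta_sqr e_inj.
split; [|split] => [P cfgP|P ch1 ch2 cfgP v1 v2|choice vc].
- exact: (valid_choice_exists planar om_generic e_inj).
(* Both values times [kappa] equal the Pfaffian of the configuration, in which no choice occurs. *)
- by apply: (mulIf k0); rewrite -!(tauE P _ (fun _ _ => 0)).
have := PF_inverse planar om_generic eta_sqr e_inj Z0.
rewrite (eq_bigr (fun P => tau pos ends eta e (choice P) * xw y P * kappa (dart_lt pos ends om)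
  (gauge_sign pos ends om eta))) => [|P cfgP]; last first.
  by rewrite (tauE P (choice P) _ cfgP (vc P cfgP)) mulrCA mulrA.
by rewrite -mulr_suml mulrA => /(mulIf k0) <-; rewrite mulrC mulfK.
Qed.
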